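(* Fix $c>0$. There exists $l_0=l_0(c)>0$ such that for every $0<l<l_0$ the following holds: if $(Q_{11}^*,M_1^* )$ is a minimiser of the order reconstruction energy $$E(Q_{11}, M_1)= \int_{-1}^{1} \Big\{ \tfrac{l}{2} (Q_{11}')^2 + \tfrac{l}{2} (M_1')^2 + (Q_{11}^2 - 1)^2 + \tfrac{1}{4}\left(M_1^2 - 1\right)^2 - cQ_{11} M_1^2 \Big\}\,\mathrm{d}y$$ in the space $\mathcal{A}'$, then $(\mathbf{Q}^{OR},\mathbf{M}^{OR})=(Q_{11}^*,0,M_1^*,0)$ is an unstable critical point, in the admissible space $\mathcal{A}$, of the full energy $$F(Q_{11}, Q_{12}, M_1, M_2) = \int_{-1}^{1} \Big\{\tfrac{l}{2}\left[(Q_{11}')^2 + (Q_{12}')^2 + (M_1')^2 + (M_2')^2 \right] + \left( Q_{11}^2 + Q_{12}^2 - 1 \right)^2 + \tfrac{1}{4}\left(M_1^2 + M_2^2 - 1 \right)^2 - cQ_{11}\left(M_1^2 - M_2^2 \right) - 2c Q_{12}M_1 M_2 \Big\}\,\mathrm{d}y.$$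
   Context: Here $'$ denotes $\frac{\mathrm{d}}{\mathrm{d}y}$. $\mathcal{A}'$ is the set of pairs $(Q_{11},M_1)$ with both components in $W^{1,2}([-1,1];\mathbb{R})$, $Q_{11}(-1)=M_1(-1)=1$ and $Q_{11}(1)=M_1(1)=-1$. $\mathcal{A}$ is the set of all $(Q_{11},Q_{12},M_1,M_2)$ with every component in $W^{1,2}([-1,1];\mathbb{R})$ satisfying $Q_{11}(-1)=M_1(-1)=1$, $Q_{11}(1)=M_1(1)=-1$, $Q_{12}(\pm1)=M_2(\pm1)=0$. A critical point of $F$ in $\mathcal{A}$ is an element of $\mathcal{A}$ at which the first variation of $F$ vanishes for all perturbations with components in $W^{1,2}_0([-1,1])$. A critical point $(Q_{11},Q_{12},M_1,M_2)$ is unstable if there exist $g,h,v,w\in W^{1,2}_0([-1,1])$ for which the second variation is negative: $$\frac{\mathrm{d}^2}{\mathrm{d}t^2}\Big|_{t=0}F(Q_{11}+tg,\,Q_{12}+th,\,M_1+tv,\,M_2+tw)<0.$$ *)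

(* Defs.v *)
From HB Require Import structures.
From mathcomp Require Import all_boot all_order all_algebra.
From mathcomp Require Import all_classical all_reals all_analysis.

Set Implicit Arguments.
Unset Strict Implicit.
Unset Printing Implicit Defensive.

Import Order.TTheory GRing.Theory Num.Theory.
Import numFieldNormedType.Exports.

Local Open Scope classical_set_scope.
Local Open Scope ring_scope.

Section Sobolev.
Variable R : realType.
Implicit Types f g phi : R -> R.

Local Notation mu := (@lebesgue_measure R).

Definition channel : set R := `[-1, 1].

Definition integral_channel f : R := Rintegral mu channel f.

Definition L2 f : Prop :=
  measurable_fun channel f /\ mu.-integrable channel (EFin \o (fun y => f y ^+ 2)).

(* The class C^1_c(]-1, 1[); the support is bounded and closed, so it is
   compact as soon as it lies in the open interval. *)
Definition test_function phi : Prop :=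
  [/\ forall y, derivable phi y 1,
      continuous phi^`()%classic &
      closure [set y | phi y != 0] `<=` `]-1, 1[].

Definition is_weak_derivative f g : Prop :=
  L2 g /\
  forall phi, test_function phi ->
    integral_channel (fun y => f y * phi^`()%classic y) =
    - integral_channel (fun y => g y * phi y).

(* An element of W^{1,2} is represented by its continuous representative on
   [-1, 1], so that its boundary values are those of the function; values
   outside [-1, 1] are irrelevant. *)
Definition W12 f : Prop :=
  [/\ {within channel, continuous f}, L2 f & exists g, is_weak_derivative f g].

Definition W12_0 f : Prop := [/\ W12 f, f (-1) = 0 & f 1 = 0].

(* The weak derivative is unique only up to a null set: for f in W12 this
   picks one representative (and it is the zero function if f has none). *)
Definition weak_derivative f : R -> R :=
  xget (fun=> 0) [set g | is_weak_derivative f g].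

End Sobolev.

Section Energies.
Variables (R : realType) (l c : R).

Local Notation D := (@weak_derivative R).

Definition E (Q11 M1 : R -> R) : R :=
  integral_channel (fun y =>
    l / 2 * D Q11 y ^+ 2 + l / 2 * D M1 y ^+ 2
    + (Q11 y ^+ 2 - 1) ^+ 2 + 1 / 4 * (M1 y ^+ 2 - 1) ^+ 2
    - c * Q11 y * M1 y ^+ 2).

Definition F (Q11 Q12 M1 M2 : R -> R) : R :=
  integral_channel (fun y =>
    l / 2 * (D Q11 y ^+ 2 + D Q12 y ^+ 2 + D M1 y ^+ 2 + D M2 y ^+ 2)
    + (Q11 y ^+ 2 + Q12 y ^+ 2 - 1) ^+ 2
    + 1 / 4 * (M1 y ^+ 2 + M2 y ^+ 2 - 1) ^+ 2
    - c * Q11 y * (M1 y ^+ 2 - M2 y ^+ 2)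
    - 2 * c * Q12 y * M1 y * M2 y).

Definition admissible_OR (Q11 M1 : R -> R) : Prop :=
  [/\ W12 Q11, W12 M1,
      Q11 (-1) = 1 /\ M1 (-1) = 1 &
      Q11 1 = -1 /\ M1 1 = -1].

Definition admissible (Q11 Q12 M1 M2 : R -> R) : Prop :=
  [/\ [/\ W12 Q11, W12 Q12, W12 M1 & W12 M2],
      Q11 (-1) = 1 /\ M1 (-1) = 1,
      Q11 1 = -1 /\ M1 1 = -1,
      Q12 (-1) = 0 /\ Q12 1 = 0 &
      M2 (-1) = 0 /\ M2 1 = 0].

Definition minimiser_OR (Q11 M1 : R -> R) : Prop :=
  admissible_OR Q11 M1 /\
  forall P N : R -> R, admissible_OR P N -> E Q11 M1 <= E P N.

Definition F_along (Q11 Q12 M1 M2 g h v w : R -> R) (t : R) : R :=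
  F (fun y => Q11 y + t * g y) (fun y => Q12 y + t * h y)
    (fun y => M1 y + t * v y) (fun y => M2 y + t * w y).

Definition critical_point (Q11 Q12 M1 M2 : R -> R) : Prop :=
  admissible Q11 Q12 M1 M2 /\
  forall g h v w : R -> R, W12_0 g -> W12_0 h -> W12_0 v -> W12_0 w ->
    is_derive (0 : R) (1 : R) (F_along Q11 Q12 M1 M2 g h v w) 0.

Definition unstable (Q11 Q12 M1 M2 : R -> R) : Prop :=
  exists g h v w : R -> R,
    [/\ W12_0 g, W12_0 h, W12_0 v, W12_0 w &
        ((F_along Q11 Q12 M1 M2 g h v w)^`(2))%classic 0 < 0].

Definition unstable_critical_point (Q11 Q12 M1 M2 : R -> R) : Prop :=
  critical_point Q11 Q12 M1 M2 /\ unstable Q11 Q12 M1 M2.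

End Energies.

(* Main.v *)
(* The full energy is invariant under rotating Q by 2 theta and M by theta, so
   the second variation in the directions (0, h, 0, w) has the null field
   (h, w) = (2 Q, M), which only violates the boundary conditions. Writing
   h = 2 (Q + f1), w = M + f2, the second variation becomes a boundary flux plus
   a remainder that is explicit in (f1, f2). Near y = 1 take
   f1 = f2 = (1 - 4 Q - M) / 6, so that h and w vanish at the wall; there the
   remainder is at most - l (4 Q' + M')^2 / 1800, by the conservation of
   l / 2 (Q'^2 + M'^2) - W(Q, M), phase-plane bounds on (Q', M') and a polynomial
   inequality in (Q, M). If M vanishes before 4 Q + M = 1 is reached, the
   perturbation is continued by simpler choices of (f1, f2) until it matches
   (2 Q, M); this uses that M has a single zero. Comparison with a competitor in
   the bulk state shows that, for small l, all this takes place in a layer of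
   width O(eta) with eta arbitrarily small, which produces a gain of order
   l / eta, whereas cutting off (2 Q, M) linearly over the rest of the channel
   costs only O(l). *)

Require Import Defs.
From mathcomp Require Import all_boot all_order all_algebra.
From mathcomp Require Import all_classical all_reals all_analysis.
From mathcomp Require Import measurable_realfun ring lra.

Set Implicit Arguments.
Unset Strict Implicit.
Unset Printing Implicit Defensive.

Import Order.TTheory GRing.Theory Num.Theory.
Import numFieldNormedType.Exports.

Local Open Scope classical_set_scope.
Local Open Scope ring_scope.

(** * Calculus on the line *)

Section Calculus.
Variable R : realType.
Implicit Types (f g df : R -> R) (a b c x y : R).
Local Notation mu := (@lebesgue_measure R).

(** The weight 4 Q + M is dictated by the gradient terms of the remainder: for f1 = f2 = f they are
    l/2 f' (4 Q' + M' + 5 f'), so only 4 Q' + M' can be exploited, and f = (1 - 4 Q - M) / 6 turns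
    them into - l (4 Q' + M')^2 / 72. The potential terms are an obstacle: just off the wall they
    are positive, of first order in M + 1. They absorb 24/25 of the square; the 1/25 left is the
    factor 1/1800. This requires (4 Q' + M')^2 to be bounded below, which could fail if Q' and M'
    had opposite signs, hence the comparison 8 M' <= - 15 Q'. The bound itself comes from the
    Hamiltonian, which is at least c + c^2 = - W(1, sqrt(1 + 2 c)) because the minimum of W lies
    strictly below that value. Fluxes of adjacent pieces cancel, since (h, w) is continuous, and
    vanish at the walls, so only remainders and the cut-off cost have to be added up. The energies
    involve weak derivatives chosen up to null sets; the calculus above becomes available only after
    a minimiser is shown to be a classical solution. *)

Definition C1_on a b f df := forall y, a <= y -> y <= b ->
  is_derive y 1 f (df y) /\ {for y, continuous df}.

Lemma is_derive_continuous f y d : is_derive y 1 f d -> {for y, continuous f}.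
Proof. by move=> [/derivable1_diffP/differentiable_continuous]. Qed.

Lemma continuous_within f a b :
  (forall y, a <= y -> y <= b -> {for y, continuous f}) ->
  {within `[a, b], continuous f}.
Proof.
move=> cf; apply: continuous_in_subspaceT => y /set_mem/=.
by rewrite in_itv/= => /andP[]; exact: cf.
Qed.

Lemma nondecreasing_derive f df a b : a <= b ->
  (forall y, a <= y -> y <= b -> is_derive y 1 f (df y)) ->
  (forall y, a < y -> y < b -> 0 <= df y) -> f a <= f b.
Proof.
move=> ab fd d0; apply: (@ger0_derive1_ndecr _ f a b) => //.
- by move=> x; rewrite in_itv/= => /andP[ax xb]; have [] := fd x (ltW ax) (ltW xb).
- move=> x; rewrite in_itv/= => /andP[ax xb]; rewrite derive1E.
  by rewrite (@derive_val _ _ _ _ _ _ _ (fd x (ltW ax) (ltW xb))) d0.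
- by apply: continuous_within => y ay yb; exact: is_derive_continuous (fd y ay yb).
Qed.

Lemma increasing_derive f df a b : a < b ->
  (forall y, a <= y -> y <= b -> is_derive y 1 f (df y)) ->
  (forall y, a < y -> y < b -> 0 < df y) -> f a < f b.
Proof.
move=> ab fd d0.
have [||c] := @MVT _ f df a b ab.
- by move=> x; rewrite in_itv/= => /andP[/ltW ax /ltW xb]; exact: fd.
- by apply: continuous_within => y ay yb; exact: is_derive_continuous (fd y ay yb).
rewrite in_itv/= => /andP[ac cb] e; rewrite -subr_gt0 e mulr_gt0 ?d0//.
by rewrite subr_gt0.
Qed.

Lemma nonincreasing_derive f df a b : a <= b ->
  (forall y, a <= y -> y <= b -> is_derive y 1 f (df y)) ->
  (forall y, a < y -> y < b -> df y <= 0) -> f b <= f a.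
Proof.
move=> ab fd d0; rewrite -lerN2.
apply: (@nondecreasing_derive (fun x => - f x) (fun x => - df x)) => //.
- by move=> y ay yb; have fy := fd y ay yb; apply: is_deriveN.
- by move=> y ay yb; rewrite oppr_ge0 d0.
Qed.

(** The supremum of the points where [f] is nonnegative: seen from [b], the first zero to the left.
    The junction points of the perturbation are all found in this way. *)
Lemma first_hit_left f a b : a <= b ->
  (forall y, a <= y -> y <= b -> {for y, continuous f}) ->
  f b < 0 -> 0 <= f a ->
  exists c, [/\ a <= c, c < b, f c = 0 & forall y, c < y -> y <= b -> f y < 0].
Proof.
move=> ab cf fb fa.
pose A := [set y | a <= y <= b /\ 0 <= f y].
have Aa : A a by split=> //; rewrite lexx.
have ubA : ubound A b by move=> y [/andP[]].
have hsA : has_sup A by split; [exists a|exists b].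
have ac : a <= sup A by apply: ub_le_sup Aa; exists b.
have cb : sup A <= b by apply: ge_sup => //; exists a.
have lt0 y : sup A < y -> y <= b -> f y < 0.
  move=> cy yb; rewrite ltNge; apply/negP => fy0.
  suff : y <= sup A by rewrite leNgt cy.
  apply: (ub_le_sup (ex_intro _ b ubA)); split=> //.
  by rewrite yb andbT (le_trans ac)// ltW.
have fc_ge0 : 0 <= f (sup A).
  rewrite leNgt; apply/negP => fc0.
  have /cvgrPdist_lt/(_ (- f (sup A))) := cf _ ac cb.
  rewrite oppr_gt0 => /(_ fc0)[e/= e0 he].
  have [z [Az1 Az2] ez] := sup_adherent e0 hsA.
  have zle : z <= sup A by apply: (ub_le_sup (ex_intro _ b ubA)).
  have := he z; rewrite /ball_/= ger0_norm ?subr_ge0// => /(_ _).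
  have -> : sup A - z < e by lra.
  move=> /(_ isT); rewrite distrC ltr_norml => /andP[_]; lra.
exists (sup A); split=> //.
- by rewrite lt_neqAle cb andbT; apply/eqP => e; move: fc_ge0; rewrite e leNgt fb.
- apply/eqP; rewrite eq_le fc_ge0 andbT leNgt; apply/negP => fc0.
  have cltb : sup A < b.
    by rewrite lt_neqAle cb andbT; apply/eqP => e; move: fc_ge0; rewrite e leNgt fb.
  have /cvgrPdist_lt/(_ (f (sup A))) := cf _ ac cb.
  move=> /(_ fc0)[e/= e0 he].
  pose z := Num.min (sup A + e / 2) b.
  have zgt : sup A < z by rewrite /z lt_min cltb andbT ltrDl divr_gt0.
  have zb : z <= b by rewrite /z ge_min lexx orbT.
  have ze : z <= sup A + e / 2 by rewrite /z ge_min lexx.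
  have := he z; rewrite /ball_/= distrC ger0_norm ?subr_ge0; last exact: ltW.
  have -> : z - sup A < e by lra.
  move=> /(_ isT); have := lt0 z zgt zb; rewrite ltr_norml => ? /andP[]; lra.
Qed.

Lemma first_hit_right f a b : a <= b ->
  (forall y, a <= y -> y <= b -> {for y, continuous f}) ->
  f a < 0 -> 0 <= f b ->
  exists c, [/\ a < c, c <= b, f c = 0 & forall y, a <= y -> y < c -> f y < 0].
Proof.
move=> ab cf fa fb.
have [|y||| c [h1 h2 h3 h4]] := @first_hit_left (fun x => f (- x)) (- b) (- a).
- by rewrite lerN2.
- move=> yb ya; apply: (@continuous_comp _ _ _ (fun x => - x) f).
    exact: opp_continuous.
  by apply: cf; [rewrite lerNr|rewrite lerNl].
- by rewrite opprK.
- by rewrite opprK.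
exists (- c); split=> //; first by rewrite ltrNr.
- by rewrite lerNl.
- by move=> y ay yc; have := h4 (- y); rewrite opprK; apply; [rewrite ltrNr|rewrite lerN2].
Qed.

(** The second-derivative test in the role of a maximum principle: [df] vanishes at an interior
    maximum and has positive slope there, so it is positive just to the right and [f] rises above
    its maximum. *)
Lemma not_max_convex f df y k a b : a < y -> y < b ->
  (forall z, a <= z -> z <= b -> is_derive z 1 f (df z)) ->
  is_derive y 1 df k -> 0 < k ->
  (forall z, a <= z -> z <= b -> f z <= f y) -> False.
Proof.
move=> ay yb fd dk k0 fmax.
have dfy : df y = 0.
  have [_ <-] := fd y (ltW ay) (ltW yb).
  suff [] : is_derive y 1 f 0 by [].
  apply: (@derive1_at_max _ f a b) => //.
  - exact: ltW (lt_trans ay yb).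
  - by move=> t; rewrite in_itv/= => /andP[/ltW at_ /ltW tb]; case: (fd t at_ tb).
  - by rewrite in_itv/= ay.
  - by move=> t; rewrite in_itv/= => /andP[/ltW at_ /ltW tb]; exact: fmax.
have [dd dv] := dk.
have := dd; rewrite /derivable => /cvg_ex[l hl].
have lk : l = k by rewrite -dv; apply/esym/cvg_lim => //; exact: hl.
rewrite {}lk in hl.
move/cvgrPdist_lt: hl => /(_ k k0)[e/= e0 he].
pose d := Num.min (e / 2) (b - y).
have d0 : 0 < d by rewrite /d lt_min divr_gt0//= subr_gt0.
have : f y < f (y + d).
  apply: (@increasing_derive f df); first by rewrite ltrDl.
  - move=> z yz zd; apply: fd; first exact: le_trans (ltW ay) yz.
    by rewrite (le_trans zd)// -lerBrDl /d ge_min lexx orbT.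
  - move=> z yz zd; have zy0 : 0 < z - y by rewrite subr_gt0.
    have := he (z - y); rewrite /ball_/= distrC subr0 gtr0_norm// => /(_ _ _).
    have -> : z - y < e.
      have : d <= e / 2 by rewrite /d ge_min lexx.
      lra.
    rewrite gt_eqF// => /(_ isT isT).
    rewrite dfy subr0 /= [_ *: 1]mulr1 subrK [_ *: _]mulrC.
    rewrite ltr_norml => /andP[_]; rewrite ltrBlDr ltrDl.
    by rewrite pmulr_lgt0 // invr_gt0.
apply/negP; rewrite -leNgt; apply: fmax.
  by rewrite (le_trans (ltW ay))// lerDl ltW.
by rewrite -lerBrDl /d ge_min lexx orbT.
Qed.

Lemma is_derive_ext f g y d : (forall x, f x = g x) ->
  is_derive y 1 g d -> is_derive y 1 f d.
Proof. by move=> /funext ->. Qed.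

(** These rules are stated for functions written pointwise, because [deriv] and [cont] select a rule
    by matching on the body of the function. *)
Lemma is_derive_cstF (k y : R) : is_derive y 1 (fun=> k) 0.
Proof. exact: is_derive_cst. Qed.

Lemma is_derive_idF (y : R) : is_derive y 1 (fun x => x) 1.
Proof. exact: is_derive_id. Qed.

Lemma is_deriveDF f g y (a b : R) : is_derive y 1 f a -> is_derive y 1 g b ->
  is_derive y 1 (fun x => f x + g x) (a + b).
Proof. by move=> *; exact: is_deriveD. Qed.

Lemma is_deriveNF f y (a : R) : is_derive y 1 f a ->
  is_derive y 1 (fun x => - f x) (- a).
Proof. by move=> *; exact: is_deriveN. Qed.

Lemma is_deriveMF f g y (a b : R) : is_derive y 1 f a -> is_derive y 1 g b ->
  is_derive y 1 (fun x => f x * g x) (a * g y + f y * b).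
Proof.
move=> fa gb; have -> : a * g y + f y * b = f y *: b + g y *: a.
  by rewrite /GRing.scale /= addrC (mulrC a).
exact: is_deriveM.
Qed.

Lemma is_deriveXF f n y (a : R) : is_derive y 1 f a ->
  is_derive y 1 (fun x => f x ^+ n.+1) (n.+1%:R * f y ^+ n * a).
Proof.
move=> fa; elim: n => [|n IH].
  by rewrite expr0 mulr1 mul1r; apply: is_derive_ext fa => x; rewrite expr1.
apply: (@is_derive_ext _ (fun x => f x * f x ^+ n.+1)) => [x|]; first by rewrite exprS.
apply: is_derive_eq (is_deriveMF fa IH) _.
by rewrite exprS -[in RHS]natr1; ring.
Qed.

Lemma continuous_idF (y : R) : {for y, continuous (fun x : R => x)}.
Proof. by []. Qed.

Lemma continuous_cstF (k y : R) : {for y, continuous (fun _ : R => k)}.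
Proof. exact: cst_continuous. Qed.

Lemma continuousDF f g y : {for y, continuous f} -> {for y, continuous g} ->
  {for y, continuous (fun x => f x + g x)}.
Proof. by move=> *; exact: continuousD. Qed.

Lemma continuousNF f y : {for y, continuous f} ->
  {for y, continuous (fun x => - f x)}.
Proof. by move=> *; exact: continuousN. Qed.

Lemma continuousMF f g y : {for y, continuous f} -> {for y, continuous g} ->
  {for y, continuous (fun x => f x * g x)}.
Proof. by move=> *; exact: continuousM. Qed.

Lemma continuousXF f n y : {for y, continuous f} ->
  {for y, continuous (fun x => f x ^+ n)}.
Proof.
move=> cf; elim: n => [|n IH].
  have -> : (fun x => f x ^+ 0) = (fun=> 1) by apply/funext => x; rewrite expr0.
  exact: continuous_cstF.
have -> : (fun x => f x ^+ n.+1) = (fun x => f x * f x ^+ n).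
  by apply/funext => x; rewrite exprS.
exact: continuousMF.
Qed.

Lemma continuousVF f y : f y != 0 -> {for y, continuous f} ->
  {for y, continuous (fun x => (f x)^-1)}.
Proof. by move=> f0 cf; exact: continuousV. Qed.

End Calculus.

Ltac deriv_step := lazymatch goal with
  | |- is_derive _ _ (fun _ => ?k) _ => exact: is_derive_cstF
  | |- is_derive _ _ (fun x => x) _ => exact: is_derive_idF
  | |- is_derive _ _ (fun x => (@?f x + @?g x)%R) _ =>
      eapply (@is_deriveDF _ f g); [deriv_step|deriv_step]
  | |- is_derive _ _ (fun x => (- @?f x)%R) _ => eapply (@is_deriveNF _ f); deriv_step
  | |- is_derive _ _ (fun x => (@?f x ^+ _)%R) _ => eapply (@is_deriveXF _ f); deriv_step
  | |- is_derive _ _ (fun x => (@?f x * @?g x)%R) _ =>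
      eapply (@is_deriveMF _ f g); [deriv_step|deriv_step]
  | |- _ => eassumption
  end.

Ltac deriv := eapply is_derive_eq; [deriv_step|rewrite /=].

(* Keeping only the listed hypotheses makes the linear problem passed to [lra] small. *)
Tactic Notation "lin" hyp_list(hs) := clear - hs; lra.

Ltac cont := unfold prop_for; cbv beta; lazymatch goal with
  | |- continuous_at _ (fun _ => ?k) => exact: continuous_cstF
  | |- continuous_at _ (fun x => x) => exact: continuous_idF
  | |- continuous_at _ (fun x => (@?f x + @?g x)%R) =>
      apply (@continuousDF _ f g); cont
  | |- continuous_at _ (fun x => (- @?f x)%R) => apply (@continuousNF _ f); cont
  | |- continuous_at _ (fun x => (@?f x ^+ ?n)%R) => apply (@continuousXF _ f n); cont
  | |- continuous_at _ (fun x => (@?f x * @?g x)%R) =>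
      apply (@continuousMF _ f g); cont
  | |- _ => eassumption
  end.

(** * Integrals over segments *)

Section Integrals.
Variable R : realType.
Implicit Types (f g df : R -> R) (a b c x y : R).
Local Notation mu := (@lebesgue_measure R).
Local Notation int a b f := (\int[mu]_(x in `[a, b]) f x).
Local Notation intg a b f := (mu.-integrable `[a, b] (EFin \o f)).

Lemma within_continuous_integrable f a b :
  {within `[a, b], continuous f} -> intg a b f.
Proof. by move=> cf; apply: continuous_compact_integrable => //; exact: segment_compact. Qed.

Lemma continuous_integrable f a b :
  (forall y, a <= y -> y <= b -> {for y, continuous f}) -> intg a b f.
Proof. by move=> cf; apply: within_continuous_integrable; exact: continuous_within. Qed.

Lemma integrable_sub f a b c d : a <= c -> d <= b -> intg a b f -> intg c d f.
Proof.
move=> ac db; apply: integrableS => //; apply: subset_itv;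
  by rewrite bnd_simp.
Qed.

Lemma integrableD_fun f g a b : intg a b f -> intg a b g ->
  intg a b (fun x => f x + g x).
Proof.
move=> fi gi; have := integrableD _ fi gi => /(_ (measurable_itv _)).
by apply: eq_integrable => // x _.
Qed.

Lemma integrableZ_fun k f a b : intg a b f -> intg a b (fun x => k * f x).
Proof.
move=> fi; have := integrableZl _ k fi => /(_ (measurable_itv _)).
by apply: eq_integrable => // x _.
Qed.

Lemma integrableN_fun f a b : intg a b f -> intg a b (fun x => - f x).
Proof.
move=> fi; have := integrableZ_fun (-1) fi.
by apply: eq_integrable => // x _ /=; rewrite mulN1r.
Qed.

Lemma Rint_split f a b c : a <= c -> c <= b -> intg a b f ->
  int a b f = int a c f + int c b f.
Proof.
move=> ac cb fi.
have /= := @Rintegral_itvB R f (BLeft a) (BRight b) c fi.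
rewrite !bnd_simp => /(_ ac cb) h.
rewrite -(@Rintegral_itv_obnd_cbnd _ c); first by rewrite -h addrC subrK.
apply: integrableS fi => // x /=; rewrite !in_itv/= => /andP[cx ->].
by rewrite andbT (le_trans ac)// ltW.
Qed.

Lemma Rint_ae f g a b : measurable_fun `[a, b] f -> measurable_fun `[a, b] g ->
  {ae mu, forall x, a <= x <= b -> f x = g x} -> int a b f = int a b g.
Proof.
move=> mf mg fg; rewrite /Rintegral; congr fine.
apply: ae_eq_integral => //; [exact/measurable_EFinP|exact/measurable_EFinP|].
move: fg; apply: filterS; first exact: (ae_filter_ringOfSetsType mu).
move=> x h.
by rewrite /= in_itv/= => /h ->.
Qed.

(** Derivatives of piecewise functions are unspecified at the breakpoints. These form a null set, so
    agreement on the open interval has to suffice, here and in the next lemmas. *)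
Lemma measurable_eq_oo f g a b : measurable_fun `[a, b] f ->
  (forall x, a < x < b -> f x = g x) -> measurable_fun `[a, b] g.
Proof.
move=> mf fg; apply: (@measurable_fun_itv_cc _ a b false true).
apply: (@eq_measurable_fun _ _ _ _ _ f).
  by move=> x; rewrite inE/= in_itv/= => /fg.
by apply: measurable_funS mf => //; apply: subset_itv_oo_cc.
Qed.

Lemma integrable_measurable f a b : intg a b f -> measurable_fun `[a, b] f.
Proof. by case/integrableP => mf _; exact/measurable_EFinP. Qed.

Lemma Rint_eq_oo f g a b : intg a b f -> (forall x, a < x < b -> f x = g x) ->
  int a b f = int a b g.
Proof.
move=> /integrable_measurable mf fg; congr fine.
apply: eq_integral_itv_bounded.
- by apply: measurable_funS mf => //; apply: subset_itv_oo_cc.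
- have := measurable_eq_oo mf fg.
  by apply: measurable_funS => //; apply: subset_itv_oo_cc.
- by move=> x; rewrite in_itv/= => /fg.
Qed.

Lemma integrable_eq_oo f g a b : intg a b f ->
  (forall x, a < x < b -> f x = g x) -> intg a b g.
Proof.
move=> fi fg; have mf := integrable_measurable fi.
have mg := measurable_eq_oo mf fg.
apply/integrableP; split; first exact/measurable_EFinP.
move/integrableP : fi => [_].
rewrite (@integral_itv_bndoo _ _ _ (fun x => `|(EFin \o f) x|)%E); last first.
  apply: measurableT_comp => //; apply/measurable_EFinP.
  by apply: measurable_funS mf => //; apply: subset_itv_oo_cc.
rewrite (@integral_itv_bndoo _ _ _ (fun x => `|(EFin \o g) x|)%E); last first.
  apply: measurableT_comp => //; apply/measurable_EFinP.
  by apply: measurable_funS mg => //; apply: subset_itv_oo_cc.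
congr (_ < _)%E; apply: eq_integral => x; rewrite inE/= in_itv/= => /fg.
by move=> ->.
Qed.

Lemma ftc f df a b : a <= b -> C1_on a b f df -> int a b df = f b - f a.
Proof.
rewrite le_eqVlt => /predU1P[->|ab fd]; first by rewrite set_itv1 Rintegral_set1 subrr.
rewrite /Rintegral (@continuous_FTC2 _ _ f)//.
- by apply: continuous_within => y ay yb; case: (fd y ay yb).
- split.
  + by move=> x; rewrite in_itv/= => /andP[/ltW ax /ltW xb]; case: (fd x ax xb) => -[].
  + apply: cvg_at_right_filter; apply: is_derive_continuous (fd a _ _).1 => //.
    exact: ltW.
  + apply: cvg_at_left_filter; apply: is_derive_continuous (fd b _ _).1 => //.
    exact: ltW.
- move=> x; rewrite in_itv/= => /andP[/ltW ax /ltW xb]; rewrite derive1E.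
  by case: (fd x ax xb) => -[].
Qed.

Lemma primitive f a : (forall y, a <= y -> {for y, continuous f}) ->
  forall y, a < y -> is_derive y 1 (fun x => int a x f) (f y).
Proof.
move=> cf y ay.
have [||d e] := @continuous_FTC1_closed _ f a y (y + 1) _ _ ay (cf _ (ltW ay)).
- by rewrite ltrDl.
- by apply: continuous_integrable => z az _; exact: cf.
by apply: DeriveDef; [exact: d|rewrite -derive1E].
Qed.
End Integrals.

(** * Plateau test functions *)

Section Step.
Variable R : realType.
Implicit Types (f g df : R -> R) (a b c x y s : R).
Local Notation mu := (@lebesgue_measure R).

(** Test functions are only required to be C^1, so a transition function can be built from the
    squared positive part, whose derivative is explicit and continuous. *)
Definition sqpos s : R := Num.max 0 s ^+ 2.

Lemma is_derive_sqpos s : is_derive s 1 sqpos (2 * Num.max 0 s).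
Proof.
have [s0|s0|->] := ltgtP s 0.
- apply: (@near_eq_is_derive _ _ _ (cst 0)) => //.
    near=> z; rewrite /sqpos /= max_l ?expr0n//; apply: ltW; near: z.
    exact: lt_nbhsl.
  rewrite mulr0; exact: is_derive_cst.
- apply: (@near_eq_is_derive _ _ _ (fun x => x ^+ 2)) => //.
    near=> z; rewrite /sqpos /= max_r//; apply: ltW; near: z.
    exact: lt_nbhsr.
  have h := is_derive_idF s; deriv.
  by ring.
- rewrite mulr0.
  have cv : (fun h => h^-1 *: (sqpos (h *: 1 + 0) - sqpos 0)) @ 0^' --> (0 : R).
    apply/cvgrPdist_le => e e0; near=> h.
    rewrite addr0 /sqpos maxxx expr0n/= subr0 [h *: 1]mulr1 sub0r normrN.
    have h0 : h != 0 by near: h; exact: nbhs_dnbhs_neq.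
    have he : `|h| <= e.
      by near: h; exact: dnbhs0_le.
    rewrite normrM normfV; have [hn|hp] := leP 0 h.
      by rewrite normrX expr2 mulKf// normr_eq0.
    by rewrite expr0n/= normr0 mulr0 ltW.
  by split; [apply/cvg_ex; exists 0|apply/cvg_lim].
Unshelve. all: by end_near. Qed.

(** A C^1 transition from 0 to 1 across [0, 1]. The denominator is positive because s and 1 - s are
    never both nonpositive. *)
Definition step s : R := sqpos s / (sqpos s + sqpos (1 - s)).
Definition dstep s : R :=
  (2 * Num.max 0 s * (sqpos s + sqpos (1 - s)) -
   sqpos s * (2 * Num.max 0 s - 2 * Num.max 0 (1 - s))) /
  (sqpos s + sqpos (1 - s)) ^+ 2.

Lemma sqpos_ge0 s : 0 <= sqpos s.
Proof. by rewrite /sqpos exprn_even_ge0. Qed.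

Lemma step_den_gt0 s : 0 < sqpos s + sqpos (1 - s).
Proof.
have [s0|s0] := ltP 0 s.
  by rewrite ltr_pwDl ?sqpos_ge0// /sqpos max_r ?exprn_gt0// ltW.
by rewrite ltr_wpDl ?sqpos_ge0// /sqpos max_r ?exprn_gt0//; lra.
Qed.

Lemma sqpos_continuous : continuous sqpos.
Proof. by move=> s; exact: is_derive_continuous (is_derive_sqpos s). Qed.

Lemma max0_continuous : continuous (fun s : R => Num.max 0 s).
Proof.
by move=> s; apply: (@continuous_max _ _ (cst 0) id); [exact: cst_continuous|].
Qed.

Lemma is_derive_step s : is_derive s 1 step (dstep s).
Proof.
have d1 := is_derive_sqpos s.
have d2 : is_derive s 1 (fun s => sqpos (1 - s)) (- (2 * Num.max 0 (1 - s))).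
  have h := is_derive_sqpos (1 - s).
  have h2 : is_derive s 1 (fun s : R => 1 - s) (-1) by deriv; ring.
  by have := @is_derive1_comp _ sqpos (fun s : R => 1 - s) s _ _ h h2; rewrite mulrN1.
have dn := is_deriveDF d1 d2.
have den0 : sqpos s + sqpos (1 - s) != 0 by rewrite gt_eqF// step_den_gt0.
have dv := @is_deriveV _ (fun x => sqpos x + sqpos (1 - x)) s _ _ den0 dn.
apply: is_derive_eq (is_deriveMF d1 dv) _.
rewrite /dstep /GRing.scale /=; field.
exact: den0.
Qed.

Lemma dstep_continuous : continuous dstep.
Proof.
have c1 := sqpos_continuous.
have cm := max0_continuous.
have c2 (s : R) : {for s, continuous (fun s => sqpos (1 - s))}.
  apply: (@continuous_comp _ _ _ (fun s => 1 - s) sqpos); last exact: c1.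
  by cont.
have cm2 (s : R) : {for s, continuous (fun s : R => Num.max 0 (1 - s))}.
  apply: (@continuous_comp _ _ _ (fun s : R => 1 - s) (fun s => Num.max 0 s)); last exact: cm.
  by cont.
move=> s.
pose N s : R := 2 * Num.max 0 s * (sqpos s + sqpos (1 - s)) -
   sqpos s * (2 * Num.max 0 s - 2 * Num.max 0 (1 - s)).
pose D s : R := (sqpos s + sqpos (1 - s)) ^+ 2.
have h1 : {for s, continuous sqpos} by exact: c1.
have h2 := c2 s; have h3 := cm s; have h4 := cm2 s.
apply: (@continuousMF _ N (fun s => (D s)^-1)); last first.
  apply: (@continuousVF _ D); first by rewrite /D expf_neq0// gt_eqF// step_den_gt0.
  rewrite /D; cont.
rewrite /N; cont.
Qed.

Lemma dstep_ge0 s : 0 <= dstep s.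
Proof.
rewrite /dstep divr_ge0 ?sqr_ge0//.
have -> : 2 * Num.max 0 s * (sqpos s + sqpos (1 - s)) -
   sqpos s * (2 * Num.max 0 s - 2 * Num.max 0 (1 - s)) =
   2 * Num.max 0 s * sqpos (1 - s) + 2 * Num.max 0 (1 - s) * sqpos s by ring.
by rewrite addr_ge0// !mulr_ge0 ?sqpos_ge0// le_max lexx.
Qed.

Lemma step0 s : s <= 0 -> step s = 0.
Proof. by move=> s0; rewrite /step /sqpos max_l// expr0n/= mul0r. Qed.

Lemma step1 s : 1 <= s -> step s = 1.
Proof.
move=> s1; have : sqpos (1 - s) = 0 by rewrite /sqpos max_l ?expr0n//; lra.
rewrite /step => ->; rewrite addr0 divff// /sqpos max_r ?expf_neq0 ?gt_eqF//; lra.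
Qed.

Lemma dstep_out s : (s <= 0) || (1 <= s) -> dstep s = 0.
Proof.
case/orP => h; rewrite /dstep /sqpos.
  by rewrite (max_l h) expr0n/= !(mulr0, mul0r, subr0).
have -> : Num.max 0 (1 - s) = 0 by rewrite max_l//; lra.
apply/eqP; rewrite mulf_eq0; apply/orP; left; apply/eqP; ring.
Qed.

Lemma step_ge0 s : 0 <= step s.
Proof. by rewrite divr_ge0 ?sqpos_ge0// ltW// step_den_gt0. Qed.

Lemma step_le1 s : step s <= 1.
Proof. by rewrite ler_pdivrMr ?step_den_gt0// mul1r lerDl sqpos_ge0. Qed.

End Step.

(** * Ramps and plateaus: approximating point values and indicators *)

Section Plateau.
Variable R : realType.
Implicit Types (f g df : R -> R) (a b c x y s : R) (n : nat).
Local Notation mu := (@lebesgue_measure R).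
Local Notation int a b f := (\int[mu]_(x in `[a, b]) f x).
Local Notation intg a b f := (mu.-integrable `[a, b] (EFin \o f)).

(** A transition on [a, a + 1/(n+1)]. Its derivative is an approximate identity at [a], and a
    difference of two ramps is a test function close to an indicator. *)
Definition ramp n a x : R := step (n.+1%:R * (x - a)).
Definition dramp n a x : R := n.+1%:R * dstep (n.+1%:R * (x - a)).

Lemma is_derive_ramp n a x : is_derive x 1 (ramp n a) (dramp n a x).
Proof.
have h := is_derive_step (n.+1%:R * (x - a)).
have h2 : is_derive x 1 (fun x => n.+1%:R * (x - a)) n.+1%:R by deriv; ring.
have := @is_derive1_comp _ (@step R) (fun x => n.+1%:R * (x - a)) x _ _ h h2.
by rewrite mulrC.
Qed.

Lemma dramp_continuous n a : continuous (dramp n a).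
Proof.
move=> x; apply: (@continuousMF _ (fun=> n.+1%:R) (fun x => dstep (n.+1%:R * (x - a)))).
  exact: continuous_cstF.
apply: (@continuous_comp _ _ _ (fun x => n.+1%:R * (x - a)) (@dstep R)).
  have : {for x, continuous (fun x => n.+1%:R * (x - a))} by cont.
  by [].
exact: dstep_continuous.
Qed.

Lemma ramp_lt n a x : x <= a -> ramp n a x = 0.
Proof.
by move=> xa; rewrite /ramp step0// pmulr_rle0 ?ltr0Sn// subr_le0.
Qed.

Lemma ramp_gt n a x : a + n.+1%:R^-1 <= x -> ramp n a x = 1.
Proof.
by move=> xa; rewrite /ramp step1// -ler_pdivrMl ?ltr0Sn// mulr1 lerBrDl.
Qed.

Lemma dramp_ge0 n a x : 0 <= dramp n a x.
Proof. by rewrite mulr_ge0// dstep_ge0. Qed.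

Lemma dramp_out n a x : (x <= a) || (a + n.+1%:R^-1 <= x) -> dramp n a x = 0.
Proof.
move=> h; rewrite /dramp dstep_out ?mulr0//.
case/orP: h => h; apply/orP; [left|right].
  by rewrite pmulr_rle0 ?ltr0Sn// subr_le0.
by rewrite -ler_pdivrMl ?ltr0Sn// mulr1 lerBrDl.
Qed.

Lemma ramp_ge0 n a x : 0 <= ramp n a x. Proof. exact: step_ge0. Qed.
Lemma ramp_le1 n a x : ramp n a x <= 1. Proof. exact: step_le1. Qed.

Lemma derive1_funE f df : (forall x, is_derive x 1 f (df x)) -> f^`()%classic = df.
Proof. by move=> h; apply/funext => x; rewrite derive1E; case: (h x). Qed.

Lemma ramp_test n a b : -1 < a -> a <= b -> b + n.+1%:R^-1 < 1 ->
  test_function (fun x => ramp n a x - ramp n b x).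
Proof.
move=> a1 ab b1.
have d x : is_derive x 1 (fun x => ramp n a x - ramp n b x)
    (dramp n a x - dramp n b x).
  have h1 := is_derive_ramp n a x; have h2 := is_derive_ramp n b x; deriv.
  by [].
split.
- by move=> y; case: (d y).
- rewrite (derive1_funE d) => x.
  have h1 := @dramp_continuous n a x; have h2 := @dramp_continuous n b x.
  exact: (@continuousDF _ (dramp n a) (fun x => - dramp n b x)  _ h1 (continuousNF h2)).
- rewrite closureE; apply: (@subset_trans _ `[a, b + n.+1%:R^-1]).
    apply: smallest_sub; first exact: itv_closed.
    move=> x /= /eqP h; rewrite in_itv/=; apply/andP; split; rewrite leNgt; apply/negP => xx.
      by apply: h; rewrite !ramp_lt ?subr0 ?(ltW xx)// (le_trans (ltW xx)).
    apply: h; rewrite !ramp_gt ?subrr//; first exact: ltW.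
    by apply: le_trans (ltW xx); rewrite lerD2r.
  move=> x /=; rewrite !in_itv/= => /andP[h1 h2].
  by rewrite (lt_le_trans a1 h1) (le_lt_trans h2 b1).
Qed.

Lemma within_continuous_in f a b x : {within `[a, b], continuous f} -> a < x < b ->
  {for x, continuous f}.
Proof.
move=> cf axb; have ab : a < b by case/andP: axb => /lt_trans; apply.
by have [+ _ _] := (continuous_within_itvP f ab).1 cf; apply; rewrite in_itv.
Qed.

(** [dramp n a] is nonnegative, has mass 1 and lives on [a, a + 1/(n+1)], so the integral is an
    average of [f] just to the right of [a]. *)
Lemma cvg_ramp f a : {within `[-1, 1], continuous f} -> -1 < a -> a < 1 ->
  (fun n => int (-1) 1 (fun x => f x * dramp n a x)) @ \oo --> f a.
Proof.
move=> cf a1 a2.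
have ca : {for a, continuous f} by apply: within_continuous_in cf _; rewrite a1.
apply/cvgrPdist_le => e e0.
have /cvgrPdist_le/(_ e e0)[d/= d0 hd] := ca.
have md0 : 0 < Num.min (d / 2) (1 - a) by rewrite lt_min divr_gt0//= subr_gt0.
near=> n.
have nd : n.+1%:R^-1 < Num.min (d / 2) (1 - a).
  by near: n; exact: (near_infty_natSinv_lt (PosNum md0)).
have {nd}[nd na] : n.+1%:R^-1 < d / 2 /\ a + n.+1%:R^-1 < 1.
  by move: nd; rewrite lt_min => /andP[-> h]; split=> //; rewrite addrC -ltrBrDr.
have id1 : int (-1) 1 (dramp n a) = 1.
  rewrite (@ftc _ (ramp n a)) ?lerN10//.
    by rewrite ramp_gt ?ltW// ramp_lt ?subr0// ltW.
  by move=> y _ _; split; [exact: is_derive_ramp|exact: dramp_continuous].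
have ig : intg (-1) 1 (dramp n a).
  by apply: continuous_integrable => y _ _; exact: dramp_continuous.
have cd : {within `[-1, 1], continuous (dramp n a)}.
  by apply: continuous_within => y _ _; exact: dramp_continuous.
have fg : intg (-1) 1 (fun x => f x * dramp n a x).
  by apply: within_continuous_integrable => x; apply: continuousM; [exact: cf|exact: cd].
have -> : f a = int (-1) 1 (fun x => f a * dramp n a x).
  by rewrite RintegralZl// id1 mulr1.
have ig2 := integrableZ_fun (f a) ig.
rewrite -RintegralB//.
apply: le_trans (le_normr_Rintegral _ _) _ => //.
  by apply: integrableD_fun => //; apply: integrableN_fun.
have -> : e = int (-1) 1 (fun x => e * dramp n a x).
  by rewrite RintegralZl// id1 mulr1.
apply: le_Rintegral => //.
- apply: (@integrable_abse _ _ _ mu `[(-1), 1] (EFin \o (fun x => f a * dramp n a x - f x * dramp n a x))).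
  by apply: integrableD_fun => //; apply: integrableN_fun.
- exact: integrableZ_fun.
- move=> x _; rewrite -mulrBl normrM [X in _ * X <= _]ger0_norm ?dramp_ge0//.
  have [h|] := boolP ((x <= a) || (a + n.+1%:R^-1 <= x)).
    by rewrite dramp_out// !mulr0.
  rewrite negb_or -!ltNge => /andP[h1 h2]; rewrite ler_wpM2r ?dramp_ge0//.
  apply: hd; rewrite /ball_/=.
  move: nd h2; set r := _^-1 => nd h2; rewrite ltr_norml; lra.
Unshelve. all: by end_near. Qed.

End Plateau.

(** * Weak derivatives *)

Section Weak.
Variable R : realType.
Implicit Types (f g h df : R -> R) (a b c x y s : R) (n : nat).
Local Notation mu := (@lebesgue_measure R).
Local Notation int a b f := (\int[mu]_(x in `[a, b]) f x).
Local Notation intg a b f := (mu.-integrable `[a, b] (EFin \o f)).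

Lemma integrable_cst k a b : intg a b (fun=> k).
Proof. by apply: continuous_integrable => y _ _; exact: continuous_cstF. Qed.

Lemma le_integrable_fun f g a b : measurable_fun `[a, b] f ->
  (forall x, a <= x <= b -> `|f x| <= g x) -> intg a b g -> intg a b f.
Proof.
move=> mf fg gi; apply: (le_integrable _ _ _ gi) => //; first exact/measurable_EFinP.
move=> x /=; rewrite in_itv/= => xab; rewrite lee_fin (le_trans (fg _ xab))//.
exact: ler_norm.
Qed.

Lemma L2M_integrable f g : L2 f -> L2 g -> intg (-1) 1 (fun x => f x * g x).
Proof.
move=> [mf fi] [mg gi].
apply: (@le_integrable_fun _ (fun x => f x ^+ 2 + g x ^+ 2)).
- exact: measurable_funM.
- move=> x _; rewrite normrM -(real_normK (num_real (f x))).
  rewrite -[leRHS](addrC) -(real_normK (num_real (g x))).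
  have := sqr_ge0 (`|f x| - `|g x|); have := sqr_ge0 `|f x|.
  have := sqr_ge0 (`|g x|); nra.
- exact: integrableD_fun.
Qed.

Lemma L2_cst k : L2 (fun _ : R => k).
Proof. by split; [exact: measurable_cst|exact: integrable_cst]. Qed.

Lemma L2_integrable f : L2 f -> intg (-1) 1 f.
Proof.
move=> f2; have := L2M_integrable f2 (L2_cst 1).
by apply: eq_integrable => // x _ /=; rewrite mulr1.
Qed.

Lemma L2_continuous f : {within `[-1, 1], continuous f} -> L2 f.
Proof.
move=> cf; split.
  exact: integrable_measurable (within_continuous_integrable cf).
have : {within `[-1, 1], continuous (fun x => f x * f x)}.
  by move=> x; apply: continuousM; exact: cf.
by move/within_continuous_integrable; apply: eq_integrable => // x _ /=; rewrite expr2.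
Qed.

Lemma L2D f g : L2 f -> L2 g -> L2 (fun x => f x + g x).
Proof.
move=> f2 g2; have fg := L2M_integrable f2 g2.
case: f2 g2 => [mf fi] [mg gi]; split; first exact: measurable_funD.
have := integrableD_fun (integrableD_fun fi (integrableZ_fun 2 fg)) gi.
by apply: eq_integrable => // x _ /=; congr EFin; ring.
Qed.

Lemma L2Z k f : L2 f -> L2 (fun x => k * f x).
Proof.
move=> [mf fi]; split; first by apply: measurable_funM => //; exact: measurable_cst.
have := integrableZ_fun (k ^+ 2) fi.
by apply: eq_integrable => // x _ /=; congr EFin; ring.
Qed.

Lemma cvg_plateau g a b : intg (-1) 1 g -> -1 < a -> a <= b -> b < 1 ->
  (fun n => int (-1) 1 (fun x => g x * (ramp n a x - ramp n b x))) @ \oo -->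
  int a b g.
Proof.
move=> gi a1 ab b1.
have mg := integrable_measurable gi.
have mr n : measurable_fun (`[(-1 : R), 1]%classic) (fun x : R => ramp n a x - ramp n b x).
  apply: integrable_measurable; apply: continuous_integrable => y _ _.
  have h1 := is_derive_continuous (is_derive_ramp n a y).
  have h2 := is_derive_continuous (is_derive_ramp n b y).
  exact: (@continuousDF _ (ramp n a) (fun x => - ramp n b x)  _ h1 (continuousNF h2)).
(* A ramp vanishes at its own base point, so in the limit [a] is excluded and [b] is kept. *)
pose F : R -> R := g \_ `]a, b].
have cF x : -1 <= x <= 1 ->
    (fun n => (g x * (ramp n a x - ramp n b x))%:E) @ \oo --> (F x)%:E.
  move=> _; apply: cvg_near_cst; rewrite /F patchE.
  have [ax|xa] := ltP a x; last first.
    near=> n; rewrite /= memNset; last by rewrite /= in_itv/= ltNge xa.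
    by rewrite !ramp_lt ?subr0 ?mulr0// (le_trans xa).
  have x0 : 0 < x - a by rewrite subr_gt0.
  have [xb|bx] := leP x b.
    near=> n; rewrite mem_set; last by rewrite /= in_itv/= ax xb.
    rewrite /= (ramp_lt n xb) ramp_gt ?subr0 ?mulr1//.
    rewrite addrC -lerBrDr ltW//; near: n; exact: (near_infty_natSinv_lt (PosNum x0)).
  have x1 : 0 < x - b by rewrite subr_gt0.
  near=> n; rewrite memNset; last by rewrite /= in_itv/= leNgt bx andbF.
  rewrite /= !ramp_gt ?subrr ?mulr0//.
    rewrite addrC -lerBrDr ltW//; near: n; exact: (near_infty_natSinv_lt (PosNum x1)).
  rewrite addrC -lerBrDr ltW//; near: n; exact: (near_infty_natSinv_lt (PosNum x0)).
have sub : `[(-1 : R), 1]%classic `&` `]a, b]%classic = `]a, b]%classic.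
  rewrite setIC; apply/setIidPl => x /=; rewrite !in_itv/= => /andP[h1 h2].
  by rewrite (le_trans (ltW a1) (ltW h1)) (le_trans h2 (ltW b1)).
have mF : measurable_fun (`[(-1 : R), 1]%classic) F.
  apply/(measurable_restrict g (measurable_itv _) (measurable_itv _)).
  by rewrite sub; apply: measurable_funS mg => //; rewrite -sub; apply: subIsetl.
have [|||||_ _] := @dominated_convergence _ _ _ mu `[-1, 1]%classic (measurable_itv _)
  (fun n x => (g x * (ramp n a x - ramp n b x))%:E) (EFin \o F) (fun x => `|g x|%:E) .
- move=> n; apply: (@measurableT_comp _ _ _ _ _ _ EFin) => //.
  exact: (@measurable_funM _ _ _ _ g (fun x : R => ramp n a x - ramp n b x) mg (mr n)).
- by apply/measurable_EFinP.
- by apply: aeW => x /=; rewrite in_itv/=; exact: cF.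
- exact: (@integrable_abse _ _ _ mu `[(-1), 1] (EFin \o g)).
- apply: aeW => x n _; rewrite lee_fin normrM ler_piMr// ler_norml.
  have := ramp_le1 n a x; have := ramp_ge0 n b x.
  have := ramp_ge0 n a x; have := ramp_le1 n b x; lra.
have -> : (\int[mu]_(x in `[(-1)%R, 1%R]) (EFin \o F) x)%E = (int a b g)%:E.
  have gab : intg a b g by apply: integrable_sub gi; exact: ltW.
  have goab : mu.-integrable `]a, b] (EFin \o g).
    by apply: integrableS gab => //; exact: subset_itv_oc_cc.
  rewrite -(@Rintegral_itv_obnd_cbnd _ a)// /Rintegral fineK; last exact: integrable_fin_num.
  rewrite -{1}sub integral_mkcondr; apply: eq_integral => x _.
  by rewrite /F /= !patchE; case: ifP.
by move/fine_cvg.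
Unshelve. all: try by end_near.
Qed.

End Weak.

(** * Fundamental theorem and uniqueness for weak derivatives *)

Section WeakFtc.
Variable R : realType.
Implicit Types (f g h df : R -> R) (a b c x y s k : R) (n : nat).
Local Notation mu := (@lebesgue_measure R).
Local Notation int a b f := (\int[mu]_(x in `[a, b]) f x).
Local Notation intg a b f := (mu.-integrable `[a, b] (EFin \o f)).

Lemma eq_Rint f g a b : (forall x, a <= x -> x <= b -> f x = g x) -> int a b f = int a b g.
Proof.
move=> fg; apply: eq_Rintegral => x; rewrite inE/= in_itv/= => /andP[]; exact: fg.
Qed.

Lemma le_Rint f g a b : intg a b f -> intg a b g ->
  (forall x, a <= x -> x <= b -> f x <= g x) -> int a b f <= int a b g.
Proof.
move=> fi gi fg; apply: le_Rintegral => // x /=; rewrite in_itv/= => /andP[]; exact: fg.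
Qed.

Lemma RintD f g a b : intg a b f -> intg a b g ->
  int a b (fun x => f x + g x) = int a b f + int a b g.
Proof. by move=> *; rewrite RintegralD. Qed.

Lemma RintB f g a b : intg a b f -> intg a b g ->
  int a b (fun x => f x - g x) = int a b f - int a b g.
Proof. by move=> *; rewrite RintegralB. Qed.

Lemma RintZ k f a b : intg a b f -> int a b (fun x => k * f x) = k * int a b f.
Proof. by move=> *; rewrite RintegralZl. Qed.

Lemma Rint_cst k a b : a <= b -> int a b (fun=> k) = k * (b - a).
Proof.
move=> ab; rewrite (@ftc _ (fun x => k * x))//; first by rewrite mulrBr.
move=> y _ _; split; last exact: continuous_cstF.
deriv; ring.
Qed.

Lemma integrableB_fun f g a b : intg a b f -> intg a b g ->
  intg a b (fun x => f x - g x).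
Proof. by move=> fi gi; apply: integrableD_fun => //; exact: integrableN_fun. Qed.

Lemma eq_integrable_fun f g a b : (forall x, a <= x -> x <= b -> f x = g x) ->
  intg a b f -> intg a b g.
Proof.
move=> fg; apply: eq_integrable => // x; rewrite inE/= in_itv/= => /andP[h1 h2].
by rewrite fg.
Qed.

(** Test with [ramp n a - ramp n b]: its derivative extracts f a - f b in the limit, while the
    plateau tends to an indicator. The endpoints have to be interior for the support to be compact
    in ]-1, 1[. *)
Lemma weak_ftc_oo f g a b : {within `[-1, 1], continuous f} ->
  is_weak_derivative f g -> -1 < a -> a <= b -> b < 1 -> f b - f a = int a b g.
Proof.
move=> cf [g2 fg] a1 ab b1.
have gi := L2_integrable g2.
have a2 : a < 1 := le_lt_trans ab b1.
have b2 : -1 < b := lt_le_trans a1 ab.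
have h1 := cvg_plateau gi a1 ab b1.
have h2 : (fun n => int (-1) 1 (fun x => f x * dramp n a x) -
    int (-1) 1 (fun x => f x * dramp n b x)) @ \oo --> f a - f b.
  by apply: cvgB; exact: cvg_ramp.
suff e : f a - f b = - int a b g by rewrite -[RHS]opprK -e opprB.
rewrite -(cvg_lim _ h2)//; apply: cvg_lim => //.
apply: cvg_trans _ (cvgN h1); apply: near_eq_cvg; rewrite /=.
have b0 : 0 < 1 - b by rewrite subr_gt0.
near=> n.
have bn : b + n.+1%:R^-1 < 1.
  by rewrite addrC -ltrBrDr; near: n; exact: (near_infty_natSinv_lt (PosNum b0)).
have fd c : intg (-1) 1 (fun x => f x * dramp n c x).
  have cd : {within `[-1, 1], continuous (dramp n c)}.
    by apply: continuous_within => y _ _; exact: dramp_continuous.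
  by apply: within_continuous_integrable => x; apply: continuousM; [exact: cf|exact: cd].
have := fg _ (ramp_test a1 ab bn).
have d x : is_derive x 1 (fun x => ramp n a x - ramp n b x)
    (dramp n a x - dramp n b x).
  have ha := is_derive_ramp n a x; have hb := is_derive_ramp n b x; deriv.
  by [].
rewrite (derive1_funE d) /integral_channel => /esym e.
rewrite -RintB//; rewrite /channel in e.
rewrite [LHS]e; apply: eq_Rint => x _ _; ring.
Unshelve. all: by end_near. Qed.

Lemma cst_oo_cc f k a b : a < b -> {within `[a, b], continuous f} ->
  (forall x, a < x < b -> f x = k) -> forall x, a <= x -> x <= b -> f x = k.
Proof.
move=> ab /(continuous_within_itvP _ ab)[_ fa fb] fk x.
rewrite le_eqVlt => /predU1P[<- _|ax].
  rewrite -(cvg_lim _ fa)//; apply: lim_near_cst => //.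
  near=> y; apply: fk; apply/andP; split; near: y; [exact: nbhs_right_gt|exact: nbhs_right_lt].
rewrite le_eqVlt => /predU1P[->|xb]; last by rewrite fk// ax.
rewrite -(cvg_lim _ fb)//; apply: lim_near_cst => //.
near=> y; apply: fk; apply/andP; split; near: y; [exact: nbhs_left_gt|exact: nbhs_left_lt].
Unshelve. all: by end_near. Qed.

Lemma ltrN11 : (-1 : R) < 1. Proof. by lra. Qed.

Lemma primitive_within f a b : a <= b -> intg a b f ->
  {within `[a, b], continuous (fun x => int a x f)}.
Proof. exact: parameterized_integral_continuous. Qed.

Lemma weak_ftc f g a b : {within `[-1, 1], continuous f} ->
  is_weak_derivative f g -> -1 <= a -> a <= b -> b <= 1 -> f b - f a = int a b g.
Proof.
move=> cf fg a1 ab b1; have gi := L2_integrable fg.1.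
(* [f] minus the primitive of [g] takes its value at 0 throughout the open interval; continuity
   carries that value to -1 and 1. *)
pose k := f 0 - int (-1) 0 g.
suff fk x : -1 <= x -> x <= 1 -> f x - int (-1) x g = k.
  have ea := fk a a1 (le_trans ab b1); have := fk b (le_trans a1 ab) b1.
  rewrite -ea (@Rint_split _ g (-1) b a)//; last exact: integrable_sub gi.
  move: (int (-1) a g) (int a b g) => u v; clear; move=> h; rewrite -[f b](subrK (u + v)) h; ring.
apply: (@cst_oo_cc (fun x => f x - int (-1) x g)); first exact: ltrN11.
  have cp : {within `[-1, 1], continuous (fun x => int (-1) x g)}.
    by apply: primitive_within => //; lra.
  by move=> y; apply: (@continuousB _ _ _ (f : subspace _ -> _) _ y); [exact: cf|exact: cp].
move=> y /andP[y1 y2].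
have gs u v : -1 <= u -> v <= 1 -> intg u v g by move=> *; exact: integrable_sub gi.
have alg (p q u v : R) : p - q = v -> p - (u + v) = q - u by clear; lra.
have alg' (p q u v : R) : q - p = v -> p - u = q - (u + v) by clear; lra.
rewrite /k; have [y0|y0] := leP 0 y.
  rewrite (@Rint_split _ g (-1) y 0)// ?lerN10//; last by rewrite gs// ltW.
  by apply: alg; apply: weak_ftc_oo => //; rewrite ltrN10.
rewrite (@Rint_split _ g (-1) 0 y)// ?ltW//; last by rewrite gs.
by apply: alg'; apply: weak_ftc_oo => //; exact: ltW.
Qed.

(** The difference integrates to zero over every [-1, y], hence vanishes almost everywhere by
    Lebesgue differentiation; [FTC1] is applied to its extension by zero to the line. *)
Lemma weak_derivative_unique f g1 g2 : {within `[-1, 1], continuous f} ->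
  is_weak_derivative f g1 -> is_weak_derivative f g2 ->
  {ae mu, forall x, -1 <= x <= 1 -> g1 x = g2 x}.
Proof.
move=> cf fg1 fg2.
pose d x := g1 x - g2 x.
have g1i := L2_integrable fg1.1; have g2i := L2_integrable fg2.1.
have di : intg (-1) 1 d by exact: integrableB_fun.
pose d' := d \_ `[-1, 1].
have d'i : mu.-integrable setT (EFin \o d').
  have := (@integrable_mkcond _ _ R mu (`[(-1 : R), 1]%classic) (EFin \o d) (measurable_itv _)).1 di.
  by apply: eq_integrable => // x _; rewrite /d' /= !patchE; case: ifP.
have := @FTC1 R d' (BLeft (-1)).
move=> /(_ _ (open_integrable_locally openT d'i)) h.
have di' y : intg (-1) y d' by apply: integrableS d'i.
have {}h := h di'; rewrite /= in h.
have {}h : {ae mu, forall x, -1 < x -> derivable (fun x => int (-1) x d') x 1 /\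
    ((fun x => int (-1) x d')^`())%classic x = d' x}.
  move: h; apply: filterS; first exact: (ae_filter_ringOfSetsType mu).
  by move=> x hx x1; apply: hx; rewrite lte_fin.
have aen x0 : {ae mu, forall x, x != x0 :> R}.
  exists [set x0]; split => //; first exact: lebesgue_measure_set1.
  by move=> x /= /negP; rewrite negbK => /eqP.
have aeF : Filter (nbhs (almost_everywhere mu)) := ae_filter_ringOfSetsType mu.
near=> x => /andP[x1 x2].
have n1 : x != 1 by near: x; exact: aen.
have n2 : x != -1 by near: x; exact: aen.
have {}x1 : -1 < x by rewrite lt_neqAle eq_sym n2.
have {}x2 : x < 1 by rewrite lt_neqAle n1.
have [//|_ ] : -1 < x -> derivable (fun x => int (-1) x d') x 1 /\
    ((fun x => int (-1) x d')^`())%classic x = d' x.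
  by near: x.
rewrite {2}/d' patchE mem_set; last by rewrite /= in_itv/= !ltW.
rewrite derive1E (_ : 'D_1 _ x = 0).
  by move/esym/eqP; rewrite subr_eq0 => /eqP.
rewrite (@near_eq_derive _ _ _ _ (fun=> 0)); first exact: derive_cst.
have : x \in `]-1, 1[ by rewrite in_itv/= x1.
move=> /near_in_itvoo; apply: filterS => y; rewrite in_itv/= => /andP[y1 y2].
have -> : int (-1) y d' = int (-1) y d.
  apply: eq_Rint => z z1 zy; rewrite /d' patchE mem_set// /= in_itv/= z1/=.
  exact: le_trans zy (ltW y2).
rewrite /d RintB; last 2 first.
  by apply: integrable_sub g1i; rewrite // ltW.
  by apply: integrable_sub g2i; rewrite // ltW.
by rewrite -(weak_ftc cf fg1) -?(weak_ftc cf fg2) ?subrr// ltW.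
Unshelve. all: by end_near. Qed.
End WeakFtc.

(** * Piecewise C^1 functions *)

Section Sobolev.
Variable R : realType.
Implicit Types (f g h df phi : R -> R) (a b c x y s k : R) (n : nat).
Local Notation mu := (@lebesgue_measure R).
Local Notation int a b f := (\int[mu]_(x in `[a, b]) f x).
Local Notation intg a b f := (mu.-integrable `[a, b] (EFin \o f)).

Lemma test_functionP phi : test_function phi ->
  exists dphi, [/\ phi^`()%classic = dphi, forall a b, C1_on a b phi dphi,
    phi (-1) = 0 & phi 1 = 0].
Proof.
move=> [d c s]; exists (phi^`()%classic); split=> //.
- move=> a b y _ _; split; last exact: c.
  by split; [exact: d|rewrite derive1E].
- apply/eqP; apply: contrapT => /negP h.
  have h' : [set y | phi y != 0] (-1) by [].
  have := s (-1) (subset_closure h'); rewrite /= in_itv/= => /andP[]; lra.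
- apply/eqP; apply: contrapT => /negP h.
  have h' : [set y | phi y != 0] 1 by [].
  have := s 1 (subset_closure h'); rewrite /= in_itv/= => /andP[]; lra.
Qed.

Lemma C1_on_sub a b a' b' f df : a <= a' -> b' <= b -> C1_on a b f df -> C1_on a' b' f df.
Proof.
move=> aa bb fd y ay yb; apply: fd; [exact: le_trans aa ay|exact: le_trans yb bb].
Qed.

Lemma C1_on_within a b f df : C1_on a b f df -> {within `[a, b], continuous f}.
Proof.
move=> fd; apply: continuous_within => y ay yb.
exact: is_derive_continuous (fd y ay yb).1.
Qed.

Lemma within_integrableM f g a b : intg a b (fun x => f x ^+ 2) -> measurable_fun `[a, b] f ->
  {within `[a, b], continuous g} -> intg a b (fun x => f x * g x).
Proof.
move=> fi mf cg.
have gi := within_continuous_integrable cg.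
have : {within `[a, b], continuous (fun x => g x * g x)}.
  by move=> x; apply: continuousM; exact: cg.
move=> /within_continuous_integrable ggi.
apply: (@le_integrable_fun _ _ (fun x => f x ^+ 2 + g x * g x)).
- by apply: measurable_funM => //; exact: integrable_measurable.
- move=> x _; rewrite normrM -(real_normK (num_real (f x))).
  rewrite -[g x * g x]expr2 -(real_normK (num_real (g x))).
  have := sqr_ge0 (`|f x| - `|g x|); have := sqr_ge0 `|f x|.
  have := (sqr_ge0 `|g x|); nra.
- exact: integrableD_fun.
Qed.

Lemma weak_derivativeD f1 g1 f2 g2 :
  {within `[-1, 1], continuous f1} -> {within `[-1, 1], continuous f2} ->
  is_weak_derivative f1 g1 -> is_weak_derivative f2 g2 ->
  is_weak_derivative (fun x => f1 x + f2 x) (fun x => g1 x + g2 x).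
Proof.
move=> c1 c2 [g12 fg1] [g22 fg2]; split; first exact: L2D.
move=> phi tphi; have := fg1 _ tphi; have := fg2 _ tphi.
have [dphi [-> cphi _ _]] := test_functionP tphi.
have cd : {within `[-1, 1], continuous dphi}.
  by apply: continuous_within => y; move=> h1 h2; case: (cphi (-1) 1 y h1 h2).
have cp := C1_on_within (cphi (-1) 1).
have lf1 := L2_continuous c1; have lf2 := L2_continuous c2.
rewrite /integral_channel /channel => e2 e1.
transitivity (int (-1) 1 (fun y => f1 y * dphi y) + int (-1) 1 (fun y => f2 y * dphi y)).
  rewrite -RintD; last 2 first.
  - by apply: within_integrableM => //; case: lf1.
  - by apply: within_integrableM => //; case: lf2.
  by apply: eq_Rint => x _ _; rewrite mulrDl.
rewrite e1 e2 -opprD -RintD; last 2 first.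
  - by apply: within_integrableM => //; case: g12.
  - by apply: within_integrableM => //; case: g22.
by congr (- _); apply: eq_Rint => x _ _; rewrite mulrDl.
Qed.

Lemma weak_derivativeZ k f g : {within `[-1, 1], continuous f} ->
  is_weak_derivative f g -> is_weak_derivative (fun x => k * f x) (fun x => k * g x).
Proof.
move=> c1 [g2 fg1]; split; first exact: L2Z.
move=> phi tphi; have := fg1 _ tphi.
have [dphi [-> cphi _ _]] := test_functionP tphi.
have cd : {within `[-1, 1], continuous dphi}.
  by apply: continuous_within => y; move=> h1 h2; case: (cphi (-1) 1 y h1 h2).
have cp := C1_on_within (cphi (-1) 1).
have lf1 := L2_continuous c1.
rewrite /integral_channel /channel => e1.
transitivity (k * int (-1) 1 (fun y => f y * dphi y)).
  rewrite -RintZ; last by apply: within_integrableM => //; case: lf1.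
  by apply: eq_Rint => x _ _; rewrite mulrA.
rewrite e1 mulrN -RintZ; last by apply: within_integrableM => //; case: g2.
by congr (- _); apply: eq_Rint => x _ _; rewrite mulrA.
Qed.

Lemma withinDF f g a b : {within `[a, b], continuous f} -> {within `[a, b], continuous g} ->
  {within `[a, b], continuous (fun x => f x + g x)}.
Proof.
move=> cf cg y; apply: (@continuousD _ _ _ (f : subspace _ -> _) (g : subspace _ -> _) y).
  exact: cf.
exact: cg.
Qed.

Lemma withinMF f g a b : {within `[a, b], continuous f} -> {within `[a, b], continuous g} ->
  {within `[a, b], continuous (fun x => f x * g x)}.
Proof.
by move=> cf cg y; apply: continuousM; [exact: cf|exact: cg].
Qed.

Lemma within_cst k a b : {within `[a, b], continuous (fun _ : R => k)}.
Proof. by move=> y; exact: cst_continuous. Qed.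

Lemma W12_weak f : W12 f -> is_weak_derivative f (weak_derivative f).
Proof. by move=> [_ _]; exact: xgetPex. Qed.

Lemma W12_unique f g : W12 f -> is_weak_derivative f g ->
  {ae mu, forall x, -1 <= x <= 1 -> weak_derivative f x = g x}.
Proof.
move=> wf fg; have [cf _ _] := wf.
by apply: weak_derivative_unique fg => //; exact: W12_weak.
Qed.

Lemma W12_intro f g : {within `[-1, 1], continuous f} -> is_weak_derivative f g -> W12 f.
Proof. by move=> cf fg; split=> //; [exact: L2_continuous|exists g]. Qed.

Lemma W12_affine f g k : W12 f -> W12 g -> W12 (fun x => f x + k * g x).
Proof.
move=> wf wg; have [cf _ _] := wf; have [cg _ _] := wg.
have ckg : {within `[-1, 1], continuous (fun x => k * g x)}.
  by apply: withinMF => //; exact: within_cst.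
apply: (@W12_intro _ (fun x => weak_derivative f x + k * weak_derivative g x)).
  exact: withinDF.
by apply: weak_derivativeD => //; [exact: W12_weak|apply: weak_derivativeZ => //; exact: W12_weak].
Qed.

Lemma weak_derivative_affine f g k : W12 f -> W12 g ->
  {ae mu, forall x, -1 <= x <= 1 -> weak_derivative (fun x => f x + k * g x) x =
     weak_derivative f x + k * weak_derivative g x}.
Proof.
move=> wf wg; have [cf _ _] := wf; have [cg _ _] := wg.
have ckg : {within `[-1, 1], continuous (fun x => k * g x)}.
  by apply: withinMF => //; exact: within_cst.
apply: W12_unique; first exact: W12_affine.
by apply: weak_derivativeD => //; [exact: W12_weak|apply: weak_derivativeZ => //; exact: W12_weak].
Qed.

(* [g] is the derivative of [f] except possibly at the finitely many breakpoints. *)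
Inductive pc1 f g : R -> R -> Prop :=
| Pc1_smooth a b f0 g0 : a < b -> C1_on a b f0 g0 ->
    (forall x, a <= x -> x <= b -> f x = f0 x) ->
    (forall x, a < x -> x < b -> g x = g0 x) -> pc1 f g a b
| Pc1_cat a b c : pc1 f g a b -> pc1 f g b c -> pc1 f g a c.

Lemma pc1_lt f g a b : pc1 f g a b -> a < b.
Proof. by elim=> // {}a {}b c _ + _; exact: lt_trans. Qed.

Lemma pc1_C1 a b f g : a < b -> C1_on a b f g -> pc1 f g a b.
Proof. by move=> ab fg; exact: (Pc1_smooth ab fg). Qed.

Lemma eq_pc1 f g f' g' a b : (forall x, a <= x -> x <= b -> f' x = f x) ->
  (forall x, a < x -> x < b -> g' x = g x) -> pc1 f g a b -> pc1 f' g' a b.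
Proof.
move=> ff gg h; elim: h ff gg => [{}a {}b f0 g0 ab fg ef eg ff gg|
    {}a {}b c h1 IH1 h2 IH2 ff gg].
  by apply: (Pc1_smooth ab fg) => x h1 h2; [rewrite ff// ef|rewrite gg// eg].
have [ab bc] := (pc1_lt h1, pc1_lt h2).
apply: (Pc1_cat (IH1 _ _) (IH2 _ _)) => x x1 x2.
- by apply: ff => //; exact: le_trans x2 (ltW bc).
- by apply: gg => //; exact: lt_trans x2 bc.
- by apply: ff => //; exact: le_trans (ltW ab) x1.
- by apply: gg => //; exact: lt_trans ab x1.
Qed.

Lemma pc1_within f g a b : pc1 f g a b -> {within `[a, b], continuous f}.
Proof.
elim=> [{}a {}b f0 g0 ab fg ef eg|{}a {}b c h1 IH1 h2 IH2].
  apply: (@subspace_eq_continuous _ _ _ f0); last exact: C1_on_within fg.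
  by move=> x; rewrite inE/= in_itv/= => /andP[x1 x2]; exact/esym/ef.
have [ab bc] := (pc1_lt h1, pc1_lt h2).
have -> : `[a, c]%classic = `[a, b] `|` `[b, c].
  apply/seteqP; split => x /=; rewrite !in_itv/=.
    by move=> /andP[-> ->]; rewrite andbT; exact: orP (le_total x b).
  by move=> [] /andP[h3 h4]; apply/andP; split=> //; apply: le_trans h3 h4 || idtac;
    [exact: le_trans h4 (ltW bc)|exact: le_trans (ltW ab) h3].
by apply: withinU_continuous => //; exact: itv_closed.
Qed.

Lemma integrable_cat f a b c : a <= b -> b <= c -> intg a b f -> intg b c f -> intg a c f.
Proof.
move=> ab bc h1 h2.
have {}h2 : mu.-integrable `]b, c] (EFin \o f).
  by apply: integrableS h2 => //; exact: subset_itv_oc_cc.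
have -> : `[a, c]%classic = `[a, b] `|` `]b, c].
  by rewrite -itv_bndbnd_setU// bnd_simp.
move/integrableP : h1 => [m1 i1]; move/integrableP : h2 => [m2 i2].
have mU : measurable_fun (`[a, b] `|` `]b, c]) (EFin \o f) by apply/measurable_funU.
apply/integrableP; split => //; rewrite ge0_integral_setU//.
- exact: lte_add_pinfty.
- by apply: measurableT_comp.
- apply/eqP; rewrite -subset0 => x [] /=; rewrite !in_itv/= => /andP[_ h] /andP[+ _].
  by rewrite ltNge h.
Qed.

Lemma pc1_integrable f g (G : R -> R -> R) a b : pc1 f g a b ->
  (forall x z, {for x, continuous z} -> {for x, continuous (fun y => G y (z y))}) ->
  intg a b (fun x => G x (g x)).
Proof.
move=> + cG; elim=> [{}a {}b f0 g0 ab fg ef eg|{}a {}b c h1 IH1 h2 IH2]; last first.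
  exact: integrable_cat (ltW (pc1_lt h1)) (ltW (pc1_lt h2)) IH1 IH2.
apply: (@integrable_eq_oo _ (fun x => G x (g0 x))).
  by apply: continuous_integrable => y ay yb; apply: cG; case: (fg y ay yb).
by move=> x /andP[x1 x2]; rewrite eg.
Qed.

Lemma pc1_integrable1 f g a b : pc1 f g a b -> intg a b g.
Proof. by move=> h; apply: (pc1_integrable (G := fun _ z => z) h). Qed.

(** On a smooth piece this is the fundamental theorem for the product. At a breakpoint the boundary
    terms of the two neighbours cancel because [f] has one value there. *)
Lemma pc1_parts f g phi dphi a b : pc1 f g a b -> C1_on a b phi dphi ->
  intg a b (fun x => g x * phi x) /\
  int a b (fun x => f x * dphi x) = f b * phi b - f a * phi a - int a b (fun x => g x * phi x).
Proof.
elim=> [{}a {}b f0 g0 ab fg ef eg|{}a {}b c h1 IH1 h2 IH2] hp.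
  have [i1 i2] : intg a b (fun x => f0 x * dphi x) /\ intg a b (fun x => g0 x * phi x).
    split; apply: continuous_integrable => y ay yb; have [d1 c1] := fg y ay yb;
    have [d2 c2] := hp y ay yb;
    have ? := is_derive_continuous d1; have ? := is_derive_continuous d2; cont.
  split; first by apply: (integrable_eq_oo i2) => x /andP[? ?]; rewrite eg.
  rewrite -(@Rint_eq_oo _ _ (fun x => g x * phi x) _ _ i2); last by move=> x /andP[? ?]; rewrite eg.
  have -> : int a b (fun x => f x * dphi x) = int a b (fun x => f0 x * dphi x).
    by apply: eq_Rint => x ? ?; rewrite ef.
  rewrite !ef ?lexx// ?ltW//; apply/eqP; rewrite eq_sym subr_eq eq_sym; apply/eqP.
  rewrite -RintD//.
  apply: (@ftc _ (fun x => f0 x * phi x)); first exact: ltW.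
  move=> y ay yb; have [d1 c1] := fg y ay yb; have [d2 c2] := hp y ay yb.
  have ? := is_derive_continuous d1; have ? := is_derive_continuous d2.
  split; last by cont.
  by deriv; ring.
have [ab bc] := (ltW (pc1_lt h1), ltW (pc1_lt h2)).
have hp1 := C1_on_sub (lexx a) bc hp; have hp2 := C1_on_sub ab (lexx c) hp.
have [i1 e1] := IH1 hp1; have [i2 e2] := IH2 hp2.
have ii := integrable_cat ab bc i1 i2; split=> //.
rewrite (Rint_split ab bc ii) (Rint_split ab bc) ?e1 ?e2; first by ring.
apply: within_continuous_integrable; apply: withinMF.
  exact: pc1_within (Pc1_cat h1 h2).
by apply: continuous_within => y ay yb; case: (hp y ay yb).
Qed.

Lemma pc1_weak f g : pc1 f g (-1) 1 -> is_weak_derivative f g.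
Proof.
move=> h; split.
  split; first exact: integrable_measurable (pc1_integrable1 h).
  by apply: (pc1_integrable (G := fun _ z => z ^+ 2) h) => x z cz; exact: continuousXF.
move=> phi /test_functionP[dphi [-> cphi p1 p2]].
have [_] := pc1_parts h (cphi (-1) 1).
by rewrite p1 p2 !mulr0 subrr sub0r.
Qed.

Lemma pc1_W12 f g : pc1 f g (-1) 1 -> W12 f.
Proof. by move=> h; apply: W12_intro (pc1_within h) (pc1_weak h). Qed.

Lemma pc1_D f g : pc1 f g (-1) 1 ->
  {ae mu, forall x, -1 <= x <= 1 -> weak_derivative f x = g x}.
Proof. by move=> h; apply: W12_unique (pc1_W12 h) (pc1_weak h). Qed.

Lemma pc1_cst k a b : a < b -> pc1 (fun=> k) (fun=> 0) a b.
Proof.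
move=> ab; apply: pc1_C1 => // y _ _; split; last exact: continuous_cstF.
exact: is_derive_cstF.
Qed.

Definition glue b f g x := if x <= b then f x else g x.

Lemma pc1_glue f1 g1 f2 g2 a b c : pc1 f1 g1 a b -> pc1 f2 g2 b c -> f1 b = f2 b ->
  pc1 (glue b f1 f2) (glue b g1 g2) a c.
Proof.
move=> h1 h2 e; apply: (@Pc1_cat _ _ a b c).
  by apply: eq_pc1 h1 => x _ xb; rewrite /glue ?xb// ltW.
apply: eq_pc1 h2 => x bx _; rewrite /glue; last by rewrite leNgt bx.
by case: ifP => // xb; have -> : x = b by apply/eqP; rewrite eq_le xb.
Qed.
End Sobolev.

(** * Expansion of the energy *)

Section Expansion.
Variable R : realType.
Implicit Types (f g h v w df phi Q P M N : R -> R) (a b x y s k t : R) (n : nat).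
Local Notation mu := (@lebesgue_measure R).
Local Notation int a b f := (\int[mu]_(x in `[a, b]) f x).
Local Notation intg a b f := (mu.-integrable `[a, b] (EFin \o f)).
Local Notation D := (@weak_derivative R).

Lemma withinNF f a b : {within `[a, b], continuous f} ->
  {within `[a, b], continuous (fun x => - f x)}.
Proof.
move=> cf; have -> : (fun x => - f x) = (fun x => -1 * f x) by apply/funext => x; rewrite mulN1r.
by apply: withinMF => //; exact: within_cst.
Qed.

Lemma withinXF f n a b : {within `[a, b], continuous f} ->
  {within `[a, b], continuous (fun x => f x ^+ n)}.
Proof.
move=> cf; elim: n => [|n IH].
  have -> : (fun x => f x ^+ 0) = (fun=> 1) by apply/funext => x; rewrite expr0.
  exact: within_cst.
have -> : (fun x => f x ^+ n.+1) = (fun x => f x * f x ^+ n).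
  by apply/funext => x; rewrite exprS.
exact: withinMF.
Qed.

Lemma W12_L2 f : W12 f -> L2 (D f).
Proof. by move=> /W12_weak[]. Qed.

Lemma W12_cst k : W12 (fun _ : R => k).
Proof. exact: pc1_W12 (pc1_cst k (ltrN11 _)). Qed.

Lemma D_cst k : {ae mu, forall x, -1 <= x <= 1 -> D (fun=> k) x = 0}.
Proof. exact: pc1_D (pc1_cst k (ltrN11 _)). Qed.

Lemma W120_0 : W12_0 (fun _ : R => 0).
Proof. by split=> //; exact: W12_cst. Qed.

Variables l c : R.

Definition Fdens (q p m n dq dp dm dn : R) : R :=
  l / 2 * (dq ^+ 2 + dp ^+ 2 + dm ^+ 2 + dn ^+ 2)
  + (q ^+ 2 + p ^+ 2 - 1) ^+ 2 + 1 / 4 * (m ^+ 2 + n ^+ 2 - 1) ^+ 2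
  - c * q * (m ^+ 2 - n ^+ 2) - 2 * c * p * m * n.

(** A name for continuity on the segment, so that [wcont_step] can match on the shape of the
    function. *)
Definition within_cont a b f := {within `[a, b], continuous f}.

Lemma within_contC k a b : within_cont a b (fun=> k).
Proof. exact: within_cst. Qed.
Lemma within_contD f g a b : within_cont a b f -> within_cont a b g ->
  within_cont a b (fun x => f x + g x).
Proof. exact: withinDF. Qed.
Lemma within_contM f g a b : within_cont a b f -> within_cont a b g ->
  within_cont a b (fun x => f x * g x).
Proof. exact: withinMF. Qed.
Lemma within_contN f a b : within_cont a b f -> within_cont a b (fun x => - f x).
Proof. exact: withinNF. Qed.
Lemma within_contX f n a b : within_cont a b f -> within_cont a b (fun x => f x ^+ n).
Proof. exact: withinXF. Qed.

Ltac wcont_step := lazymatch goal with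
  | |- within_cont _ _ (fun _ => ?k) => exact: within_contC
  | |- within_cont _ _ (fun x => (@?f x + @?g x)%R) =>
      apply (@within_contD f g); wcont_step
  | |- within_cont _ _ (fun x => (- @?f x)%R) => apply (@within_contN f); wcont_step
  | |- within_cont _ _ (fun x => (@?f x * @?g x)%R) =>
      apply (@within_contM f g); wcont_step
  | |- within_cont _ _ (fun x => (@?f x ^+ ?n)%R) => apply (@within_contX f n); wcont_step
  | |- _ => assumption
  end.

Lemma within_cont_integrable f : within_cont (-1) 1 f -> intg (-1) 1 f.
Proof. exact: within_continuous_integrable. Qed.

Ltac wcont := apply: within_cont_integrable; wcont_step.

Lemma Fdens_integrable Q P M N dq dp dm dn :
  {within `[-1, 1], continuous Q} -> {within `[-1, 1], continuous P} ->
  {within `[-1, 1], continuous M} -> {within `[-1, 1], continuous N} ->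
  L2 dq -> L2 dp -> L2 dm -> L2 dn ->
  intg (-1) 1 (fun y => Fdens (Q y) (P y) (M y) (N y) (dq y) (dp y) (dm y) (dn y)).
Proof.
move=> cQ cP cM cN [_ iq] [_ ip] [_ im] [_ iN].
have i1 := integrableZ_fun (l / 2) (integrableD_fun (integrableD_fun (integrableD_fun iq ip) im) iN).
have i2 : intg (-1) 1 (fun y => (Q y ^+ 2 + P y ^+ 2 - 1) ^+ 2 + 1 / 4 * (M y ^+ 2 + N y ^+ 2 - 1) ^+ 2
  - c * Q y * (M y ^+ 2 - N y ^+ 2) - 2 * c * P y * M y * N y).
  by wcont.
apply: eq_integrable_fun (integrableD_fun i1 i2) => x _ _.
rewrite /Fdens; ring.
Qed.

(** [weak_derivative] is a choice, so on a sum it is additive only almost everywhere. Here arbitrary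
    representatives may replace the chosen ones under the integral. *)
Lemma F_weakE Q P M N dq dp dm dn : W12 Q -> W12 P -> W12 M -> W12 N ->
  L2 dq -> L2 dp -> L2 dm -> L2 dn ->
  {ae mu, forall x, -1 <= x <= 1 -> D Q x = dq x} ->
  {ae mu, forall x, -1 <= x <= 1 -> D P x = dp x} ->
  {ae mu, forall x, -1 <= x <= 1 -> D M x = dm x} ->
  {ae mu, forall x, -1 <= x <= 1 -> D N x = dn x} ->
  F l c Q P M N = int (-1) 1 (fun y => Fdens (Q y) (P y) (M y) (N y) (dq y) (dp y) (dm y) (dn y)).
Proof.
move=> wQ wP wM wN iq ip im iN eq ep em en.
have [[cQ _ _] [cP _ _] [cM _ _] [cN _ _]] := And4 wQ wP wM wN.
rewrite /F /integral_channel.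
apply: Rint_ae.
- have := Fdens_integrable cQ cP cM cN (W12_L2 wQ) (W12_L2 wP) (W12_L2 wM) (W12_L2 wN).
  exact: integrable_measurable.
- have := Fdens_integrable cQ cP cM cN iq ip im iN.
  exact: integrable_measurable.
- have aeF : Filter (nbhs (almost_everywhere mu)) := ae_filter_ringOfSetsType mu.
  near=> x => hx.
  have -> : D Q x = dq x by move: hx; near: x.
  have -> : D P x = dp x by move: hx; near: x.
  have -> : D M x = dm x by move: hx; near: x.
  have -> : D N x = dn x by move: hx; near: x.
  by [].
Unshelve. all: by end_near. Qed.

(** [coef1] to [coef4] are the coefficients of t, ..., t^4 in the density of [F] at (Q + t g, t h, M
    + t v, t w). The first contains neither h nor w, which is why stationarity for [E] gives
    stationarity for [F]. *)
Definition coef1 (q m g v dq dm dg dv : R) : R :=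
  l * (dq * dg) + l * (dm * dv) + (4 * (q ^+ 2 - 1) * q * g + (m ^+ 2 - 1) * m * v
  - c * g * m ^+ 2 - 2 * c * q * m * v).

Definition coef2 (q m g h v w dg dh dv dw : R) : R :=
  l / 2 * (dg * dg + dh * dh + dv * dv + dw * dw) + (2 * (q ^+ 2 - 1) * (g ^+ 2 + h ^+ 2)
   + 4 * q ^+ 2 * g ^+ 2 + 1 / 2 * (m ^+ 2 - 1) * (v ^+ 2 + w ^+ 2) + m ^+ 2 * v ^+ 2
   - c * (q * (v ^+ 2 - w ^+ 2) + 2 * g * m * v) - 2 * c * h * m * w).

Definition coef3 (q m g h v w : R) : R :=
  4 * q * g * (g ^+ 2 + h ^+ 2) + m * v * (v ^+ 2 + w ^+ 2) - c * g * (v ^+ 2 - w ^+ 2)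
  - 2 * c * h * v * w.

Definition coef4 (g h v w : R) : R := (g ^+ 2 + h ^+ 2) ^+ 2 + 1 / 4 * (v ^+ 2 + w ^+ 2) ^+ 2.

Definition var1 Q M g v := int (-1) 1 (fun y => coef1 (Q y) (M y) (g y) (v y)
  (D Q y) (D M y) (D g y) (D v y)).

Definition var2 Q M g h v w := int (-1) 1 (fun y => coef2 (Q y) (M y) (g y) (h y) (v y) (w y)
  (D g y) (D h y) (D v y) (D w y)).

Lemma intg_DD f g : W12 f -> W12 g -> intg (-1) 1 (fun y => D f y * D g y).
Proof. by move=> wf wg; apply: L2M_integrable; exact: W12_L2. Qed.

Lemma coef1_integrable Q M g v : W12 Q -> W12 M -> W12 g -> W12 v ->
  intg (-1) 1 (fun y => coef1 (Q y) (M y) (g y) (v y) (D Q y) (D M y) (D g y) (D v y)).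
Proof.
move=> wQ wM wg wv.
have [[cQ _ _] [cM _ _] [cg _ _] [cv _ _]] := And4 wQ wM wg wv.
apply: integrableD_fun; first by apply: integrableD_fun; apply: integrableZ_fun; exact: intg_DD.
by wcont.
Qed.

Lemma coef2_integrable Q M g h v w : W12 Q -> W12 M -> W12 g -> W12 h -> W12 v -> W12 w ->
  intg (-1) 1 (fun y => coef2 (Q y) (M y) (g y) (h y) (v y) (w y)
    (D g y) (D h y) (D v y) (D w y)).
Proof.
move=> wQ wM wg wh wv ww.
have [[cQ _ _] [cM _ _] [cg _ _] [cv _ _]] := And4 wQ wM wg wv.
have [[ch _ _] [cw _ _]] := conj wh ww.
apply: integrableD_fun.
  by apply: integrableZ_fun; do 3?[apply: integrableD_fun]; exact: intg_DD.
by wcont.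
Qed.

(** The density is a quartic polynomial in t, so both variations are read off as coefficients
    instead of differentiating under the integral. *)
Lemma F_expansion Q M g h v w : W12 Q -> W12 M -> W12 g -> W12 h -> W12 v -> W12 w ->
  exists A3 A4, F_along l c Q (fun=> 0) M (fun=> 0) g h v w =
    (fun t => F l c Q (fun=> 0) M (fun=> 0) + var1 Q M g v * t + var2 Q M g h v w * t ^+ 2 +
      A3 * t ^+ 3 + A4 * t ^+ 4).
Proof.
move=> wQ wM wg wh wv ww.
have [[cQ _ _] [cM _ _] [cg _ _] [cv _ _]] := And4 wQ wM wg wv.
have [[ch _ _] [cw _ _]] := conj wh ww.
have i1 := coef1_integrable wQ wM wg wv.
have i2 := coef2_integrable wQ wM wg wh wv ww.
have i3 : intg (-1) 1 (fun y => coef3 (Q y) (M y) (g y) (h y) (v y) (w y)).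
  by rewrite /coef3; wcont.
have i4 : intg (-1) 1 (fun y => coef4 (g y) (h y) (v y) (w y)).
  by rewrite /coef4; wcont.
have c0 := @within_cst _ (0 : R) (-1) 1.
have w0 := W12_cst 0; have L0 := L2_cst (0 : R).
have [LQ LM Lg Lv] := And4 (W12_L2 wQ) (W12_L2 wM) (W12_L2 wg) (W12_L2 wv).
have [Lh Lw] := conj (W12_L2 wh) (W12_L2 ww).
have i0 := Fdens_integrable cQ c0 cM c0 LQ L0 LM L0.
have aeF : Filter (nbhs (almost_everywhere mu)) := ae_filter_ringOfSetsType mu.
exists (int (-1) 1 (fun y => coef3 (Q y) (M y) (g y) (h y) (v y) (w y))).
exists (int (-1) 1 (fun y => coef4 (g y) (h y) (v y) (w y))).
apply/funext => t; rewrite /F_along.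
rewrite (@F_weakE _ _ _ _ (fun y => D Q y + t * D g y) (fun y => t * D h y)
   (fun y => D M y + t * D v y) (fun y => t * D w y)); last 1 first.
- have := weak_derivative_affine t w0 ww; have := D_cst 0.
  by apply: filterS2 => x e1 e2 hx; rewrite e2// e1// add0r.
all: try exact: W12_affine.
all: try by apply: L2D => //; exact: L2Z.
all: try exact: L2Z.
all: try exact: weak_derivative_affine.
- rewrite (@F_weakE _ _ _ _ (D Q) (fun=> 0) (D M) (fun=> 0))//; last 4 first.
  + by apply: nearW.
  + exact: D_cst.
  + by apply: nearW.
  + exact: D_cst.
  rewrite /var1 /var2 ![_ * t ^+ _]mulrC [_ * t]mulrC -!RintZ//.
  rewrite -!RintD//; do ?[apply: integrableD_fun => //]; do ?[exact: integrableZ_fun].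
  by apply: eq_Rint => x _ _; rewrite /Fdens /coef1 /coef2 /coef3 /coef4; field.
- have := weak_derivative_affine t w0 wh; have := D_cst 0.
  by apply: filterS2 => x e1 e2 hx; rewrite e2// e1// add0r.
Qed.

Lemma E_F Q M : W12 Q -> W12 M -> E l c Q M = F l c Q (fun=> 0) M (fun=> 0).
Proof.
move=> wQ wM; have w0 := W12_cst 0; have L0 := L2_cst (0 : R).
rewrite (@F_weakE _ _ _ _ (D Q) (fun=> 0) (D M) (fun=> 0))//.
- by apply: eq_Rint => x _ _; rewrite /Fdens; field.
- exact: W12_L2.
- exact: W12_L2.
- exact: nearW.
- exact: D_cst.
- exact: nearW.
- exact: D_cst.
Qed.

Lemma quartic_derive (p : R -> R) A0 A1 A2 A3 A4 :
  p = (fun t => A0 + A1 * t + A2 * t ^+ 2 + A3 * t ^+ 3 + A4 * t ^+ 4) ->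
  is_derive (0 : R) (1 : R) p A1 /\ (p^`(2))%classic 0 = 2 * A2.
Proof.
move=> ->.
have d t : is_derive t 1 (fun t => A0 + A1 * t + A2 * t ^+ 2 + A3 * t ^+ 3 + A4 * t ^+ 4)
  (A1 + 2 * A2 * t + 3 * A3 * t ^+ 2 + 4 * A4 * t ^+ 3) by deriv; ring.
have d2 t : is_derive t 1 (fun t => A1 + 2 * A2 * t + 3 * A3 * t ^+ 2 + 4 * A4 * t ^+ 3)
  (2 * A2 + 6 * A3 * t + 12 * A4 * t ^+ 2) by deriv; ring.
split; first by apply: is_derive_eq (d 0) _; ring.
rewrite /derive1n /= (derive1_funE d) (derive1_funE d2); ring.
Qed.

Lemma minimiser_var1 Q M g v : minimiser_OR l c Q M -> W12_0 g -> W12_0 v -> var1 Q M g v = 0.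
Proof.
move=> [[wQ wM [Qm Mm] [Qp Mp]] min] [wg gm gp] [wv vm vp].
have w0 := W12_cst 0.
have [A3 [A4 e]] := F_expansion wQ wM wg w0 wv w0.
have [d _] := quartic_derive e.
have [_ <-] := d; suff [] : is_derive (0 : R) (1 : R) (F_along l c Q (fun=> 0) M (fun=> 0) g (fun=> 0) v (fun=> 0)) 0 by [].
apply: (@derive1_at_min _ _ (-1) 1).
- by lra.
- move=> t _; rewrite e.
  have : is_derive t 1 (fun t => F l c Q (fun=> 0) M (fun=> 0) + var1 Q M g v * t + var2 Q M g (fun=> 0) v (fun=> 0) * t ^+ 2 +
      A3 * t ^+ 3 + A4 * t ^+ 4) (var1 Q M g v  + 2 * var2 Q M g (fun=> 0) v (fun=> 0) * t + 3 * A3 * t ^+ 2 + 4 * A4 * t ^+ 3) by deriv; ring.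
  by case.
- by rewrite in_itv/=; lra.
- move=> t _.
  have -> : F_along l c Q (fun=> 0) M (fun=> 0) g (fun=> 0) v (fun=> 0) 0 =
     F l c Q (fun=> 0) M (fun=> 0).
    by rewrite e; ring.
  have -> : F_along l c Q (fun=> 0) M (fun=> 0) g (fun=> 0) v (fun=> 0) t =
     F l c (fun y => Q y + t * g y) (fun=> 0) (fun y => M y + t * v y) (fun=> 0).
    have z : (fun y : R => 0 + t * 0 : R) = (fun=> 0) by apply/funext => y; rewrite mulr0 addr0.
    by rewrite /F_along z.
  rewrite -!E_F//; try exact: W12_affine.
  apply: min; split; try exact: W12_affine.
  + by rewrite gm vm !mulr0 !addr0.
  + by rewrite gp vp !mulr0 !addr0.
Qed.

Lemma minimiser_critical Q M : minimiser_OR l c Q M ->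
  critical_point l c Q (fun=> 0) M (fun=> 0).
Proof.
move=> h; have [[wQ wM Em Ep] _] := h; split; first by split=> //; split=> //; exact: W12_cst.
move=> g h' v w W0g [wh _ _] W0v [ww _ _].
have [[wg _ _] [wv _ _]] := conj W0g W0v.
have [A3 [A4 e]] := F_expansion wQ wM wg wh wv ww.
by have [] := quartic_derive e; rewrite (minimiser_var1 h W0g W0v).
Qed.

(** The t^2 coefficient in the directions (0, h, 0, w), half of the second variation. At Q12 = M2 =
    0 these directions decouple from (g, 0, v, 0). *)
Definition dens (q m h w dh dw : R) : R :=
  l / 2 * (dh ^+ 2 + dw ^+ 2) + 2 * (q ^+ 2 - 1) * h ^+ 2 + 1 / 2 * (m ^+ 2 - 1 + 2 * c * q) * w ^+ 2
   - 2 * c * m * h * w.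

Lemma unstable_of_dens Q M h dh w dw : W12 Q -> W12 M ->
  pc1 h dh (-1) 1 -> pc1 w dw (-1) 1 -> h (-1) = 0 -> h 1 = 0 -> w (-1) = 0 -> w 1 = 0 ->
  int (-1) 1 (fun y => dens (Q y) (M y) (h y) (w y) (dh y) (dw y)) < 0 ->
  unstable l c Q (fun=> 0) M (fun=> 0).
Proof.
move=> wQ wM ph pw hm hp wm wp neg.
have wh := pc1_W12 ph; have ww := pc1_W12 pw.
have [[cQ _ _] [cM _ _] [ch _ _] [cw _ _]] := And4 wQ wM wh ww.
have w0 := W12_cst 0.
exists (fun=> 0), h, (fun=> 0), w; split; [exact: W120_0|by []|exact: W120_0|by []|].
have [A3 [A4 e]] := F_expansion wQ wM w0 wh w0 ww.
have [_ ->] := quartic_derive e.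
suff -> : var2 Q M (fun=> 0) h (fun=> 0) w = int (-1) 1 (fun y => dens (Q y) (M y) (h y) (w y) (dh y) (dw y)).
  by rewrite pmulr_rlt0.
apply: Rint_ae.
- exact: integrable_measurable (coef2_integrable wQ wM w0 wh w0 ww).
- apply: (integrable_measurable (a := -1)).
  have [[_ ih] _] := pc1_weak ph; have [[_ iw] _] := pc1_weak pw.
  have i2 : intg (-1) 1 (fun y => 2 * (Q y ^+ 2 - 1) * h y ^+ 2 + 1 / 2 * (M y ^+ 2 - 1 + 2 * c * Q y) * w y ^+ 2
   - 2 * c * M y * h y * w y) by wcont.
  apply: eq_integrable_fun (integrableD_fun (integrableZ_fun (l / 2) (integrableD_fun ih iw)) i2) => x _ _.
  rewrite /dens; ring.
- have aeF : Filter (nbhs (almost_everywhere mu)) := ae_filter_ringOfSetsType mu.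
  near=> x => hx.
  have -> : D h x = dh x by move: hx; near: x; exact: pc1_D.
  have -> : D w x = dw x by move: hx; near: x; exact: pc1_D.
  have -> : D (fun=> 0) x = 0 by move: hx; near: x; exact: D_cst.
  by rewrite /coef2 /dens; field.
Unshelve. all: by end_near. Qed.

End Expansion.

(** * Regularity of minimisers *)

Section Regularity.
Variable R : realType.
Implicit Types (f g h v w A B df phi Q P M N q m dq dm : R -> R) (a b x y s k t : R) (n : nat).
Local Notation mu := (@lebesgue_measure R).
Local Notation int a b f := (\int[mu]_(x in `[a, b]) f x).
Local Notation intg a b f := (mu.-integrable `[a, b] (EFin \o f)).
Local Notation D := (@weak_derivative R).

(** Composition with [clamp] extends a function by its boundary values, so that its primitives have
    two-sided derivatives at -1 and 1, as [is_derive] demands. *)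
Definition clamp x : R := Num.max (-1) (Num.min x 1).

Lemma clamp_id x : -1 <= x -> x <= 1 -> clamp x = x.
Proof. by move=> x1 x2; rewrite /clamp min_l// max_r. Qed.

Lemma clamp_bound x : -1 <= clamp x <= 1.
Proof.
rewrite /clamp le_max lexx/= ge_max ge_min lexx orbT andbT.
by rewrite ltW// ltrN11.
Qed.

Lemma clamp_lip x y : `|clamp x - clamp y| <= `|x - y|.
Proof.
rewrite /clamp !maxEle !minEle.
do !case: ifPn; rewrite -?ltNge => *; rewrite ler_norml; apply/andP; split;
  have := ler_norm (x - y); have := ler_norm (y - x); rewrite (distrC y x); lra.
Qed.

Lemma clamp_continuous B : {within `[-1, 1], continuous B} ->
  forall y, {for y, continuous (fun x => B (clamp x))}.
Proof.
move=> cB y; have /andP[y1 y2] := clamp_bound y.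
have yin : `[(-1 : R), 1]%classic (clamp y) by rewrite /= in_itv/= y1.
have /cvgrPdist_lt h := cB (clamp y); apply/cvgrPdist_lt => e e0.
have : within `[(-1 : R), 1]%classic (nbhs (clamp y)) (fun t => `|B (clamp y) - B t| < e).
  by rewrite (nbhs_subspace_in yin); exact: h.
rewrite /within/= => -[d/= d0 hd].
exists d => //= z yz; apply: hd; last by rewrite /= in_itv/=; exact: clamp_bound.
by rewrite /ball_/=; apply: le_lt_trans yz; exact: clamp_lip.
Qed.

(* Du Bois-Reymond: testing with tents shows that the primitive of l A - Phi is
   affine, where Phi is a primitive of B. *)
Lemma weak_EL l f A B : 0 < l -> {within `[-1, 1], continuous f} ->
  is_weak_derivative f A -> {within `[-1, 1], continuous B} ->
  (forall g dg, pc1 g dg (-1) 1 -> g (-1) = 0 -> g 1 = 0 ->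
    int (-1) 1 (fun y => l * (A y * dg y) + B y * g y) = 0) ->
  exists q dq, (forall y, -1 <= y -> y <= 1 -> f y = q y) /\
    forall y, -1 <= y -> y <= 1 -> is_derive y 1 q (dq y) /\ is_derive y 1 dq (B y / l).
Proof.
move=> l0 cf fA cB hv; have A2 := fA.1.
pose B' x := B (clamp x).
have cB' : forall y, {for y, continuous B'} by exact: clamp_continuous.
(* The base point lies to the left of the channel, so that [Phi] is differentiable at -1 itself. *)
pose Phi x := int (-2) x B'.
have dPhi y : -2 < y -> is_derive y 1 Phi (B' y) by apply: primitive => z _; exact: cB'.
have cPhi : {within `[-1, 1], continuous Phi}.
  by apply: continuous_within => y y1 _; apply: is_derive_continuous (dPhi y _); lra.
have iA : intg (-1) 1 A := L2_integrable A2.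
have iPhi := within_continuous_integrable cPhi.
pose psi y := l * A y - Phi y.
have ipsi : intg (-1) 1 psi by apply: integrableB_fun => //; exact: integrableZ_fun.
have lin s : -1 < s -> s < 1 -> int (-1) s psi = int (-1) 1 psi / 2 * (s + 1).
  move=> s1 s2.
  (* A tent with peak at s has one slope on each side, so testing with it says that [psi] has the
     same mean over [-1, s] and [s, 1]; its primitive is therefore linear in s. *)
  pose g := glue s (fun x => (s + 1)^-1 * (x + 1)) (fun x => (1 - s)^-1 * (1 - x)).
  pose dg := glue s (fun=> (s + 1)^-1) (fun=> - (1 - s)^-1).
  have s10 : s + 1 != 0 by lra.
  have s20 : 1 - s != 0 by lra.
  have pg : pc1 g dg (-1) 1.
    apply: pc1_glue; last by rewrite !mulVf.
      apply: pc1_C1 => // y _ _; split; last exact: continuous_cstF.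
      by deriv; ring.
    apply: pc1_C1 => // y _ _; split; last exact: continuous_cstF.
    by deriv; ring.
  have g1 : g (-1) = 0 by rewrite /g /glue ltW// addNr mulr0.
  have g2 : g 1 = 0 by rewrite /g /glue leNgt s2/= subrr mulr0.
  have C1Phi : C1_on (-1) 1 Phi B'.
    by move=> y y1 _; split; [apply: dPhi; lra|exact: cB'].
  have [idg edg] := pc1_parts pg C1Phi.
  have dg2 := (pc1_weak pg).1.
  have cg := pc1_within pg.
  have iAdg := L2M_integrable A2 dg2.
  have igB : intg (-1) 1 (fun y => B y * g y).
    by apply: within_continuous_integrable; exact: withinMF.
  have := hv _ _ pg g1 g2.
  rewrite RintD//; last exact: integrableZ_fun.
  have -> : int (-1) 1 (fun y => B y * g y) = int (-1) 1 (fun y => g y * B' y).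
    by apply: eq_Rint => y y1 y2; rewrite /B' clamp_id// mulrC.
  rewrite edg g1 g2 !mul0r subrr sub0r -RintB//; last exact: integrableZ_fun.
  have -> : int (-1) 1 (fun y => l * (A y * dg y) - dg y * Phi y) =
    int (-1) 1 (fun y => psi y * dg y) by apply: eq_Rint => y _ _; rewrite /psi; ring.
  have ipdg : intg (-1) 1 (fun y => psi y * dg y).
    apply: eq_integrable_fun (integrableB_fun (integrableZ_fun l iAdg) idg) => y _ _.
    rewrite /psi; ring.
  have ips1 : intg (-1) s psi by apply: integrable_sub ipsi; rewrite // ltW.
  have ips2 : intg s 1 psi by apply: integrable_sub ipsi; rewrite // ltW.
  rewrite (Rint_split (ltW s1) (ltW s2) ipdg).
  have -> : int (-1) s (fun y => psi y * dg y) = (s + 1)^-1 * int (-1) s psi.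
    rewrite -RintZ//; apply: eq_Rint => y _ y2.
    by rewrite /dg /glue y2 mulrC.
  have -> : int s 1 (fun y => psi y * dg y) = - (1 - s)^-1 * int s 1 psi.
    rewrite -RintZ//; apply: Rint_eq_oo.
      by apply: integrable_sub ipdg; rewrite // ltW.
    by move=> y /andP[y1 _]; rewrite /dg /glue leNgt y1/= mulrC.
  rewrite (Rint_split (ltW s1) (ltW s2) ipsi).
  move: (int _ _ _) (int _ _ _) => z u; clear -s10 s20 => e.
  have {}e : (1 - s) * u - (s + 1) * z = 0.
    transitivity ((s + 1) * (1 - s) * ((s + 1)^-1 * u + - (1 - s)^-1 * z)); first by field; rewrite s10 s20.
    by rewrite e mulr0.
  by apply/eqP; rewrite -subr_eq0 -(mulr0 2^-1) -e; apply/eqP; field.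
pose k := int (-1) 1 psi / 2.
have lin' s : -1 <= s -> s <= 1 -> int (-1) s psi = k * (s + 1).
  rewrite le_eqVlt => /predU1P[<- _|s1].
    by rewrite set_itv1 Rintegral_set1 addNr mulr0.
  rewrite le_eqVlt => /predU1P[->|]; last exact: lin.
  by rewrite /k; field.
pose dq y := (Phi y + k) / l.
have dqd y : -2 < y -> is_derive y 1 dq (B' y / l).
  by move=> /dPhi h; rewrite /dq; deriv; ring.
(* Strictly between -2, to the right of which [dq] is continuous, and -1, where its primitive must
   be differentiable. *)
pose b0 : R := - (3 / 2).
have dQ y : b0 < y -> is_derive y 1 (fun x => int b0 x dq) (dq y).
  apply: primitive => z; rewrite /b0 => hz.
  by apply: is_derive_continuous (dqd z _); lra.
exists (fun x => f (-1) + (int b0 x dq - int b0 (-1) dq)), dq; split => y y1 y2; last first.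
  split.
    have h : is_derive y 1 (fun x => int b0 x dq) (dq y) by apply: dQ; rewrite /b0; lra.
    by deriv; ring.
  by have := dqd y; rewrite /B' clamp_id//; apply; lra.
have idq u z : -1 <= u -> z <= 1 -> intg u z dq.
  move=> u1 z1; apply: continuous_integrable => x ux _.
  by apply: is_derive_continuous (dqd x _); lra.
have -> : int b0 y dq = int b0 (-1) dq + int (-1) y dq.
  apply: Rint_split => //; first by rewrite /b0; lra.
  apply: continuous_integrable => x; rewrite /b0 => ux _.
  by apply: is_derive_continuous (dqd x _); lra.
rewrite [X in _ + X]addrC addKr -(subrK (f (-1)) (f y)) addrC (weak_ftc cf fA)//; congr (_ + _).
have iA' : intg (-1) y A by exact: integrable_sub iA.
have iP' : intg (-1) y Phi by exact: integrable_sub iPhi.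
have := lin' y y1 y2; rewrite /psi RintB//; last exact: integrableZ_fun.
rewrite RintZ// => e.
have -> : int (-1) y dq = l^-1 * int (-1) y (fun x => Phi x + k).
  rewrite -RintZ; first by apply: eq_Rint => x _ _; rewrite /dq mulrC.
  by apply: integrableD_fun => //; exact: integrable_cst.
rewrite RintD//; last exact: integrable_cst.
rewrite Rint_cst//; apply: (mulfI (lt0r_neq0 l0)); rewrite mulVKf ?gt_eqF//.
by move/eqP: e; rewrite subr_eq => /eqP ->; rewrite opprK addrC.
Qed.

End Regularity.

(** * Minimisers as classical solutions of the Euler-Lagrange system *)

Section ClassicalMinimiser.
Variable R : realType.
Implicit Types (f g h v w A B df phi Q P M N q m dq dm : R -> R) (a b x y s k t : R) (n : nat).
Local Notation mu := (@lebesgue_measure R).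
Local Notation int a b f := (\int[mu]_(x in `[a, b]) f x).
Local Notation intg a b f := (mu.-integrable `[a, b] (EFin \o f)).
Local Notation D := (@weak_derivative R).
Variables l c : R.

Definition solution q dq m dm := forall y, -1 <= y -> y <= 1 ->
  [/\ is_derive y 1 q (dq y),
      is_derive y 1 dq ((4 * q y * (q y ^+ 2 - 1) - c * m y ^+ 2) / l),
      is_derive y 1 m (dm y) &
      is_derive y 1 dm (m y * (m y ^+ 2 - 1 - 2 * c * q y) / l)].

Definition Edens (q m dq dm : R) : R :=
  l / 2 * (dq ^+ 2 + dm ^+ 2) + ((q ^+ 2 - 1) ^+ 2 + 1 / 4 * (m ^+ 2 - 1) ^+ 2 - c * q * m ^+ 2).

Lemma minimiser_solution Q M : 0 < l -> minimiser_OR l c Q M ->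
  exists q dq m dm, [/\ forall y, -1 <= y -> y <= 1 -> Q y = q y,
    forall y, -1 <= y -> y <= 1 -> M y = m y & solution q dq m dm].
Proof.
move=> l0 h; have [[wQ wM _ _] _] := h.
have [[cQ _ _] [cM _ _]] := conj wQ wM.
have aeF : Filter (nbhs (almost_everywhere mu)) := ae_filter_ringOfSetsType mu.
have w0 := W12_cst (0 : R).
pose BQ y := 4 * Q y * (Q y ^+ 2 - 1) - c * M y ^+ 2.
pose BM y := M y * (M y ^+ 2 - 1 - 2 * c * Q y).
have cBQ : {within `[-1, 1], continuous BQ}.
  by apply: withinDF; [apply: withinMF; [apply: withinMF; [exact: within_cst|]|
    apply: withinDF; [exact: withinXF|exact: within_cst]]|
    apply: withinNF; apply: withinMF; [exact: within_cst|exact: withinXF]].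
have cBM : {within `[-1, 1], continuous BM}.
  by apply: withinMF => //; apply: withinDF; [apply: withinDF;
     [exact: withinXF|exact: within_cst]|apply: withinNF; apply: withinMF; [exact: within_cst|]].
have [q [dq [Qq dQ]]] : exists q dq, (forall y, -1 <= y -> y <= 1 -> Q y = q y) /\
    forall y, -1 <= y -> y <= 1 -> is_derive y 1 q (dq y) /\ is_derive y 1 dq (BQ y / l).
  apply: (weak_EL l0 cQ (W12_weak wQ) cBQ) => g dg pg g1 g2.
  have wg := pc1_W12 pg; have [cg _ _] := wg.
  have W0g : W12_0 g by split.
  rewrite -(minimiser_var1 h W0g (W120_0 R)); apply: Rint_ae.
  - suff i : intg (-1) 1 (fun y => l * (D Q y * dg y) + BQ y * g y).
      exact: integrable_measurable i.
    apply: integrableD_fun.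
      by apply: integrableZ_fun; apply: L2M_integrable; [exact: W12_L2|exact: (pc1_weak pg).1].
    by apply: within_continuous_integrable; exact: withinMF.
  - exact: integrable_measurable (coef1_integrable l c wQ wM wg w0).
  - near=> x => hx.
    have -> : D g x = dg x by move: hx; near: x; exact: pc1_D.
    have -> : D (fun=> 0) x = 0 by move: hx; near: x; exact: D_cst.
    by rewrite /coef1 /BQ; ring.
have [m [dm [Mm dM]]] : exists q dq, (forall y, -1 <= y -> y <= 1 -> M y = q y) /\
    forall y, -1 <= y -> y <= 1 -> is_derive y 1 q (dq y) /\ is_derive y 1 dq (BM y / l).
  apply: (weak_EL l0 cM (W12_weak wM) cBM) => g dg pg g1 g2.
  have wg := pc1_W12 pg; have [cg _ _] := wg.
  have W0g : W12_0 g by split.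
  rewrite -(minimiser_var1 h (W120_0 R) W0g); apply: Rint_ae.
  - suff i : intg (-1) 1 (fun y => l * (D M y * dg y) + BM y * g y).
      exact: integrable_measurable i.
    apply: integrableD_fun.
      by apply: integrableZ_fun; apply: L2M_integrable; [exact: W12_L2|exact: (pc1_weak pg).1].
    by apply: within_continuous_integrable; exact: withinMF.
  - exact: integrable_measurable (coef1_integrable l c wQ wM w0 wg).
  - near=> x => hx.
    have -> : D g x = dg x by move: hx; near: x; exact: pc1_D.
    have -> : D (fun=> 0) x = 0 by move: hx; near: x; exact: D_cst.
    by rewrite /coef1 /BM; ring.
exists q, dq, m, dm; split=> // y y1 y2.
have [d1 d2] := dQ y y1 y2; have [d3 d4] := dM y y1 y2.
by rewrite -Qq// -Mm//; split.
Unshelve. all: by end_near. Qed.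

Lemma E_pc1 Q dQ M dM : pc1 Q dQ (-1) 1 -> pc1 M dM (-1) 1 ->
  E l c Q M = int (-1) 1 (fun y => Edens (Q y) (M y) (dQ y) (dM y)).
Proof.
move=> pQ pM; have wQ := pc1_W12 pQ; have wM := pc1_W12 pM.
have w0 := W12_cst (0 : R); have L0 := L2_cst (0 : R).
rewrite E_F// (@F_weakE _ _ _ _ _ _ _ dQ (fun=> 0) dM (fun=> 0))//.
- by apply: eq_Rint => x _ _; rewrite /Fdens /Edens; field.
- exact: (pc1_weak pQ).1.
- exact: (pc1_weak pM).1.
- exact: pc1_D.
- exact: D_cst.
- exact: pc1_D.
- exact: D_cst.
Qed.

Lemma minimiser_of_eq Q M P N : minimiser_OR l c Q M -> admissible_OR P N ->
  E l c P N = E l c Q M -> minimiser_OR l c P N.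
Proof. by move=> [_ min] aPN e; split=> // P' N' /min; rewrite e. Qed.

Lemma solution_C1 q dq m dm : solution q dq m dm ->
  C1_on (-1) 1 q dq /\ C1_on (-1) 1 m dm.
Proof.
move=> s; split=> y y1 y2; have [? d2 ? d4] := s y y1 y2; split=> //.
  exact: is_derive_continuous d2.
exact: is_derive_continuous d4.
Qed.

(** The given pair is arbitrary outside [-1, 1] and may lack two-sided derivatives at the walls. The
    pair [q], [m] agrees with it on the channel, has the same energy, and so replaces it from here
    on. *)
Lemma classical_minimiser Q M : 0 < l -> minimiser_OR l c Q M ->
  exists q dq m dm, [/\ forall y, -1 <= y -> y <= 1 -> Q y = q y,
    forall y, -1 <= y -> y <= 1 -> M y = m y, solution q dq m dm & minimiser_OR l c q m].
Proof.
move=> l0 h; have [q [dq [m [dm [Qq Mm s]]]]] := minimiser_solution l0 h.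
exists q, dq, m, dm; split=> //.
have [cq cm] := solution_C1 s.
have pq := pc1_C1 (ltrN11 R) cq; have pm := pc1_C1 (ltrN11 R) cm.
have n11 : (-1 : R) <= 1 by lra.
have [[_ _ [Q1 M1] [Q2 M2]] _] := h.
apply: (minimiser_of_eq h).
  split; [exact: pc1_W12 pq|exact: pc1_W12 pm| |]; split.
  - by rewrite -Qq.
  - by rewrite -Mm.
  - by rewrite -Qq.
  - by rewrite -Mm.
have pQ : pc1 Q dq (-1) 1 by apply: eq_pc1 pq.
have pM : pc1 M dm (-1) 1 by apply: eq_pc1 pm.
rewrite (E_pc1 pq pm) (E_pc1 pQ pM); apply: eq_Rint => x x1 x2.
by rewrite Qq// Mm.
Qed.
End ClassicalMinimiser.

(** * Phase-plane properties of solutions *)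

Section Qualitative.
Variable R : realType.
Implicit Types (f g h v w A B df phi : R -> R) (a b x y s k t : R) (n : nat).

Lemma derive_gt0_right f x d : is_derive x 1 f d -> 0 < d ->
  exists2 e, 0 < e & forall y, x < y -> y < x + e -> f x < f y.
Proof.
move=> [dd dv] d0; move: dd; rewrite /derivable => /cvg_ex[l hl].
have lk : l = d by rewrite -dv; apply/esym/cvg_lim => //; exact: hl.
rewrite {}lk in hl; move/cvgrPdist_lt: hl => /(_ d d0)[e/= e0 he].
exists e => // y xy yx; have yx0 : 0 < y - x by rewrite subr_gt0.
have := he (y - x); rewrite /ball_/= distrC subr0 gtr0_norm// => /(_ _ _).
rewrite ltrBlDl yx gt_eqF// => /(_ isT isT).
rewrite /= [_ *: 1]mulr1 subrK [_ *: _]mulrC ltr_norml => /andP[_].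
by rewrite ltrBlDr ltrDl pmulr_lgt0 ?invr_gt0// subr_gt0.
Qed.

Lemma exists_max f : (forall y, -1 <= y -> y <= 1 -> {for y, continuous f}) ->
  exists y, [/\ -1 <= y, y <= 1 & forall z, -1 <= z -> z <= 1 -> f z <= f y].
Proof.
move=> cf; have [|y + fy] := @EVT_max _ f (-1) 1 _ (continuous_within cf); first by lra.
rewrite in_itv/= => /andP[y1 y2]; exists y; split=> // z z1 z2.
by apply: fy; rewrite in_itv/= z1.
Qed.

(** To be read with a = m^2, x = l m'^2 and h the Hamiltonian: the bracket is then l/2 (q'^2 +
    m'^2), and the claim is 64 m'^2 <= 225 q'^2, as 289 = 64 + 225 and 450 = 2 * 225. *)
Lemma slope_bound (c q a x h : R) : 0 < c -> -1 <= q -> q <= 1 / 2 -> 0 <= a -> a <= 1 ->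
  x <= 2 * c -> x <= 2 * c ^+ 2 -> c + c ^+ 2 <= h ->
  289 * x <= 450 * (h + ((q ^+ 2 - 1) ^+ 2 + 1 / 4 * (a - 1) ^+ 2 - c * q * a)).
Proof.
move=> c0 q1 q2 a0 a1 x1 x2 hh.
have ha := sqr_ge0 (a - 1); have hc := sqr_ge0 c.
have [q0|q0] := leP q 0.
  have h1 : 0 <= c * (- q) * a by rewrite !mulr_ge0 ?oppr_ge0// ltW.
  have h2 := sqr_ge0 (q ^+ 2 - 1).
  have [c1|c1] := leP c 1; last by nra.
  have : 578 * c ^+ 2 <= 450 * c + 450 * c ^+ 2 by nra.
  lra.
have h1 : c * (q * a) <= c * (1 / 2).
  have hqa : q * a <= q * 1 by rewrite ler_pM2l.
  by rewrite ler_pM2l//; lra.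
have h2 : 9 / 16 <= (q ^+ 2 - 1) ^+ 2.
  have h3 : 3 / 4 <= 1 - q ^+ 2 by nra.
  nra.
have [c1|c1] := leP c 1; last by nra.
have : 578 * c ^+ 2 <= 450 * (c / 2 + c ^+ 2) by nra.
lra.
Qed.

Variables (l c : R) (q dq m dm : R -> R).
Hypotheses (l0 : 0 < l) (c0 : 0 < c) (sol : solution l c q dq m dm).
Hypotheses (qN1 : q (-1) = 1) (mN1 : m (-1) = 1) (q1 : q 1 = -1) (m1 : m 1 = -1).

Definition potential (x y : R) : R :=
  (x ^+ 2 - 1) ^+ 2 + 1 / 4 * (y ^+ 2 - 1) ^+ 2 - c * x * y ^+ 2.

Definition ham y := l / 2 * (dq y ^+ 2 + dm y ^+ 2) - potential (q y) (m y).

Lemma sol_continuous y : -1 <= y -> y <= 1 ->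
  [/\ {for y, continuous q}, {for y, continuous dq}, {for y, continuous m} &
      {for y, continuous dm}].
Proof.
move=> y1 y2; have [d1 d2 d3 d4] := sol y1 y2.
by split; apply: is_derive_continuous; eassumption.
Qed.

Lemma ham_cst y : -1 <= y -> y <= 1 -> ham y = ham (-1).
Proof.
move=> y1 y2.
have d z : -1 <= z -> z <= y -> is_derive z 1 ham 0.
  move=> z1 z2; have [d1 d2 d3 d4] := sol z1 (le_trans z2 y2).
  rewrite /ham /potential; deriv; field.
  by rewrite gt_eqF.
apply/eqP; rewrite eq_le; apply/andP; split.
  exact: (@nonincreasing_derive _ ham (fun=> 0)).
exact: (@nondecreasing_derive _ ham (fun=> 0)).
Qed.

(** Where q < -1, the right-hand side 4 q (q^2 - 1) - c m^2 of l q'' is negative, which excludes an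
    interior minimum. *)
Lemma q_ge y : -1 <= y -> y <= 1 -> -1 <= q y.
Proof.
have [lp cp] := conj l0 c0; move=> y1 y2.
have [|z [z1 z2 hz]] := @exists_max (fun x => - q x).
  by move=> x x1 x2; have [? _ _ _] := sol_continuous x1 x2; cont.
suff : - q z <= 1 by have := hz y y1 y2; lra.
rewrite leNgt; apply/negP => qz.
have z1' : -1 < z by rewrite lt_neqAle z1 andbT; apply/eqP => e; move: qz; rewrite -e qN1; lra.
have z2' : z < 1 by rewrite lt_neqAle z2 andbT; apply/eqP => e; move: qz; rewrite e q1; lra.
have [d1 d2 d3 d4] := sol z1 z2.
apply: (@not_max_convex _ (fun x => - q x) (fun x => - dq x) z
  (- ((4 * q z * (q z ^+ 2 - 1) - c * m z ^+ 2) / l)) (-1) 1) => //.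
- by move=> x x1 x2; have [? ? ? ?] := sol x1 x2; deriv.
- rewrite -mulNr divr_gt0//.
  have : 0 <= c * m z ^+ 2 by rewrite mulr_ge0 ?sqr_ge0// ltW.
  have : 0 < - q z * (- q z - 1) * (- q z + 1) by rewrite !mulr_gt0//; lra.
  nra.
Qed.

(** Above 1 + 2 c k the function m^2 is strictly convex. The bound [k] is a parameter because [q_le]
    needs it with the still unknown maximum of q. *)
Lemma m_sqr_le k : (forall y, -1 <= y -> y <= 1 -> q y <= k) -> 1 <= k ->
  forall y, -1 <= y -> y <= 1 -> m y ^+ 2 <= 1 + 2 * c * k.
Proof.
have [lp cp] := conj l0 c0; move=> qk k1 y y1 y2.
have [|z [z1 z2 hz]] := @exists_max (fun x => m x ^+ 2).
  by move=> x x1 x2; have [_ _ ? _] := sol_continuous x1 x2; cont.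
apply: le_trans (hz y y1 y2) _; rewrite leNgt; apply/negP => mz.
have ck : 0 < c * k by rewrite mulr_gt0//; lra.
have z1' : -1 < z.
  by rewrite lt_neqAle z1 andbT; apply/eqP => e; move: mz; rewrite -e mN1; lra.
have z2' : z < 1.
  by rewrite lt_neqAle z2 andbT; apply/eqP => e; move: mz; rewrite e m1; lra.
have [d1 d2 d3 d4] := sol z1 z2.
apply: (@not_max_convex _ (fun x => m x ^+ 2) (fun x => 2 * (m x * dm x)) z
  (2 * (dm z ^+ 2 + m z ^+ 2 * (m z ^+ 2 - 1 - 2 * c * q z) / l)) (-1) 1) => //.
- by move=> x x1 x2; have [? ? ? ?] := sol x1 x2; deriv; ring.
- by deriv; ring.
- have cq : c * q z <= c * k by rewrite ler_pM2l// qk.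
  have h1 : 0 < m z ^+ 2 by lra.
  have h2 : 0 < m z ^+ 2 - 1 - 2 * c * q z by lra.
  by rewrite mulr_gt0// ltr_wpDl ?sqr_ge0// divr_gt0// mulr_gt0.
Qed.

(** The bounds on q and m are coupled. At the maximum of q, [m_sqr_le] controls m^2 by q there, and
    4 q (q^2 - 1) exceeds c (1 + 2 c q) once q > 1 + c, so q'' would be positive. *)
Lemma q_le y : -1 <= y -> y <= 1 -> q y <= 1 + c.
Proof.
have [lp cp] := conj l0 c0; move=> y1 y2.
have [|z [z1 z2 hz]] := @exists_max q.
  by move=> x x1 x2; have [? _ _ _] := sol_continuous x1 x2; cont.
apply: le_trans (hz y y1 y2) _; rewrite leNgt; apply/negP => qz.
have z1' : -1 < z.
  by rewrite lt_neqAle z1 andbT; apply/eqP => e; move: qz; rewrite -e qN1 => h; lra.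
have z2' : z < 1.
  by rewrite lt_neqAle z2 andbT; apply/eqP => e; move: qz; rewrite e q1 => h; lra.
have [d1 d2 d3 d4] := sol z1 z2.
have mz : m z ^+ 2 <= 1 + 2 * c * q z by apply: m_sqr_le => //; lra.
apply: (@not_max_convex _ q dq z
  ((4 * q z * (q z ^+ 2 - 1) - c * m z ^+ 2) / l) (-1) 1) => //.
- by move=> x x1 x2; have [? ? ? ?] := sol x1 x2.
- rewrite divr_gt0//.
  have h1 : c * m z ^+ 2 <= c * (1 + 2 * c * q z) by rewrite ler_pM2l.
  set u := q z in qz h1 *.
  have h2 : 0 < u * (u - 1 - c) * (u + 1) by rewrite !mulr_gt0//; lra.
  have h3 : 0 < c * (u - 1) by rewrite mulr_gt0//; lra.
  have h4 : 0 < c * c * u by rewrite !mulr_gt0//; lra.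
  have h5 : 0 < c * u * (u - 1 - c) by rewrite !mulr_gt0//; lra.
  nra.
Qed.

Lemma m_bound y : -1 <= y -> y <= 1 -> m y ^+ 2 <= 1 + 2 * c + 2 * c ^+ 2.
Proof.
have [lp cp] := conj l0 c0; move=> y1 y2; have := m_sqr_le q_le _ y1 y2; rewrite expr2.
move=> /(_ _); have c1 : 1 <= 1 + c by lra.
by move=> /(_ c1); lra.
Qed.

(* Comparison with the scalar heteroclinic: [v] has the sign of the defect in
   sqrt(l) q' <= - sqrt(2) (1 - q^2), and v' >= - k v as long as v < 0. *)
Lemma dq_le0 y : -1 <= y -> y <= 1 -> q y < 1 -> dq y <= 0.
Proof.
have [lp cp] := conj l0 c0; move=> y1 y2 qy.
have [|x x1 xy||| z [z1 zy qz hz]] := @first_hit_left _ (fun x => q x - 1) (-1) y.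
- by [].
- by have [? _ _ _] := sol_continuous x1 (le_trans xy y2); cont.
- by lra.
- by rewrite qN1 subrr.
have {}qz : q z = 1 by lra.
have z2 : z <= 1 := le_trans (ltW zy) y2.
have [dz _ _ _] := sol z1 z2.
have dqz : dq z <= 0.
  rewrite leNgt; apply/negP => d0; have [e e0 he] := derive_gt0_right dz d0.
  pose x := Num.min (z + e / 2) y.
  have zx : z < x by rewrite /x lt_min zy andbT; lra.
  have xe : x < z + e by rewrite /x gt_min; apply/orP; left; lra.
  have xy : x <= y by rewrite /x ge_min lexx orbT.
  have := he x zx xe; have := hz x zx xy; lra.
pose sg := Num.sqrt l; pose r := Num.sqrt (2 : R).
have sg0 : 0 < sg by rewrite sqrtr_gt0.
have r0 : 0 < r by rewrite sqrtr_gt0.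
have sgl : sg ^+ 2 = l by rewrite sqr_sqrtr// ltW.
have r2 : r ^+ 2 = 2 by rewrite sqr_sqrtr.
pose v x := - (sg * dq x) - r * (1 - q x ^+ 2).
have dv x : -1 <= x -> x <= 1 -> is_derive x 1 v ((c * m x ^+ 2 - 2 * r * q x * v x) / sg).
  move=> x1 x2; have [? ? ? ?] := sol x1 x2; rewrite /v; deriv.
  set X := 4 * q x * (q x ^+ 2 - 1) - c * m x ^+ 2.
  have eX : sg * (X / l) = X / sg by rewrite -sgl; field; rewrite gt_eqF.
  transitivity (- (X / sg) + 2 * r * q x * dq x); first by rewrite -eX; ring.
  have -> : X = 2 * r ^+ 2 * q x * (q x ^+ 2 - 1) - c * m x ^+ 2 by rewrite r2 /X; ring.
  by field; rewrite gt_eqF.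
have vz : 0 <= v z by rewrite /v qz; nra.
suff vy : 0 <= v y.
  have q2 : q y ^+ 2 <= 1 by have := q_ge y1 y2; nra.
  have : 0 <= r * (1 - q y ^+ 2) by rewrite mulr_ge0 ?(ltW r0)//; lra.
  move: vy; rewrite /v => vy h; rewrite -(pmulr_rle0 _ sg0); lra.
rewrite leNgt; apply/negP => vy.
have [x x1 xy|//|//|z' [z1' zy' vz' hz']] := @first_hit_left _ v z y (ltW zy).
  by apply: is_derive_continuous (dv x _ _); [exact: le_trans z1 x1|exact: le_trans xy y2].
(* Because q >= -1, v' - k v >= 0 wherever v < 0; hence v exp(- k x) is nondecreasing there and
   cannot leave zero downwards. *)
pose k := 2 * r / sg.
have k0 : 0 < k by rewrite divr_gt0// mulr_gt0.
have dE x : is_derive x 1 (fun x => expR (- k * x)) (- k * expR (- k * x)).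
  have h1 : is_derive x 1 (fun x : R => - k * x) (- k) by deriv; ring.
  have := @is_derive1_comp _ (@expR R) _ x _ _ (is_derive_expR _) h1.
  by rewrite mulrC.
have h0 : v z' * expR (- k * z') <= v y * expR (- k * y).
  apply: (@nondecreasing_derive _ (fun x => v x * expR (- k * x))
     (fun x => expR (- k * x) * ((c * m x ^+ 2 - 2 * r * q x * v x) / sg - k * v x))) => [|x x1 x2|x x1 x2].
  - exact: ltW.
  - have x1' : -1 <= x by exact: le_trans (le_trans z1 z1') x1.
    have ? := dv x x1' (le_trans x2 y2).
    have ? := dE x.
    by deriv; ring.
  - have x1' : -1 <= x by exact: le_trans (le_trans z1 z1') (ltW x1).
    have x2' : x <= 1 by exact: le_trans (ltW x2) y2.
    rewrite mulr_ge0 ?expR_ge0//.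
    have -> : (c * m x ^+ 2 - 2 * r * q x * v x) / sg - k * v x =
       (c * m x ^+ 2 + 2 * r * ((q x + 1) * (- v x))) / sg by rewrite /k; field; rewrite gt_eqF.
    rewrite divr_ge0 ?(ltW sg0)// addr_ge0//.
      by rewrite mulr_ge0 ?sqr_ge0// ltW.
    have vx := hz' x x1 (ltW x2).
    by rewrite !mulr_ge0 ?(ltW r0)//; [have := q_ge x1' x2'; lra|lra].
move: h0; rewrite vz' mul0r leNgt pmulr_llt0 ?expR_gt0// vy //.
Qed.

(** Through [slope_sq] this makes (4 q' + m')^2 dominate q'^2 + m'^2. If m' > 0, then m must turn
    back before reaching -1. Up to the turning point the energy of m with q frozen at -1, the [k] of
    the proof, is nondecreasing and limits m'; the conserved Hamiltonian then forces q' to be large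
    in comparison. *)
Lemma m_slope y : -1 <= y -> y <= 1 -> c + c ^+ 2 <= ham (-1) -> q y <= 1 / 2 ->
  -1 < m y -> m y < 0 -> (forall x, y <= x -> x <= 1 -> m x < 0) ->
  8 * dm y <= - (15 * dq y).
Proof.
have [lp cp] := conj l0 c0; move=> y1 y2 hH qy my1 my2 mneg.
have dq0 : dq y <= 0 by apply: dq_le0 => //; lra.
have [dm0|dm0] := leP (dm y) 0; first by lra.
have [x [yx x1 dmx]] : exists x, [/\ y <= x, x <= 1 & dm x <= 0].
  apply: contrapT => nx; have : m y <= m 1; last by rewrite m1; lra.
  apply: (@nondecreasing_derive _ m dm) => // [z z1 z2|z z1 z2].
    by have [] := sol (le_trans y1 z1) z2.
  rewrite leNgt; apply/negP => dz; apply: nx; exists z; split; exact: ltW.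
have [|z z1 z2||| y0 [y0y y0x dmy0 hy0]] := @first_hit_right _ (fun x => - dm x) y x.
- by [].
- by have [_ _ _ ?] := sol_continuous (le_trans y1 z1) (le_trans z2 x1); cont.
- lra.
- lra.
have y01 := le_trans y0x x1.
(* [k] is nondecreasing as long as m' > 0, that is up to the next zero y0 of m'. *)
pose k z := l / 2 * dm z ^+ 2 - 1 / 4 * (1 - m z ^+ 2) ^+ 2 - c * m z ^+ 2.
have kk : k y <= k y0.
  apply: (@nondecreasing_derive _ k (fun z => 2 * c * (dm z * (- m z)) * (q z + 1))) => [|z z1 z2|z z1 z2].
  - exact: ltW.
  - have [? ? ? ?] := sol (le_trans y1 z1) (le_trans z2 y01).
    by rewrite /k; deriv; field; rewrite gt_eqF.
  - have h1 := hy0 z (ltW z1) z2.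
    have h2 := mneg z (ltW z1) (le_trans (ltW z2) y01).
    have h3 := q_ge (le_trans y1 (ltW z1)) (le_trans (ltW z2) y01).
    by rewrite !mulr_ge0 ?(ltW c0)//; lra.
have mm : m y <= m y0.
  apply: (@nondecreasing_derive _ m dm) => [|z z1 z2|z z1 z2].
  - exact: ltW.
  - by have [? ? ? ?] := sol (le_trans y1 z1) (le_trans z2 y01).
  - by have := hy0 z (ltW z1) z2; lra.
have m0 := mneg y0 (ltW y0y) y01.
move: kk; rewrite /k (_ : dm y0 = 0); last by lra.
rewrite expr0n/= mulr0.
have hy : l / 2 * (dq y ^+ 2 + dm y ^+ 2) = ham (-1) + potential (q y) (m y).
  by rewrite -(ham_cst y1 y2) /ham subrK.
set a := m y ^+ 2; set b := m y0 ^+ 2 => kk.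
have b0 : 0 <= b by exact: sqr_ge0.
have ba : b <= a by rewrite /a /b; nra.
have a1 : a <= 1 by rewrite /a; nra.
have hp : potential (q y) (m y) = (q y ^+ 2 - 1) ^+ 2 + 1 / 4 * (a - 1) ^+ 2 - c * q y * a by [].
set p := potential (q y) (m y) in hy hp *.
(* Two bounds on l m'^2: this linear one serves c > 1; the quadratic one below, from completing the
   square in m^2, serves c <= 1. *)
have e1 : l * dm y ^+ 2 <= 2 * c.
  have : l / 2 * dm y ^+ 2 <= c * (a - b) - 1 / 4 * ((a - b) * (1 - a + (1 - b))) by lra.
  have : 0 <= (a - b) * (1 - a + (1 - b)) by rewrite mulr_ge0//; lra.
  have : c * (a - b) <= c * 1 by rewrite ler_pM2l//; lra.
  lra.
have e2 : l * dm y ^+ 2 <= 2 * c ^+ 2.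
  have : l * dm y ^+ 2 <= 1 / 2 * ((a + 2 * c - 1) ^+ 2 - (b + 2 * c - 1) ^+ 2) by lra.
  have [h|h] := leP 0 (a + 2 * c - 1).
    have := sqr_ge0 (b + 2 * c - 1); have : (a + 2 * c - 1) ^+ 2 <= (2 * c) ^+ 2 by nra.
    lra.
  have : (a - b) * (a + 2 * c - 1 + (b + 2 * c - 1)) <= 0 by rewrite mulr_ge0_le0//; lra.
  have := sqr_ge0 c; lra.
have e3 : 289 * (l * dm y ^+ 2) <= 450 * (ham (-1) + p).
  by rewrite hp; apply: (slope_bound cp) => //; [exact: q_ge|exact: le_trans ba].
move: e3 hy; clear -lp dq0 dm0 => e3 hy.
have : 64 * (l * dm y ^+ 2) <= 225 * (l * dq y ^+ 2) by lra.
have -> : 64 * (l * dm y ^+ 2) = l * (8 * dm y) ^+ 2 by ring.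
have -> : 225 * (l * dq y ^+ 2) = l * (- (15 * dq y)) ^+ 2 by ring.
rewrite ler_pM2l// ler_pXn2r// nnegrE; lra.
Qed.

(** Gronwall for m^2 + m'^2: times exp(- K x) it is nonincreasing, so a zero of first order would
    propagate to the right wall, where m = -1. [K] bounds the coefficient 1 + (m^2 - 1 - 2 c q) /
    l. *)
Lemma m_unique y : -1 <= y -> y < 1 -> m y = 0 -> dm y = 0 -> False.
Proof.
have [lp cp] := conj l0 c0; move=> y1 y2 my dmy.
pose K := (1 + l^-1) * (2 + 2 * (1 + 2 * c + 2 * c ^+ 2) + 2 * (1 + 2 * c * (1 + c))).
pose e x := m x ^+ 2 + dm x ^+ 2.
have dE x : is_derive x 1 (fun x => expR (- K * x)) (- K * expR (- K * x)).
  have h1 : is_derive x 1 (fun x : R => - K * x) (- K) by deriv; ring.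
  have := @is_derive1_comp _ (@expR R) _ x _ _ (is_derive_expR _) h1.
  by rewrite mulrC.
have : e 1 * expR (- K * 1) <= e y * expR (- K * y).
  apply: (@nonincreasing_derive _ (fun x => e x * expR (- K * x))
     (fun x => expR (- K * x) * (2 * (m x * dm x) * (1 + (m x ^+ 2 - 1 - 2 * c * q x) / l) - K * e x))) => [|x x1 x2|x x1 x2].
  - exact: ltW.
  - have [? ? ? ?] := sol (le_trans y1 x1) x2; have ? := dE x; rewrite /e.
    by deriv; ring.
  - have x1' : -1 <= x by exact: le_trans y1 (ltW x1).
    have x2' := ltW x2.
    rewrite mulr_ge0_le0 ?expR_ge0// subr_le0.
    set g := 1 + _ / l.
    have gK : `|g| <= K.
      have li : 0 < l^-1 by rewrite invr_gt0.
      have := m_bound x1' x2'; have := q_ge x1' x2'; have := q_le x1' x2'.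
      have m20 : 0 <= m x ^+ 2 by exact: sqr_ge0.
      move=> h1 h2 h3.
      have h4 : c * q x <= c * (1 + c) by rewrite ler_pM2l.
      have h5 : - c <= c * q x by rewrite -mulrN1 ler_pM2l.
      have c20 : 0 < c ^+ 2 by rewrite exprn_gt0.
      pose B := 2 + 2 * (1 + 2 * c + 2 * c ^+ 2) + 2 * (1 + 2 * c * (1 + c)).
      have hB : `|m x ^+ 2 - 1 - 2 * c * q x| <= B by rewrite ler_norml /B; lra.
      rewrite /g; apply: le_trans (ler_normD _ _) _; rewrite normr1 normrM (gtr0_norm li).
      have -> : K = B + l^-1 * B by rewrite /K /B; ring.
      by apply: lerD; [rewrite /B; lra|rewrite mulrC ler_pM2l].
    have h : 2 * `|m x * dm x| <= e x.
      by rewrite /e normrM -(real_normK (num_real (m x))) -(real_normK (num_real (dm x)));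
        have := sqr_ge0 (`|m x| - `|dm x|); lra.
    apply: le_trans (ler_norm _) _; rewrite normrM [K * _]mulrC normrM (ger0_norm (ler0n _ _)).
    by apply: ler_pM.
rewrite /e my dmy !expr0n/= addr0 mul0r leNgt mulr_gt0 ?expR_gt0//.
by rewrite m1; have := sqr_ge0 (dm 1); lra.
Qed.
End Qualitative.

(** * The polynomial inequality at the wall *)

Section WallPolynomial.
Variable R : realFieldType.
Implicit Types (a b c d k s t r x y : R).

Lemma bernstein_ge0 (i i' j j' : nat) a b c d x y :
  a <= x -> x <= b -> c <= y -> y <= d ->
  0 <= (x - a) ^+ i * (b - x) ^+ i' * ((y - c) ^+ j * (d - y) ^+ j').
Proof. by move=> *; rewrite !mulr_ge0 ?exprn_ge0 ?subr_ge0. Qed.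

Ltac bernstein_row i i' j j' ha hb hc hd :=
  have := bernstein_ge0 i i' j j' ha hb hc hd;
  lazymatch j' with O => idtac | S ?k => bernstein_row i i' (S j) k ha hb hc hd end.
Ltac bernstein_rows i i' m ha hb hc hd :=
  bernstein_row i i' O m ha hb hc hd;
  lazymatch i' with O => idtac | S ?k => bernstein_rows (S i) k m ha hb hc hd end.
(* A polynomial with nonnegative Bernstein coefficients on the box is
   nonnegative there. *)
Ltac bernstein n m ha hb hc hd :=
  clear -ha hb hc hd; bernstein_rows O n m ha hb hc hd; lra.

(** With t = 1 + q and r = 1 + m, the potential part of the wall remainder is (6 - 4 t - r) (- T - 2
    c K) / 72; the first factor is 1 - 4 q - m. *)
Definition wall_T t r : R := 16 * t * (2 - t) * (2 * t - r) + r * (2 - r) * (5 * r - 4 * t).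
Definition wall_K t r : R := - (3 * r) + 8 * r ^+ 2 - 9 * r * t + 4 * t ^+ 2.

(* [wall_poly] is quadratic in c; on each part of its domain an explicit x, found
   numerically, separates the discriminant condition into two polynomial
   inequalities in (t, r). *)
Lemma quadratic_ge0 k b a x c : 0 < k -> 0 <= c -> 0 <= b + x -> x ^+ 2 <= 4 * k * a ->
  0 <= k * c ^+ 2 + c * b + a.
Proof.
move=> k0 c0 bx xa; have h1 : 0 <= c * (b + x) by rewrite mulr_ge0.
rewrite -(pmulr_rge0 _ (mulr_gt0 (ltr0Sn _ 3) k0)).
have := sqr_ge0 (2 * k * c - x); have : 0 <= 4 * k * (c * (b + x)) by rewrite !mulr_ge0// ltW.
lra.
Qed.

(** The range 2 t <= r. At the corner t = r = 0 both sides of the discriminant condition vanish to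
    second order, so it is blown up by t = s r and divided by r^2. The separating x is 25/2 r (1 -
    3/4 r). *)
Lemma steep_T s r : 0 <= s -> s <= 1 / 2 -> 0 <= r -> r <= 1 ->
  (25 / 2 * (1 - 3 / 4 * r)) ^+ 2 <= 4 * (48 / 25) *
    ((6 - 4 * (s * r) - r) * (16 * s * (2 - s * r) * (2 * s - 1) + (2 - r) * (5 - 4 * s))).
Proof.
move=> s0 s1 r0 r1; have [s2|/ltW s2] := leP s (1 / 4).
  by bernstein 4%N 2%N s0 s2 r0 r1.
by bernstein 4%N 2%N s2 s1 r0 r1.
Qed.

Lemma steep_K s r : 0 <= s -> s <= 1 / 2 -> 0 <= r -> r <= 1 ->
  0 <= 48 / 25 * (1 + (1 - s * r) * (1 - r) ^+ 2) +
    2 * (6 - 4 * (s * r) - r) * wall_K (s * r) r + 25 / 2 * r * (1 - 3 / 4 * r).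
Proof.
rewrite /wall_K => s0 s1 r0 r1; have [r2|/ltW r2] := leP r (1 / 2); last first.
  have [s2|/ltW s2] := leP s (1 / 4); first by bernstein 3%N 3%N s0 s2 r2 r1.
  by bernstein 3%N 3%N s2 s1 r2 r1.
have [r3|/ltW r3] := leP r (1 / 4).
  have [s2|/ltW s2] := leP s (1 / 4).
    have [s3|/ltW s3] := leP s (1 / 8); first by bernstein 3%N 3%N s0 s3 r0 r3.
    by bernstein 3%N 3%N s3 s2 r0 r3.
  have [s3|/ltW s3] := leP s (3 / 8); first by bernstein 3%N 3%N s2 s3 r0 r3.
  by bernstein 3%N 3%N s3 s1 r0 r3.
have [s2|/ltW s2] := leP s (1 / 4).
  have [s3|/ltW s3] := leP s (1 / 8); first by bernstein 3%N 3%N s0 s3 r3 r2.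
  by bernstein 3%N 3%N s3 s2 r3 r2.
have [s3|/ltW s3] := leP s (3 / 8); first by bernstein 3%N 3%N s2 s3 r3 r2.
by bernstein 3%N 3%N s3 s1 r3 r2.
Qed.

(** The other half of the corner, blown up by r = 2 t s and divided by t^2, with x = 25 t (1 - 2/5
    r). *)
Lemma shallow_T t s : 0 <= t -> t <= 1 / 2 -> 0 <= s -> s <= 1 ->
  (25 * (1 - 2 / 5 * (2 * t * s))) ^+ 2 <= 4 * (48 / 25) *
    ((6 - 4 * t - 2 * t * s) * (32 * (2 - t) * (1 - s) + 8 * s * (1 - t * s) * (5 * s - 2))).
Proof. by move=> t0 t1 s0 s1; bernstein 2%N 4%N t0 t1 s0 s1. Qed.

Lemma shallow_K t s : 0 <= t -> t <= 1 / 2 -> 0 <= s -> s <= 1 ->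
  0 <= 48 / 25 * (1 + (1 - t) * (1 - 2 * t * s) ^+ 2) +
    2 * (6 - 4 * t - 2 * t * s) * wall_K t (2 * t * s) + 25 * t * (1 - 2 / 5 * (2 * t * s)).
Proof.
rewrite /wall_K => t0 t1 s0 s1; have [t2|/ltW t2] := leP t (1 / 4); last first.
  by bernstein 3%N 3%N t2 t1 s0 s1.
have [s2|/ltW s2] := leP s (1 / 2); first by bernstein 3%N 3%N t0 t2 s0 s2.
have [t3|/ltW t3] := leP t (1 / 8); first by bernstein 3%N 3%N t0 t3 s2 s1.
by bernstein 3%N 3%N t3 t2 s2 s1.
Qed.

(** Away from the corner the factor 6 - 4 t - r may be replaced by its bound 6, which divides 48/25
    down to 8/25; here x = 4 t (1 - r/10). *)
Lemma far_T t r : 1 / 2 <= t -> t <= 3 / 2 -> 0 <= r -> r <= 1 ->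
  (4 * t * (1 - 1 / 10 * r)) ^+ 2 <= 4 * (8 / 25) * wall_T t r.
Proof. by rewrite /wall_T => t0 t1 r0 r1; bernstein 3%N 3%N t0 t1 r0 r1. Qed.

Lemma far_K t r : 1 / 2 <= t -> t <= 3 / 2 -> 0 <= r -> r <= 1 ->
  0 <= 8 / 25 * (1 + (1 - t) * (1 - r) ^+ 2) + 2 * wall_K t r + 4 * t * (1 - 1 / 10 * r).
Proof.
rewrite /wall_K => t0 t1 r0 r1; have [t2|/ltW t2] := leP t 1; last first.
  by bernstein 2%N 2%N t2 t1 r0 r1.
have [r2|/ltW r2] := leP r (1 / 2); first by bernstein 2%N 2%N t0 t2 r0 r2.
by bernstein 2%N 2%N t0 t2 r2 r1.
Qed.

(** The right-hand side is 24/25 of the lower bound 2 (c + c^2 - c q m^2) for l (q'^2 + m'^2),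
    obtained from the Hamiltonian by dropping the two squares in the potential. *)
Lemma wall_poly c t r : 0 <= c -> 0 <= t -> t <= 3 / 2 -> 0 <= r -> r <= 1 ->
  0 <= 6 - 4 * t - r ->
  (6 - 4 * t - r) * (- wall_T t r - 2 * c * wall_K t r) <=
  48 / 25 * (c + c ^+ 2 + c * ((1 - t) * (1 - r) ^+ 2)).
Proof.
move=> c0 t0 t1 r0 r1; set A := 6 - 4 * t - r => A0.
have k0 : 0 < 48 / 25 :> R by lra.
have [t2|/ltW t2] := leP t (1 / 2); last first.
  have k1 : 0 < 8 / 25 :> R by lra.
  have h := quadratic_ge0 k1 c0 (far_K t2 t1 r0 r1) (far_T t2 t1 r0 r1).
  have [T0|T0] := leP (- wall_T t r - 2 * c * wall_K t r) 0.
    have h1 : 0 <= c * (1 + (1 - t) * (1 - r) ^+ 2 + c).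
      rewrite mulr_ge0//.
      have : (1 - r) ^+ 2 <= 1 by nra.
      have := sqr_ge0 (1 - r); nra.
    have : A * (- wall_T t r - 2 * c * wall_K t r) <= 0 by rewrite mulr_ge0_le0.
    lra.
  have : A * (- wall_T t r - 2 * c * wall_K t r) <= 6 * (- wall_T t r - 2 * c * wall_K t r).
    by rewrite ler_pM2r// /A; lra.
  lra.
suff : 0 <= 48 / 25 * c ^+ 2 + c * (48 / 25 * (1 + (1 - t) * (1 - r) ^+ 2) + 2 * A * wall_K t r)
    + A * wall_T t r by lra.
have [tr|tr] := leP (2 * t) r.
  move: r0; rewrite le_eqVlt => /predU1P[r0|r0].
    have {}t0 : t = 0 by lra.
    rewrite /wall_T /wall_K t0 -r0.
    by have := sqr_ge0 c; lra.
  pose s := t / r.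
  have ts : t = s * r by rewrite /s divfK// gt_eqF.
  have s0 : 0 <= s by rewrite divr_ge0// ltW.
  have s1 : s <= 1 / 2 by rewrite ler_pdivrMr//; lra.
  apply: quadratic_ge0 k0 c0 _ _.
    by have := steep_K s0 s1 (ltW r0) r1; rewrite -ts; apply.
  have h := steep_T s0 s1 (ltW r0) r1.
  have r2 : 0 <= r ^+ 2 by exact: sqr_ge0.
  have := ler_wpM2l r2 h; rewrite -ts -/A.
  have -> : r ^+ 2 * (4 * (48 / 25) * (A * (16 * s * (2 - t) * (2 * s - 1) + (2 - r) * (5 - 4 * s)))) =
    4 * (48 / 25) * (A * wall_T t r) by rewrite /wall_T ts; ring.
  by apply: le_trans; rewrite le_eqVlt; apply/orP; left; apply/eqP; ring.
have t0' : 0 < t by lra.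
pose s := r / (2 * t).
have rs : r = 2 * t * s by rewrite /s mulrC divfK// gt_eqF// mulr_gt0.
have s0 : 0 <= s by rewrite divr_ge0// mulr_ge0.
have s1 : s <= 1 by rewrite ler_pdivrMr ?mulr_gt0// mul1r ltW.
apply: quadratic_ge0 k0 c0 _ _.
  by have := shallow_K t0 t2 s0 s1; rewrite -rs; apply.
have h := shallow_T t0 t2 s0 s1.
have t20 : 0 <= t ^+ 2 by exact: sqr_ge0.
have := ler_wpM2l t20 h; rewrite -rs -/A.
have -> : t ^+ 2 * (4 * (48 / 25) * (A * (32 * (2 - t) * (1 - s) + 8 * s * (1 - t * s) * (5 * s - 2)))) =
  4 * (48 / 25) * (A * wall_T t r) by rewrite /wall_T rs; ring.
by apply: le_trans; rewrite le_eqVlt; apply/orP; left; apply/eqP; ring.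
Qed.

(** Covers m <= -1, with n = - r, where [m_slope] does not apply: there [wall_T] has the favourable
    sign by itself. *)
Lemma wall_poly_out t n : 0 <= t -> 0 <= n -> 4 * t - n <= 6 -> 0 <= wall_T t (- n).
Proof.
move=> t0 n0 tn; rewrite /wall_T.
have -> : 16 * t * (2 - t) * (2 * t - - n) + - n * (2 - - n) * (5 * - n - 4 * t) =
  16 * t * (2 - t) * (2 * t + n) + n * (2 + n) * (5 * n + 4 * t) by ring.
have [t2|t2] := leP t 2.
  by rewrite addr_ge0// !mulr_ge0//; lra.
have h1 : t * (t - 2) <= (n + 6) / 4 * ((n - 2) / 4) by apply: ler_pM; lra.
have h2 : t * (t - 2) * (2 * t + n) <= (n + 6) / 4 * ((n - 2) / 4) * (2 * ((n + 6) / 4) + n).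
  by apply: ler_pM => //; [rewrite mulr_ge0//; lra|lra|lra].
have h3 : n * (2 + n) * (5 * n + 8) <= n * (2 + n) * (5 * n + 4 * t).
  by apply: ler_wpM2l; [rewrite mulr_ge0//; lra|lra].
have h4 : 0 <= n ^+ 2 by exact: sqr_ge0.
have h5 : 0 <= n ^+ 3 by exact: exprn_ge0.
lra.
Qed.
End WallPolynomial.

(** * Second variation on segments *)

Section Segments.
Variable R : realType.
Implicit Types (f g h v w A B df phi : R -> R) (a b x y s k t : R) (n : nat).
Local Notation mu := (@lebesgue_measure R).
Local Notation int a b f := (\int[mu]_(x in `[a, b]) f x).
Local Notation intg a b f := (mu.-integrable `[a, b] (EFin \o f)).

Lemma le_Rint_oo f g a b : intg a b f -> intg a b g ->
  (forall x, a < x -> x < b -> f x <= g x) -> int a b f <= int a b g.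
Proof.
move=> fi gi fg; pose f' x := if (a < x < b) then f x else g x.
have ff' x : a < x < b -> f x = f' x by rewrite /f' => ->.
rewrite (Rint_eq_oo fi ff'); apply: le_Rint => //; first exact: integrable_eq_oo fi ff'.
by move=> x _ _; rewrite /f'; case: ifP => // /andP[x1 x2]; exact: fg.
Qed.

Lemma C1_onD s t f df g dg : C1_on s t f df -> C1_on s t g dg ->
  C1_on s t (fun x => f x + g x) (fun x => df x + dg x).
Proof.
move=> hf hg y y1 y2; have [d1 c1] := hf y y1 y2; have [d2 c2] := hg y y1 y2.
by split; [deriv|cont].
Qed.

Lemma C1_onM s t f df g dg : C1_on s t f df -> C1_on s t g dg ->
  C1_on s t (fun x => f x * g x) (fun x => df x * g x + f x * dg x).
Proof.
move=> hf hg y y1 y2; have [d1 c1] := hf y y1 y2; have [d2 c2] := hg y y1 y2.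
have ? := is_derive_continuous d1; have ? := is_derive_continuous d2.
by split; [deriv|cont].
Qed.

Lemma C1_on_cst s t k : C1_on s t (fun=> k) (fun=> 0).
Proof. by move=> y _ _; split; [exact: is_derive_cstF|exact: continuous_cstF]. Qed.

Lemma C1_onZ s t k f df : C1_on s t f df -> C1_on s t (fun x => k * f x) (fun x => k * df x).
Proof.
move=> hf y y1 y2; have [d1 c1] := hf y y1 y2.
by split; [deriv; ring|cont].
Qed.

Lemma C1_on_affine s t k x0 : C1_on s t (fun x => k * (x + x0)) (fun=> k).
Proof. by move=> y _ _; split; [deriv; ring|exact: continuous_cstF]. Qed.

Variables (l c : R) (q dq m dm : R -> R).
Hypotheses (l0 : 0 < l) (c0 : 0 < c) (sol : solution l c q dq m dm).
Hypotheses (qN1 : q (-1) = 1) (mN1 : m (-1) = 1) (q1 : q 1 = -1) (m1 : m 1 = -1).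

Local Notation d2q y := (4 * q y * (q y ^+ 2 - 1) - c * m y ^+ 2).
Local Notation d2m y := (m y * (m y ^+ 2 - 1 - 2 * c * q y)).

Lemma sol_C1 s t : -1 <= s -> t <= 1 ->
  [/\ C1_on s t q dq, C1_on s t m dm, C1_on s t dq (fun y => d2q y / l) &
      C1_on s t dm (fun y => d2m y / l)].
Proof.
move=> s1 t1; split=> y y1 y2; have y1' := le_trans s1 y1; have y2' := le_trans y2 t1;
  have [? ? ? ?] := sol y1' y2'; have [? ? ? ?] := sol_continuous sol y1' y2'; split=> //; cont.
Qed.

Definition sdens h w dh dw y := dens l c (q y) (m y) (h y) (w y) (dh y) (dw y).

Lemma sdens_integrable h w dh dw s t : -1 <= s -> t <= 1 -> pc1 h dh s t -> pc1 w dw s t ->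
  intg s t (sdens h w dh dw).
Proof.
move=> s1 t1 ph pw.
have [/C1_on_within cq /C1_on_within cm _ _] := sol_C1 s1 t1.
have [ch cw] := (pc1_within ph, pc1_within pw).
have X2 (z : R -> R) x : {for x, continuous z} -> {for x, continuous (fun y => z y ^+ 2)}.
  exact: continuousXF.
have ih : intg s t (fun y => dh y ^+ 2) := pc1_integrable (G := fun _ z => z ^+ 2) ph (fun x z => X2 z x).
have iw : intg s t (fun y => dw y ^+ 2) := pc1_integrable (G := fun _ z => z ^+ 2) pw (fun x z => X2 z x).
have ii : intg s t (fun y => 2 * ((q y * q y + -1) * (h y * h y)) +
   (1 / 2 * ((m y * m y + (-1 + 2 * c * q y)) * (w y * w y)) + - (2 * c) * (m y * (h y * w y)))).
  apply: within_continuous_integrable.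
  apply: withinDF; [|apply: withinDF].
  - apply: withinMF; first exact: within_cst.
    apply: withinMF; last exact: withinMF.
    by apply: withinDF; [exact: withinMF|exact: within_cst].
  - apply: withinMF; first exact: within_cst.
    apply: withinMF; last exact: withinMF.
    apply: withinDF; first exact: withinMF.
    by apply: withinDF; [exact: within_cst|apply: withinMF => //; exact: within_cst].
  - apply: withinMF; first exact: within_cst.
    by apply: withinMF => //; exact: withinMF.
apply: eq_integrable_fun (integrableD_fun (integrableZ_fun (l / 2) (integrableD_fun ih iw)) ii) => y _ _.
rewrite /sdens /dens; ring.
Qed.

(** An upper bound for the second variation on [s, t] under Dirichlet data. The perturbation stays
    hidden, so pieces are joined by their boundary values alone. *)
Definition seg s t (hs ws ht wt b : R) := exists h dh w dw,
  [/\ pc1 h dh s t, pc1 w dw s t, h s = hs /\ w s = ws, h t = ht /\ w t = wt &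
      int s t (sdens h w dh dw) <= b].

Lemma seg_le s t hs ws ht wt b b' : b <= b' -> seg s t hs ws ht wt b -> seg s t hs ws ht wt b'.
Proof.
by move=> bb [h [dh [w [dw [p1 p2 e1 e2 hb]]]]]; exists h, dh, w, dw; split=> //; exact: le_trans bb.
Qed.

(** A calibration: the density is dominated by an exact derivative, so the bound is a boundary
    term. *)
Lemma seg_C1 s t h dh w dw Psi dPsi : s < t -> -1 <= s -> t <= 1 ->
  C1_on s t h dh -> C1_on s t w dw -> C1_on s t Psi dPsi ->
  (forall y, s < y -> y < t -> sdens h w dh dw y <= dPsi y) ->
  seg s t (h s) (w s) (h t) (w t) (Psi t - Psi s).
Proof.
move=> st s1 t1 hh hw hP le; exists h, dh, w, dw.
have [ph pw] := (pc1_C1 st hh, pc1_C1 st hw); split=> //.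
rewrite -(ftc (ltW st) hP); apply: le_Rint_oo => //.
  exact: sdens_integrable.
by apply: continuous_integrable => y y1 y2; case: (hP y y1 y2).
Qed.

Lemma seg_glue a b x ha wa hb wb hx wx k1 k2 : -1 <= a -> x <= 1 ->
  seg a b ha wa hb wb k1 -> seg b x hb wb hx wx k2 -> seg a x ha wa hx wx (k1 + k2).
Proof.
move=> a1 x1 [h [dh [w [dw [ph pw [eh ew] [eh' ew'] le]]]]].
move=> [g [dg [v [dv [pg pv [eg ev] [eg' ev'] le2]]]]].
have [ab bx] := (pc1_lt ph, pc1_lt pg).
have p1 : pc1 (glue b h g) (glue b dh dg) a x by apply: pc1_glue => //; rewrite eh' eg.
have p2 : pc1 (glue b w v) (glue b dw dv) a x by apply: pc1_glue => //; rewrite ew' ev.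
have ii := sdens_integrable a1 x1 p1 p2.
exists (glue b h g), (glue b dh dg), (glue b w v), (glue b dw dv); split=> //.
- by rewrite /glue (ltW ab).
- by rewrite /glue leNgt bx.
rewrite (Rint_split (ltW ab) (ltW bx) ii) lerD//.
  rewrite (_ : int a b _ = int a b (sdens h w dh dw))//.
  by apply: eq_Rint => y _ yb; rewrite /sdens /glue yb.
rewrite (_ : int b x _ = int b x (sdens g v dg dv))//.
apply: Rint_eq_oo; first by apply: integrable_sub ii => //; exact: ltW.
by move=> y /andP[by_ _]; rewrite /sdens /glue leNgt by_.
Qed.

Lemma seg_zero s t : s < t -> -1 <= s -> t <= 1 -> seg s t 0 0 0 0 0.
Proof.
move=> st s1 t1; have C := @C1_on_cst s t 0.
have := @seg_C1 s t (fun=> 0) (fun=> 0) (fun=> 0) (fun=> 0) (fun=> 0) (fun=> 0) st s1 t1 C C C.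
rewrite subrr; apply=> y _ _; rewrite /sdens /dens; lra.
Qed.

(** The boundary term l/2 (2 q' h + m' w) left by pairing (h, w) with the null field (2 q, m). *)
Definition flux y (h w : R) := l * dq y * h + l / 2 * dm y * w.

(** The polarised density [dens] at the pair (2 f1, f2) and (h, w) = (2 (q + f1), m + f2); the
    pairing of (h, w) with the null field is the flux. *)
Definition remainder (q m dq dm f1 f2 df1 df2 : R) : R :=
  l * df1 * (2 * (dq + df1)) + l / 2 * df2 * (dm + df2) +
  1 / 2 * (2 * (q + f1) * (8 * (q ^+ 2 - 1) * f1 - 2 * c * m * f2) +
           (m + f2) * ((m ^+ 2 - 1 + 2 * c * q) * f2 - 4 * c * m * f1)).

(* The rotation field (2 q, m) is a null field of the second variation;
   [remainder] is what is left when it is shifted by (2 f1, f2). *)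
Lemma seg_flux s t f1 df1 f2 df2 E dE : s < t -> -1 <= s -> t <= 1 ->
  C1_on s t f1 df1 -> C1_on s t f2 df2 -> C1_on s t E dE ->
  (forall y, s < y -> y < t ->
    remainder (q y) (m y) (dq y) (dm y) (f1 y) (f2 y) (df1 y) (df2 y) <= dE y) ->
  seg s t (2 * (q s + f1 s)) (m s + f2 s) (2 * (q t + f1 t)) (m t + f2 t)
    (flux t (2 * (q t + f1 t)) (m t + f2 t) - flux s (2 * (q s + f1 s)) (m s + f2 s)
     + (E t - E s)).
Proof.
move=> st s1 t1 h1 h2 hE le.
have [Cq Cm Cdq Cdm] := sol_C1 s1 t1.
have Ch := C1_onZ 2 (C1_onD Cq h1).
have Cw := C1_onD Cm h2.
have CP := C1_onD (C1_onD (C1_onM (C1_onZ l Cdq) Ch) (C1_onM (C1_onZ (l / 2) Cdm) Cw)) hE.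
have := seg_C1 st s1 t1 Ch Cw CP; rewrite /flux.
set b := (X in seg _ _ _ _ _ _ X); set b' := (X in _ -> seg _ _ _ _ _ _ X).
have -> : b' = b by rewrite /b /b'; ring.
apply=> y y1 y2; have := le y y1 y2.
rewrite -subr_ge0 -[in X in _ -> X]subr_ge0 => h; apply: le_trans h _.
rewrite le_eqVlt; apply/orP; left; apply/eqP; rewrite /sdens /dens /remainder.
by field; rewrite gt_eqF.
Qed.

(** Multiplying a null field by a cut-off costs, besides the flux, only l/2 times the squared slope
    of the cut-off times 4 q^2 + m^2. As s >= 0, the linear cut-off has slope at most 1 and the cost
    is at most l k / 2. *)
Lemma seg_rotation s k : 0 <= s -> s <= 1 ->
  (forall y, -1 <= y -> y <= s -> 4 * q y ^+ 2 + m y ^+ 2 <= k) ->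
  seg (-1) s 0 0 (2 * q s) (m s) (flux s (2 * q s) (m s) + l * k / 2).
Proof.
move=> s0 s1 hk; have lp := l0.
have s2 : -1 < s by lra.
have [Cq Cm Cdq Cdm] := sol_C1 (lexx (-1)) s1.
pose z := (s + 1)^-1.
have z0 : 0 < z by rewrite invr_gt0; lra.
have z1 : z <= 1 by rewrite invf_le1; lra.
have zs : z * (s + 1) = 1 by rewrite mulVf// gt_eqF//; lra.
have Cx := @C1_on_affine (-1) s z 1.
have Ch := C1_onZ 2 (C1_onM Cx Cq).
have Cw := C1_onM Cx Cm.
have Cb := C1_onD (C1_onZ (2 * l) (C1_onM Cq Cdq)) (C1_onZ (l / 2) (C1_onM Cm Cdm)).
have CP := C1_onD (C1_onM (C1_onM Cx Cx) Cb) (@C1_on_affine (-1) s (l / 2 * k * z ^+ 2) 1).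
have := seg_C1 s2 (lexx _) s1 Ch Cw CP.
rewrite addNr !mulr0 !mul0r mulr0 addr0 subr0 zs !mul1r => h.
have k0 : 0 <= k.
  apply: le_trans (hk s (ltW s2) (lexx _)).
  by rewrite addr_ge0 ?sqr_ge0// mulr_ge0 ?sqr_ge0.
apply: seg_le (h _) => [|y y1 y2].
- rewrite /flux.
  have : l / 2 * k * z ^+ 2 * (s + 1) <= l / 2 * k.
    have -> : l / 2 * k * z ^+ 2 * (s + 1) = l / 2 * k * z by rewrite expr2 mulrA -mulrA zs mulr1.
    by rewrite ler_piMr// mulr_ge0// divr_ge0// ltW.
  lra.
- have hky : l / 2 * z ^+ 2 * (4 * q y ^+ 2 + m y ^+ 2) <= l / 2 * z ^+ 2 * k.
    by rewrite ler_pM2l ?hk ?(ltW y1) ?(ltW y2)// mulr_gt0 ?exprn_gt0// divr_gt0.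
  rewrite -subr_ge0; move: hky; rewrite -subr_ge0 => hky; apply: le_trans hky _.
  rewrite le_eqVlt; apply/orP; left; apply/eqP; rewrite /sdens /dens.
  by field; rewrite gt_eqF.
Qed.

End Segments.

(** * Remainder estimates in the layer at the wall *)

Section WallSegments.
Variable R : realType.
Implicit Types (b s t k y x : R).

Lemma sqr_le1_itv x : -1 <= x -> x <= 1 -> x ^+ 2 <= 1.
Proof.
move=> x1 x2; have : 0 <= (1 - x) * (1 + x) by rewrite mulr_ge0//; lra.
lra.
Qed.

Lemma wall_range (q m : R) : -1 < m -> 4 * q + m <= 1 -> q < 1 /\ q <= 1 / 2.
Proof. by move=> *; split; lra. Qed.

(** The difference of the two sides is x (15 x + 8 y), the origin of the ratio 15 : 8. *)
Lemma slope_sq (x y : R) : x <= 0 -> 8 * y <= - (15 * x) -> x ^+ 2 + y ^+ 2 <= (4 * x + y) ^+ 2.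
Proof.
move=> x0 xy; have : 0 <= (- x) * (- (15 * x) - 8 * y) by rewrite mulr_ge0//; lra.
lra.
Qed.

(** A tangent-line substitute for Cauchy-Schwarz: with x a derivative and y constant, the right-hand
    side integrates exactly, and y is chosen at the end. *)
Lemma square_tangent (k x y : R) : 0 <= k -> - (k * x ^+ 2) <= k * (2 * y * x + y ^+ 2).
Proof.
move=> k0; have : 0 <= k * (x + y) ^+ 2 by rewrite mulr_ge0// sqr_ge0.
lra.
Qed.

(** The gradient part is - l (4 q' + m')^2 / 72. The potential part costs at most 24/25 of it, and
    1/1800 = 1 / (25 * 72) remains. *)
Lemma wall_remainder (l c q m dq dm : R) : 0 < l -> 0 < c -> -1 <= q -> m <= 0 -> 4 * q + m <= 1 ->
  (-1 < m -> c + c ^+ 2 <= l / 2 * (dq ^+ 2 + dm ^+ 2) - potential c q m /\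
     dq ^+ 2 + dm ^+ 2 <= (4 * dq + dm) ^+ 2) ->
  remainder l c q m dq dm (1 / 6 * (1 - 4 * q - m)) (1 / 6 * (1 - 4 * q - m))
     (1 / 6 * - (4 * dq + dm)) (1 / 6 * - (4 * dq + dm)) <= - (l / 1800 * (4 * dq + dm) ^+ 2).
Proof.
move=> l0 c0 q1 m0 qm hm.
pose t := 1 + q; pose r := 1 + m.
set Y := 4 * dq + dm.
suff h : (6 - 4 * t - r) * (- wall_T t r - 2 * c * wall_K t r) <= 24 / 25 * (l * Y ^+ 2).
  rewrite -subr_ge0; move: h; rewrite -subr_ge0 => h.
  have {}h := mulr_ge0 (_ : 0 <= 1 / 72) h; apply: le_trans (h _) _; first by lra.
  rewrite le_eqVlt; apply/orP; left; apply/eqP.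
  by rewrite /remainder /wall_T /wall_K /t /r /Y; field.
have A0 : 0 <= 6 - 4 * t - r by rewrite /t /r; lra.
have t0 : 0 <= t by rewrite /t; lra.
have Y0 : 0 <= l * Y ^+ 2 by rewrite mulr_ge0 ?sqr_ge0// ltW.
have [m1|m1] := leP m (-1).
  have n0 : 0 <= - r by rewrite /r; lra.
  have n1 : 4 * t - - r <= 6 by rewrite /t /r; lra.
  have := wall_poly_out t0 n0 n1; rewrite opprK => T0.
  have K0 : 0 <= wall_K t r.
    have -> : wall_K t r = 3 * (- r) + 8 * (- r) ^+ 2 + 9 * ((- r) * t) + 4 * t ^+ 2.
      by rewrite /wall_K; ring.
    by rewrite !addr_ge0// mulr_ge0 ?sqr_ge0// mulr_ge0.
  have h1 : 0 <= c * wall_K t r by rewrite mulr_ge0// ltW.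
  have : (6 - 4 * t - r) * (- wall_T t r - 2 * c * wall_K t r) <= 0.
    by rewrite mulr_ge0_le0//; lra.
  lra.
have [hH hY] := hm m1.
have r0 : 0 <= r by rewrite /r; lra.
have r1 : r <= 1 by rewrite /r; lra.
have t1 : t <= 3 / 2 by lra.
have := wall_poly (ltW c0) t0 t1 r0 r1 A0.
move: (_ * (- wall_T t r - _)) => X hX.
have e : c * ((1 - t) * (1 - r) ^+ 2) = - (c * q * m ^+ 2) by rewrite /t /r; ring.
have := sqr_ge0 (q ^+ 2 - 1); have := sqr_ge0 (m ^+ 2 - 1).
have : l * (dq ^+ 2 + dm ^+ 2) <= l * Y ^+ 2 by rewrite ler_pM2l.
move: hX hH; rewrite e /potential; clear; lra.
Qed.

(** The choice f2 = f1 - m/2 meets the wall perturbation where m = 0 and drops to 0 where m/2 = f1.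
    In the expanded form only c q (m + f) f can be positive; it is at most c/8, which the kinetic
    terms cover since the Hamiltonian gives l/2 (q'^2 + m'^2) >= 3 c / 4. *)
Lemma middle_remainder (l c q m dq dm : R) : 0 < l -> 0 < c -> - (1 / 2) <= q -> 0 <= m ->
  m / 2 <= 1 / 6 * (1 - 4 * q) ->
  c + c ^+ 2 <= l / 2 * (dq ^+ 2 + dm ^+ 2) - potential c q m ->
  remainder l c q m dq dm (1 / 6 * (1 - 4 * q)) (1 / 6 * (1 - 4 * q) - m / 2)
     (- (2 / 3 * dq)) (- (2 / 3 * dq) - dm / 2) <= 0.
Proof.
move=> l0 c0 q1 m0 mp hH.
set p := 1 / 6 * (1 - 4 * q) in mp *; pose f := p - m / 2; pose h := (1 + 2 * q) / 3.
have -> : remainder l c q m dq dm p (p - m / 2) (- (2 / 3 * dq)) (- (2 / 3 * dq) - dm / 2) =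
  - (2 / 9 * (l * dq ^+ 2)) - 1 / 8 * (l * dm ^+ 2) - 4 * (h * p * (1 - q ^+ 2)) - c * m * f * h
   - 1 / 2 * ((1 - m ^+ 2) * ((m + f) * f)) - 2 * (c * m * p * (m + f)) + c * (q * ((m + f) * f)).
  by rewrite /remainder /f /h /p; field.
have p0 : 0 <= p by lra.
have q2 : q <= 1 / 4 by rewrite /p in p0; lra.
have p2 : p <= 1 / 2 by rewrite /p; lra.
have m2 : m <= 1 by lra.
have f0 : 0 <= f by rewrite /f; lra.
have h0 : 0 <= h by rewrite /h; lra.
have mm : m ^+ 2 <= 1 by rewrite expr_le1.
have q3 : q ^+ 2 <= 1 by apply: sqr_le1_itv; lra.
have t1 : 0 <= h * p * (1 - q ^+ 2) by apply: mulr_ge0; [exact: mulr_ge0|lra].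
have cm : 0 <= c * m by rewrite mulr_ge0// ltW.
have t2 : 0 <= c * m * f * h by apply: mulr_ge0 => //; exact: mulr_ge0.
have mf : 0 <= m + f by lra.
have ff : 0 <= (m + f) * f by exact: mulr_ge0.
have t3 : 0 <= (1 - m ^+ 2) * ((m + f) * f) by apply: mulr_ge0 => //; lra.
have t4 : 0 <= c * m * p * (m + f) by apply: mulr_ge0 => //; exact: mulr_ge0.
have dq0 : 0 <= l * dq ^+ 2 by rewrite mulr_ge0 ?sqr_ge0// ltW.
have dm0 : 0 <= l * dm ^+ 2 by rewrite mulr_ge0 ?sqr_ge0// ltW.
have cqm : c * (q * m ^+ 2) <= c * (1 / 4).
  rewrite ler_pM2l//; have := sqr_ge0 m => m20.
  by apply: le_trans (ler_wpM2r m20 q2) _; lra.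
have hW : c + c ^+ 2 - c * (q * m ^+ 2) <= l / 2 * (dq ^+ 2 + dm ^+ 2).
  move: hH; rewrite /potential.
  have := sqr_ge0 (q ^+ 2 - 1); have := sqr_ge0 (m ^+ 2 - 1); lra.
have c2 : 0 <= c ^+ 2 by exact: sqr_ge0.
suff : c * (q * ((m + f) * f)) <= c * (1 / 8) by lra.
rewrite ler_pM2l//.
have [q0|q0] := leP q 0.
  have h1 : q * ((m + f) * f) <= 0 by exact: mulr_le0_ge0.
  by apply: le_trans h1 _; lra.
have p3 : p <= 1 / 6 by rewrite /p; lra.
have : (m + f) * f <= (1 / 3) * (1 / 6) by apply: ler_pM => //; rewrite /f; lra.
have : q * ((m + f) * f) <= 1 / 4 * ((m + f) * f) by rewrite ler_wpM2r.
lra.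
Qed.

(** Bridges from 4 q = 1, where f1 = 0 joins the rotation field, to the point where the f2 of the
    middle range vanishes. For q in [-1/2, 1/4] all terms have the good sign. *)
Lemma upper_remainder (l c q m dq dm : R) : 0 < l -> 0 < c -> - (1 / 2) <= q -> q <= 1 / 4 ->
  remainder l c q m dq dm (1 / 6 * (1 - 4 * q)) 0 (- (2 / 3 * dq)) 0 <= 0.
Proof.
move=> l0 c0 q1 q2.
set p := 1 / 6 * (1 - 4 * q); pose h := (1 + 2 * q) / 3.
have -> : remainder l c q m dq dm p 0 (- (2 / 3 * dq)) 0 =
  - (4 / 9 * (l * dq ^+ 2)) - 4 * (h * p * (1 - q ^+ 2)) - 2 * (c * m ^+ 2 * p).
  by rewrite /remainder /h /p; field.
have p0 : 0 <= p by rewrite /p; lra.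
have h0 : 0 <= h by rewrite /h; lra.
have q3 : q ^+ 2 <= 1 by apply: sqr_le1_itv; lra.
have t1 : 0 <= h * p * (1 - q ^+ 2) by apply: mulr_ge0; [exact: mulr_ge0|lra].
have t4 : 0 <= c * m ^+ 2 * p by apply: mulr_ge0 => //; rewrite mulr_ge0 ?sqr_ge0// ltW.
have dq0 : 0 <= l * dq ^+ 2 by rewrite mulr_ge0 ?sqr_ge0// ltW.
lra.
Qed.

(** Here h = 2 (q - q0) / (1 - q0) and w = m: h equals 2 q where q = 1 and vanishes where q = q0.
    The bounds on q0 keep z = 1 / (1 - q0) in [1/2, 2/3], whence 2 z (1 - z) >= 4/9. *)
Lemma low_remainder (l c q m dq dm k q0 : R) : 0 < l -> 0 < c -> -1 <= q0 -> q0 <= - (1 / 2) ->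
  q0 <= q -> q <= 1 ->
  remainder l c q m dq dm ((1 - q0)^-1 * (q - q0) - q) 0 ((1 - q0)^-1 * dq - dq) 0 <=
    4 / 9 * l * (2 * k * dq + k ^+ 2).
Proof.
move=> l0 c0 q1 q2 q3 q4; have q5 : 1 - q0 != 0 by lra.
pose z := (1 - q0)^-1.
have zq : z * (1 - q0) = 1 by rewrite mulVf.
have z0 : 0 < z by rewrite invr_gt0; lra.
have z1 : 1 / 2 <= z by nra.
have z2 : z <= 2 / 3 by nra.
have q0z : q0 = 1 - z^-1 by rewrite invrK; ring.
pose f := (1 - z) * (1 - q).
have f0 : 0 <= f by apply: mulr_ge0; lra.
have -> : remainder l c q m dq dm (z * (q - q0) - q) 0 (z * dq - dq) 0 =
  - (2 * (1 - z) * z * (l * dq ^+ 2)) - 8 * (z * (q - q0) * (1 - q ^+ 2) * f) - 2 * (c * m ^+ 2 * f).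
  by rewrite /remainder /f q0z; field; rewrite gt_eqF.
have qq : q ^+ 2 <= 1 by apply: sqr_le1_itv; lra.
have t1 : 0 <= z * (q - q0) * (1 - q ^+ 2) * f.
  by apply: mulr_ge0 => //; apply: mulr_ge0; [apply: mulr_ge0|]; lra.
have t2 : 0 <= c * m ^+ 2 * f by apply: mulr_ge0 => //; rewrite mulr_ge0 ?sqr_ge0// ltW.
have dq0 : 0 <= l * dq ^+ 2 by rewrite mulr_ge0 ?sqr_ge0// ltW.
have t3 : 4 / 9 * (l * dq ^+ 2) <= 2 * (1 - z) * z * (l * dq ^+ 2).
  by rewrite ler_wpM2r//; nra.
have t4 : 0 <= l * (dq + k) ^+ 2 by rewrite mulr_ge0 ?sqr_ge0// ltW.
lra.
Qed.

Variables (l c : R) (q dq m dm : R -> R).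
Hypotheses (l0 : 0 < l) (c0 : 0 < c) (sol : solution l c q dq m dm).
Hypotheses (qN1 : q (-1) = 1) (mN1 : m (-1) = 1) (q1 : q 1 = -1) (m1 : m 1 = -1).
Hypothesis (hH : c + c ^+ 2 <= ham l c q dq m dm (-1)).

Lemma ham_ge y : -1 <= y -> y <= 1 ->
  c + c ^+ 2 <= l / 2 * (dq y ^+ 2 + dm y ^+ 2) - potential c (q y) (m y).
Proof. by move=> y1 y2; move: hH; rewrite -(ham_cst l0 sol y1 y2). Qed.

(** [k] is the free constant of [square_tangent]; 5 + 4 q b + m b is the drop of 4 q + m between b
    and the wall. *)
Lemma seg_wall b k : -1 <= b -> b < 1 ->
  (forall y, b < y -> y <= 1 -> m y < 0 /\ 4 * q y + m y <= 1) ->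
  seg l c q m b 1 (2 * (q b + 1 / 6 * (1 - 4 * q b - m b))) (m b + 1 / 6 * (1 - 4 * q b - m b)) 0 0
    (- flux l dq dm b (2 * (q b + 1 / 6 * (1 - 4 * q b - m b))) (m b + 1 / 6 * (1 - 4 * q b - m b))
     - l / 1800 * (2 * k * (5 + 4 * q b + m b) - k ^+ 2 * (1 - b))).
Proof.
move=> b1 b2 hb; have [lp cp] := conj l0 c0.
have [Cq Cm _ _] := sol_C1 sol b1 (lexx 1).
have Cf : C1_on b 1 (fun y => 1 / 6 * (1 - 4 * q y - m y)) (fun y => 1 / 6 * - (4 * dq y + dm y)).
  move=> y y1 y2; have [? ?] := Cq y y1 y2; have [? ?] := Cm y y1 y2.
  by split; [deriv; ring|cont].
have CE : C1_on b 1 (fun y => l / 1800 * (2 * k * (4 * q y + m y) + k ^+ 2 * y))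
    (fun y => l / 1800 * (2 * k * (4 * dq y + dm y) + k ^+ 2)).
  move=> y y1 y2; have [? ?] := Cq y y1 y2; have [? ?] := Cm y y1 y2.
  by split; [deriv; ring|cont].
have := seg_flux l0 sol b2 b1 (lexx 1) Cf Cf CE.
rewrite q1 m1 (_ : 1 / 6 * (1 - 4 * -1 - -1) = 1); last by lra.
rewrite addNr !mulr0 => h; apply: seg_le (h _) => [|y y1 y2].
  by rewrite /flux !mulr0 addr0 le_eqVlt; apply/orP; left; apply/eqP; ring.
have y1' : -1 <= y := le_trans b1 (ltW y1).
have [my qmy] := hb y y1 (ltW y2).
have q2 := q_ge l0 c0 sol qN1 q1 y1' (ltW y2).
apply: le_trans (wall_remainder l0 c0 q2 (ltW my) qmy _) _ => [my1|].
  split; first exact: ham_ge y1' (ltW y2).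
  have [qy qy2] := wall_range my1 qmy.
  have dq0 := dq_le0 l0 c0 sol qN1 q1 y1' (ltW y2) qy.
  have mneg x : y <= x -> x <= 1 -> m x < 0.
    by move=> yx x1; have [] := hb x (lt_le_trans y1 yx) x1.
  exact: slope_sq dq0 (m_slope l0 c0 sol qN1 q1 m1 y1' (ltW y2) hH qy2 my1 my mneg).
have l18 : 0 <= l / 1800 by apply: divr_ge0; [exact: ltW|exact: ler0n].
exact: square_tangent.
Qed.

Lemma seg_low a b k : -1 <= a -> a < b -> b <= 1 -> q a = 1 -> m b = 0 -> q b <= - (1 / 2) ->
  (forall y, a < y -> y <= b -> q y < 1) ->
  seg l c q m a b (2 * q a) (m a) 0 0
    (- flux l dq dm a (2 * q a) (m a) - 4 / 9 * l * (2 * k * (1 - q b) - k ^+ 2 * (b - a))).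
Proof.
move=> a1 ab b1 qa mb qb hq; have [lp cp] := conj l0 c0.
have b2 : -1 <= b by exact: le_trans a1 (ltW ab).
have qb1 := q_ge l0 c0 sol qN1 q1 b2 b1.
have [Cq Cm _ _] := sol_C1 sol a1 b1.
set z := (1 - q b)^-1.
have zq : z * (1 - q b) = 1 by rewrite mulVf// gt_eqF//; lra.
have Cf : C1_on a b (fun y => z * (q y - q b) - q y) (fun y => z * dq y - dq y).
  move=> y y1 y2; have [? ?] := Cq y y1 y2.
  by split; [deriv; ring|cont].
have CE : C1_on a b (fun y => 4 / 9 * l * (2 * k * q y + k ^+ 2 * y))
    (fun y => 4 / 9 * l * (2 * k * dq y + k ^+ 2)).
  move=> y y1 y2; have [? ?] := Cq y y1 y2.
  by split; [deriv; ring|cont].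
have := seg_flux l0 sol ab a1 b1 Cf (@C1_on_cst _ a b 0) CE.
have -> : 2 * (q a + (z * (q a - q b) - q a)) = 2 * q a by rewrite qa zq; ring.
have -> : 2 * (q b + (z * (q b - q b) - q b)) = 0 by ring.
rewrite mb !addr0 => h.
apply: seg_le (h _) => [|y y1 y2].
  by rewrite /flux qa !mulr0 addr0 le_eqVlt; apply/orP; left; apply/eqP; ring.
apply: low_remainder => //.
- apply: (@nonincreasing_derive _ q dq); first exact: ltW.
    by move=> x yx xb; case: (Cq x (le_trans (ltW y1) yx) xb).
  move=> x yx xb; apply: (dq_le0 l0 c0 sol qN1 q1).
  + exact: le_trans a1 (ltW (lt_trans y1 yx)).
  + exact: le_trans (ltW xb) b1.
  + exact: hq (lt_trans y1 yx) (ltW xb).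
- by apply: ltW; apply: hq => //; exact: ltW.
Qed.

Lemma seg_middle a b : -1 <= a -> a < b -> b <= 1 ->
  (forall y, a <= y -> y <= b -> [/\ 0 <= m y, - (1 / 2) <= q y & m y / 2 <= 1 / 6 * (1 - 4 * q y)]) ->
  let h y := 2 * (q y + 1 / 6 * (1 - 4 * q y)) in
  let w y := m y + (1 / 6 * (1 - 4 * q y) - m y / 2) in
  seg l c q m a b (h a) (w a) (h b) (w b) (flux l dq dm b (h b) (w b) - flux l dq dm a (h a) (w a)).
Proof.
move=> a1 ab b1 hq h w; have [lp cp] := conj l0 c0.
have [Cq Cm _ _] := sol_C1 sol a1 b1.
have Cf : C1_on a b (fun y => 1 / 6 * (1 - 4 * q y)) (fun y => - (2 / 3 * dq y)).
  move=> y y1 y2; have [? ?] := Cq y y1 y2.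
  by split; [deriv; field|cont].
have Cf2 : C1_on a b (fun y => 1 / 6 * (1 - 4 * q y) - m y / 2) (fun y => - (2 / 3 * dq y) - dm y / 2).
  move=> y y1 y2; have [? ?] := Cq y y1 y2; have [? ?] := Cm y y1 y2.
  by split; [deriv; field|cont].
have := seg_flux l0 sol ab a1 b1 Cf Cf2 (@C1_on_cst _ a b 0).
rewrite subrr addr0; apply=> y y1 y2.
have [my qy mqy] := hq y (ltW y1) (ltW y2).
apply: middle_remainder => //; apply: ham_ge.
  exact: le_trans a1 (ltW y1).
exact: le_trans (ltW y2) b1.
Qed.

Lemma seg_upper a b : -1 <= a -> a < b -> b <= 1 ->
  (forall y, a <= y -> y <= b -> - (1 / 2) <= q y /\ q y <= 1 / 4) ->
  let h y := 2 * (q y + 1 / 6 * (1 - 4 * q y)) in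
  seg l c q m a b (h a) (m a) (h b) (m b) (flux l dq dm b (h b) (m b) - flux l dq dm a (h a) (m a)).
Proof.
move=> a1 ab b1 hq h; have [lp cp] := conj l0 c0.
have [Cq Cm _ _] := sol_C1 sol a1 b1.
have Cf : C1_on a b (fun y => 1 / 6 * (1 - 4 * q y)) (fun y => - (2 / 3 * dq y)).
  move=> y y1 y2; have [? ?] := Cq y y1 y2.
  by split; [deriv; field|cont].
have := seg_flux l0 sol ab a1 b1 Cf (@C1_on_cst _ a b 0) (@C1_on_cst _ a b 0).
rewrite subrr !addr0; apply=> y y1 y2.
have [qy1 qy2] := hq y (ltW y1) (ltW y2).
exact: upper_remainder.
Qed.

End WallSegments.

(** * Comparison with the bulk state *)

Section Bulk.
Variable R : realType.
Implicit Types (f g h v w A B df phi q m dq dm : R -> R) (a b c l x y s k t p n : R).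
Local Notation mu := (@lebesgue_measure R).
Local Notation int a b f := (\int[mu]_(x in `[a, b]) f x).
Local Notation intg a b f := (mu.-integrable `[a, b] (EFin \o f)).

(** The potential at y^2 = 1 + 2 c x, which minimises over y^2 as a free real variable;
    [potential_bulk] completes the square. *)
Definition bulk c x := (x ^+ 2 - 1) ^+ 2 - c * x - c ^+ 2 * x ^+ 2.

Lemma potential_bulk c x y :
  potential c x y = bulk c x + 1 / 4 * (y ^+ 2 - 1 - 2 * c * x) ^+ 2.
Proof. by rewrite /potential /bulk; field. Qed.

Lemma bulk_ge c x : 0 < c -> -1 <= x -> x <= 1 -> - (c + c ^+ 2) <= bulk c x.
Proof.
move=> c0 x1 x2; have h := sqr_le1_itv x1 x2.
have h1 : c * x <= c * 1 by rewrite ler_pM2l.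
have h2 : c ^+ 2 * x ^+ 2 <= c ^+ 2 * 1 by rewrite ler_wpM2l// sqr_ge0.
by rewrite /bulk; have := sqr_ge0 (x ^+ 2 - 1); lra.
Qed.

Lemma bulk_min c : 0 < c -> exists rho, [/\ 1 <= rho, bulk c rho < - (c + c ^+ 2) &
  forall x, -1 <= x -> x <= 1 + c -> bulk c rho <= bulk c x].
Proof.
move=> c0.
have [||y + hy] := @EVT_min _ (bulk c) 1 (1 + c); first by lra.
  by apply: continuous_within => y _ _; rewrite /bulk; cont.
rewrite in_itv/= => /andP[y1 y2]; exists y.
have lt : bulk c y < - (c + c ^+ 2).
  (* [bulk] equals - (c + c^2) at 1 and decreases there. With s <= c / 9 the growth s^2 (2 + s)^2 <=
     9 s^2 is beaten by the linear gain c s. *)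
  pose s := Num.min 1 (c / 9).
  have s0 : 0 < s by rewrite lt_min ltr01 divr_gt0.
  have s1 : s <= 1 by rewrite ge_min lexx.
  have s2 : s <= c / 9 by rewrite ge_min lexx orbT.
  apply: le_lt_trans (hy (1 + s) _) _; first by rewrite in_itv/=; lra.
  have h1 : s * s <= c / 9 * s by rewrite ler_pM2r.
  have h2 : 0 < c ^+ 2 * s by rewrite mulr_gt0// exprn_gt0.
  have h3 : s ^+ 2 * (2 + s) ^+ 2 <= s ^+ 2 * 9 by rewrite ler_pM2l ?exprn_gt0//; nra.
  have h4 : 0 <= c ^+ 2 * s ^+ 2 by rewrite mulr_ge0 ?sqr_ge0.
  have -> : bulk c (1 + s) = s ^+ 2 * (2 + s) ^+ 2 - c - c * s - c ^+ 2 - 2 * (c ^+ 2 * s) - c ^+ 2 * s ^+ 2.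
    by rewrite /bulk; ring.
  lra.
split=> // x x1 x2; have [xl|/ltW xl] := leP x 1; last by apply: hy; rewrite in_itv/= xl.
by apply: le_trans (ltW lt) _; exact: bulk_ge.
Qed.

(* The wall perturbation lives in the excluded region m < 0, 4 q + m < 1. *)
Lemma near_bulk c rho e x y : 0 < c -> e <= 1 / 4 -> bulk c rho + e < - (c + c ^+ 2) ->
  (forall x, -1 <= x -> x <= 1 + c -> bulk c rho <= bulk c x) ->
  -1 <= x -> x <= 1 + c -> potential c x y <= bulk c rho + e ->
  1 < x /\ (0 <= y \/ 1 <= 4 * x + y).
Proof.
move=> c0 e1 re hr x1 x2; rewrite potential_bulk => hp.
have y0 := sqr_ge0 (y ^+ 2 - 1 - 2 * c * x).
have x3 : 1 < x.
  rewrite ltNge; apply/negP => xl; have := bulk_ge c0 x1 xl; lra.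
split=> //; have [?|yn] := leP 0 y; [by left|right].
rewrite leNgt; apply/negP => xy.
have hb := hr x x1 x2.
have hy : (y ^+ 2 - 1 - 2 * c * x) ^+ 2 <= 1 by lra.
have y2 : y ^+ 2 <= 2 + 2 * c * x by nra.
have hx : (4 * x - 1) ^+ 2 < y ^+ 2 by nra.
have c9 : 16 * x - 9 < 2 * c.
  have : x * (16 * x - 8 - 2 * c) < x * 1 by lra.
  rewrite ltr_pM2l; lra.
have c7 : 7 * x <= 2 * c by lra.
(* Since 7 x <= 2 c, the value 2 x is still below 1 + c, and it lowers [bulk] by at least 1, more
   than the tolerance e allows. *)
have := hr (2 * x) _ _.
suff : bulk c (2 * x) + 1 <= bulk c x by move=> h1 h2; have := h2 ltac:(lra) ltac:(lra); lra.
have h1 : (7 * x) ^+ 2 <= (2 * c) ^+ 2 by rewrite ler_pXn2r// nnegrE; lra.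
have x20 : 0 <= x ^+ 2 by exact: sqr_ge0.
have h2 := ler_wpM2r x20 h1.
have h3 : 0 <= c * x by rewrite mulr_ge0//; lra.
have h4 : 1 <= x ^+ 2 by nra.
have h5 : 1 <= x ^+ 4 by rewrite (exprM x 2 2); nra.
rewrite /bulk; lra.
Qed.

Lemma linear_bound a s p0 p1 x k : 0 < s -> a <= x -> x <= a + s -> `|p0| <= k -> `|p1| <= k ->
  `|p0 + (p1 - p0) / s * (x - a)| <= k.
Proof.
move=> s0 x1 x2 k0 k1; pose z := (x - a) / s.
have z0 : 0 <= z by rewrite divr_ge0// ?(ltW s0)// subr_ge0.
have z1 : z <= 1 by rewrite ler_pdivrMr// mul1r; lra.
have -> : p0 + (p1 - p0) / s * (x - a) = (1 - z) * p0 + z * p1 by rewrite /z; field; rewrite gt_eqF.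
move: (z) z0 z1 => {}z z0 z1.
apply: le_trans (ler_normD _ _) _; rewrite !normrM (ger0_norm z0) ger0_norm; last by lra.
have := ler_wpM2l z0 k1; have z2 : 0 <= 1 - z by lra.
have := ler_wpM2l z2 k0; lra.
Qed.

Lemma potential_le c x y k : 0 < c -> `|x| <= k -> `|y| <= k ->
  potential c x y <= 2 * (k ^+ 2 + 1) ^+ 2 + c * k * k ^+ 2.
Proof.
move=> c0 xk yk; have k0 : 0 <= k := le_trans (normr_ge0 _) xk.
have sq z : `|z| <= k -> z ^+ 2 <= k ^+ 2.
  by move=> h; rewrite -(real_normK (num_real z)) ler_pXn2r// nnegrE.
have hx := sq x xk; have hy := sq y yk.
have x20 := sqr_ge0 x; have y20 := sqr_ge0 y.
have sq2 z : 0 <= z -> z <= k ^+ 2 -> (z - 1) ^+ 2 <= (k ^+ 2 + 1) ^+ 2 by move=> *; nra.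
have h1 := sq2 _ x20 hx; have h2 := sq2 _ y20 hy.
have h3 : - (c * x * y ^+ 2) <= c * k * k ^+ 2.
  have xk' : - x <= k by apply: le_trans xk; rewrite -normrN ler_norm.
  have ck : 0 <= c * k by rewrite mulr_ge0// ltW.
  have h4 : c * (- x) <= c * k by rewrite ler_pM2l.
  have h5 := ler_wpM2r y20 h4; have h6 := ler_wpM2l ck hy; lra.
rewrite /potential; have := sqr_ge0 (k ^+ 2 + 1); lra.
Qed.

Lemma EdensE l c x y dx dy : Edens l c x y dx dy = l / 2 * (dx ^+ 2 + dy ^+ 2) + potential c x y.
Proof. by rewrite /Edens /potential; ring. Qed.

Lemma Edens_integrable l c q dq m dm a b : pc1 q dq a b -> pc1 m dm a b ->
  intg a b (fun y => Edens l c (q y) (m y) (dq y) (dm y)).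
Proof.
move=> pq pm; have [cq cm] := (pc1_within pq, pc1_within pm).
have X2 (z : R -> R) x : {for x, continuous z} -> {for x, continuous (fun y => z y ^+ 2)}.
  exact: continuousXF.
have iq : intg a b (fun y => dq y ^+ 2) := pc1_integrable (G := fun _ z => z ^+ 2) pq (fun x z => X2 z x).
have im : intg a b (fun y => dm y ^+ 2) := pc1_integrable (G := fun _ z => z ^+ 2) pm (fun x z => X2 z x).
have ii : intg a b (fun y => (q y ^+ 2 + -1) ^+ 2 + (1 / 4 * (m y ^+ 2 + -1) ^+ 2 + - c * (q y * m y ^+ 2))).
  apply: within_continuous_integrable; apply: withinDF; [|apply: withinDF].
  - by apply: withinXF; apply: withinDF; [exact: withinXF|exact: within_cst].
  - apply: withinMF; first exact: within_cst.
    by apply: withinXF; apply: withinDF; [exact: withinXF|exact: within_cst].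
  - by apply: withinMF; [exact: within_cst|apply: withinMF => //; exact: withinXF].
apply: eq_integrable_fun (integrableD_fun (integrableZ_fun (l / 2) (integrableD_fun iq im)) ii) => y _ _.
rewrite /Edens; ring.
Qed.

Definition piece l c a b p0 n0 p1 n1 k := exists P dP N dN,
  [/\ pc1 P dP a b, pc1 N dN a b, P a = p0 /\ N a = n0, P b = p1 /\ N b = n1 &
      int a b (fun y => Edens l c (P y) (N y) (dP y) (dN y)) <= k].

Lemma piece_glue l c a b x p0 n0 p1 n1 p2 n2 k1 k2 : piece l c a b p0 n0 p1 n1 k1 ->
  piece l c b x p1 n1 p2 n2 k2 -> piece l c a x p0 n0 p2 n2 (k1 + k2).
Proof.
move=> [h [dh [w [dw [ph pw [eh ew] [eh' ew'] le]]]]].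
move=> [g [dg [v [dv [pg pv [eg ev] [eg' ev'] le2]]]]].
have [ab bx] := (pc1_lt ph, pc1_lt pg).
have p1' : pc1 (glue b h g) (glue b dh dg) a x by apply: pc1_glue => //; rewrite eh' eg.
have p2' : pc1 (glue b w v) (glue b dw dv) a x by apply: pc1_glue => //; rewrite ew' ev.
have ii := Edens_integrable l c p1' p2'.
exists (glue b h g), (glue b dh dg), (glue b w v), (glue b dw dv); split=> //.
- by rewrite /glue (ltW ab).
- by rewrite /glue leNgt bx.
rewrite (Rint_split (ltW ab) (ltW bx) ii); apply: lerD.
  apply: le_trans le; rewrite le_eqVlt; apply/orP; left; apply/eqP.
  by apply: eq_Rint => y _ yb; rewrite /glue yb.
apply: le_trans le2; rewrite le_eqVlt; apply/orP; left; apply/eqP.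
apply: Rint_eq_oo; first by apply: integrable_sub ii => //; exact: ltW.
by move=> y /andP[by_ _]; rewrite /glue leNgt by_.
Qed.

Lemma piece_cst l c a b p n : a < b -> piece l c a b p n p n (potential c p n * (b - a)).
Proof.
move=> ab; exists (fun=> p), (fun=> 0), (fun=> n), (fun=> 0).
split=> //; try exact: pc1_cst.
by rewrite -(Rint_cst _ (ltW ab)) le_Rint//; [exact: integrable_cst|exact: integrable_cst|
  move=> x _ _; rewrite EdensE; lra].
Qed.

(** On a layer of width s = sqrt l the gradient density is independent of l, so the whole transition
    costs O(s). *)
Lemma piece_linear l c a s p0 n0 p1 n1 k : 0 < c -> 0 < s -> s ^+ 2 = l ->
  `|p0| <= k -> `|p1| <= k -> `|n0| <= k -> `|n1| <= k ->
  piece l c a (a + s) p0 n0 p1 n1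
    ((1 / 2 * ((p1 - p0) ^+ 2 + (n1 - n0) ^+ 2) + (2 * (k ^+ 2 + 1) ^+ 2 + c * k * k ^+ 2)) * s).
Proof.
move=> c0 s0 sl p0k p1k n0k n1k; have as_ : a < a + s by lra.
have C1L p z : C1_on a (a + s) (fun x => p + z * (x - a)) (fun=> z).
  by move=> y _ _; split; [deriv; ring|exact: continuous_cstF].
have E p p' : p + (p' - p) / s * (a + s - a) = p'.
  by rewrite [a + s]addrC addrK divfK ?gt_eqF//; ring.
have pc p z := pc1_C1 as_ (C1L p z).
exists (fun x => p0 + (p1 - p0) / s * (x - a)), (fun=> (p1 - p0) / s).
exists (fun x => n0 + (n1 - n0) / s * (x - a)), (fun=> (n1 - n0) / s).
split=> //.
- by rewrite subrr !mulr0 !addr0.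
set K := (X in X * s).
have -> : K * s = int a (a + s) (fun=> K) by rewrite Rint_cst ?(ltW as_)//; ring.
apply: le_Rint => [||x x1 x2]; [exact: Edens_integrable|exact: integrable_cst|].
rewrite EdensE; apply: lerD; last by apply: potential_le => //; exact: linear_bound.
rewrite -sl le_eqVlt; apply/orP; left; apply/eqP.
by field; rewrite gt_eqF.
Qed.

Lemma competitor_energy c p n : 0 < c -> exists C, 0 < C /\
  forall l s, 0 < s -> s < 1 / 2 -> s ^+ 2 = l ->
  exists P N, admissible_OR P N /\ E l c P N <= 2 * potential c p n + C * s.
Proof.
move=> c0; pose k := 1 + `|p| + `|n|.
have [k1 k2 k3 k4] : [/\ `|1 : R| <= k, `|-1 : R| <= k, `|p| <= k & `|n| <= k].
  rewrite normrN normr1 /k; have := normr_ge0 p; have := normr_ge0 n.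
  by split; lra.
pose K p0 n0 p1 n1 := 1 / 2 * ((p1 - p0) ^+ 2 + (n1 - n0) ^+ 2) + (2 * (k ^+ 2 + 1) ^+ 2 + c * k * k ^+ 2).
pose C := K 1 1 p n + K p n (-1) (-1) + 2 * `|potential c p n|.
have K0 a b x y : 0 < K a b x y.
  have h1 := sqr_ge0 (x - a); have h2 := sqr_ge0 (y - b).
  have k20 := sqr_ge0 k.
  have h3 : 0 < (k ^+ 2 + 1) ^+ 2 by rewrite exprn_gt0//; lra.
  have h4 : 0 <= c * k * k ^+ 2.
    by apply: mulr_ge0 => //; apply: mulr_ge0; [exact: ltW|rewrite /k; have := normr_ge0 p; have := normr_ge0 n; lra].
  by rewrite /K; lra.
have C0 : 0 < C.
  have h1 := K0 1 1 p n; have h2 := K0 p n (-1) (-1); have h3 := normr_ge0 (potential c p n).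
  rewrite /C; move: (K _ _ _ _) (K _ _ _ _) h1 h2 => *; lra.
exists C; split=> // l s s0 s2 sl.
have P1 := piece_linear (-1) c0 s0 sl k1 k3 k1 k4.
have mid : -1 + s < 1 - s by lra.
have P2 := @piece_cst l c _ _ p n mid.
have P3 := piece_linear (1 - s) c0 s0 sl k3 k2 k4 k2.
have := piece_glue (piece_glue P1 P2) P3; rewrite subrK.
move=> [P [dP [N [dN [pP pN [eP eN] [eP' eN'] le]]]]].
exists P, N; split; first by split=> //; [exact: pc1_W12 pP|exact: pc1_W12 pN].
rewrite (E_pc1 l c pP pN); apply: le_trans le _.
rewrite -/(K 1 1 p n) -/(K p n (-1) (-1)) /C.
set W := potential c p n.
have h : - W * s <= `|W| * s by rewrite ler_pM2r// -normrN ler_norm.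
move: (K _ _ _ _) (K _ _ _ _) => *; lra.
Qed.

Lemma excess_ge0 a b x y : a <= b -> 0 <= x -> 0 <= y -> 0 <= x + (b + 1 / 4 * y) - a.
Proof. by move=> *; lra. Qed.

(** The density in excess of the bulk minimum is nonnegative and its integral is O(sqrt l), so for
    small l every subinterval of length eta contains a point where it is at most d. There the pair
    is nearly in the bulk state, and one such point also bounds the Hamiltonian. *)
Lemma small_points c (eta : R) : 0 < c -> 0 < eta -> eta <= 2 -> exists l0, 0 < l0 /\
  forall l q dq m dm, 0 < l -> l < l0 -> solution l c q dq m dm -> minimiser_OR l c q m ->
  c + c ^+ 2 <= ham l c q dq m dm (-1) /\
  forall a, -1 <= a -> a + eta <= 1 ->
    exists y, [/\ a <= y, y <= a + eta, 1 < q y & 0 <= m y \/ 1 <= 4 * q y + m y].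
Proof.
move=> c0 eta0 eta2; have [rho [rho1 rho2 hrho]] := bulk_min c0.
pose mr := Num.sqrt (1 + 2 * c * rho).
have cr : 0 < c * rho by rewrite mulr_gt0//; lra.
have mr2 : mr ^+ 2 = 1 + 2 * c * rho by rewrite sqr_sqrtr//; lra.
have Wb : potential c rho mr = bulk c rho.
  by rewrite potential_bulk mr2 (_ : _ - _ - _ = 0) ?expr0n/= ?mulr0 ?addr0//; ring.
have [C [C0 hC]] := competitor_energy rho mr c0.
pose d := Num.min (1 / 4) ((- (c + c ^+ 2) - bulk c rho) / 2).
have d0 : 0 < d by rewrite /d lt_min; apply/andP; split; lra.
have d1 : d <= 1 / 4 by rewrite /d ge_min lexx.
have d2 : d <= (- (c + c ^+ 2) - bulk c rho) / 2 by rewrite /d ge_min lexx orbT.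
(* Makes the total excess C s less than d eta / 2, so that it cannot exceed d throughout a
   subinterval of length eta. *)
pose s0 := Num.min (1 / 2) (d * eta / (2 * C)).
have s00 : 0 < s0.
  by rewrite /s0 lt_min; apply/andP; split; [lra|rewrite divr_gt0// mulr_gt0].
have s01 : s0 <= 1 / 2 by rewrite /s0 ge_min lexx.
have s02 : s0 <= d * eta / (2 * C) by rewrite /s0 ge_min lexx orbT.
exists (s0 ^+ 2); split; first by rewrite exprn_gt0.
move=> l q dq m dm l0 ll sol min.
pose s := Num.sqrt l.
have sp : 0 < s by rewrite sqrtr_gt0.
have sl : s ^+ 2 = l by rewrite sqr_sqrtr// ltW.
have ss : s < s0 by move: ll; rewrite -sl ltr_pXn2r// nnegrE ltW.
have [P [N [aPN EPN]]] := hC l s sp (lt_le_trans ss s01) sl.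
have hE := le_trans (min.2 P N aPN) EPN.
have [[_ _ [qN1 mN1] [q1 m1]] _] := min.
have [Cq Cm] := solution_C1 sol.
have pq := pc1_C1 (ltrN11 R) Cq; have pm := pc1_C1 (ltrN11 R) Cm.
rewrite (E_pc1 l c pq pm) Wb in hE.
pose g y := Edens l c (q y) (m y) (dq y) (dm y) - bulk c rho.
have n11 : (-1 : R) <= 1 := ltW (ltrN11 R).
have iE := Edens_integrable l c pq pm.
have ig : intg (-1) 1 g by apply: integrableB_fun => //; exact: integrable_cst.
have g0 y : -1 <= y -> y <= 1 -> 0 <= g y.
  move=> y1 y2; rewrite /g EdensE potential_bulk.
  have h1 := hrho _ (q_ge l0 c0 sol qN1 q1 y1 y2) (q_le l0 c0 sol qN1 mN1 q1 m1 y1 y2).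
  have h2 : 0 <= l / 2 * (dq y ^+ 2 + dm y ^+ 2).
    by rewrite mulr_ge0 ?addr_ge0 ?sqr_ge0// divr_ge0// ltW.
  have h3 := sqr_ge0 (m y ^+ 2 - 1 - 2 * c * q y).
  exact: excess_ge0.
have gC : int (-1) 1 g <= C * s.
  rewrite /g RintB//; last exact: integrable_cst.
  by rewrite Rint_cst//; lin hE.
have small a : -1 <= a -> a + eta <= 1 -> exists y, [/\ a <= y, y <= a + eta & g y <= d].
  move=> a1 a2; apply: contrapT => ny.
  have gd y : a <= y -> y <= a + eta -> d <= g y.
    by move=> y1 y2; rewrite leNgt; apply/negP => gy; apply: ny; exists y; split=> //; exact: ltW.
  have aeta : a <= a + eta by lin eta0.
  have ga : int a (a + eta) (fun=> d) <= int a (a + eta) g.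
    by apply: le_Rint => //; [exact: integrable_cst|exact: integrable_sub ig].
  have int0 b b' : -1 <= b -> b <= b' -> b' <= 1 -> 0 <= int b b' g.
    move=> u1 uv v1; rewrite -(mul0r (b' - b)) -Rint_cst//.
    apply: le_Rint => [||y y1 y2]; [exact: integrable_cst|exact: integrable_sub ig|].
    by apply: g0; [exact: le_trans u1 y1|exact: le_trans y2 v1].
  have hs : int (-1) 1 g = int (-1) a g + (int a (a + eta) g + int (a + eta) 1 g).
    rewrite (Rint_split a1 (le_trans aeta a2) ig) (Rint_split aeta a2)//.
    exact: integrable_sub ig.
  have hl := int0 (-1) a (lexx _) a1 (le_trans aeta a2).
  have hr := int0 (a + eta) 1 (le_trans a1 aeta) a2 (lexx _).
  rewrite Rint_cst// [a + eta - a](_ : _ = eta) in ga; last by ring.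
  have hd : s * (2 * C) < d * eta.
    by rewrite -ltr_pdivlMr ?mulr_gt0//; exact: lt_le_trans ss s02.
  have Cs : 0 < C * s by rewrite mulr_gt0.
  by lin gC hs hl hr ga hd Cs.
have pot y : -1 <= y -> y <= 1 -> g y <= d ->
    l / 2 * (dq y ^+ 2 + dm y ^+ 2) >= 0 /\ potential c (q y) (m y) <= bulk c rho + d.
  move=> y1 y2; rewrite /g EdensE.
  have h2 : 0 <= l / 2 * (dq y ^+ 2 + dm y ^+ 2).
    by rewrite mulr_ge0 ?addr_ge0 ?sqr_ge0// divr_ge0// ltW.
  by move=> h; split=> //; lin h h2.
have d3 : bulk c rho + d < - (c + c ^+ 2) by lin d2 rho2.
split.
  have [|y [y1 y2 gy]] := small (-1) (lexx _); first by lin eta2.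
  have y2' : y <= 1 by lin y2 eta2.
  have [h1 h2] := pot y y1 y2' gy.
  by rewrite -(ham_cst l0 sol y1 y2') /ham; lin h1 h2 d3.
move=> a a1 a2; have [y [y1 y2 gy]] := small a a1 a2.
have y1' := le_trans a1 y1; have y2' := le_trans y2 a2.
have [_ hp] := pot y y1' y2' gy.
have [h1 h2] := near_bulk c0 d1 d3 hrho (q_ge l0 c0 sol qN1 q1 y1' y2')
  (q_le l0 c0 sol qN1 mN1 q1 m1 y1' y2') hp.
by exists y.
Qed.
End Bulk.

(** * Sign of M *)

Section Sign.
Variable R : realType.
Implicit Types (f g : R -> R) (a b x y d : R).
Local Notation mu := (@lebesgue_measure R).
Local Notation int a b f := (\int[mu]_(x in `[a, b]) f x).

Lemma derive_zero_right f x b d : is_derive x 1 f d -> x < b ->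
  (forall y, x <= y -> y <= b -> f y = 0) -> d = 0.
Proof.
move=> fd xb f0; have fx := f0 x (lexx _) (ltW xb).
pose y e := Num.min (x + e / 2) b.
have yP e : 0 < e -> [/\ x < y e, y e < x + e & f (y e) = 0].
  move=> e0; have h1 : x < y e by rewrite /y lt_min xb andbT; lra.
  split=> //; first by rewrite /y gt_min; apply/orP; left; lra.
  by apply: f0; [exact: ltW|rewrite /y ge_min lexx orbT].
apply/eqP; rewrite eq_le; apply/andP; split; rewrite leNgt; apply/negP => d0.
  have [e e0 he] := derive_gt0_right fd d0.
  have [h1 h2 h3] := yP e e0; have := he _ h1 h2; rewrite h3 fx; lra.
have fdN : is_derive x 1 (fun z => - f z) (- d) by deriv.
have d0' : 0 < - d by lra.
have [e e0 he] := derive_gt0_right fdN d0'.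
have [h1 h2 h3] := yP e e0; have := he _ h1 h2; rewrite h3 fx; lra.
Qed.

Lemma derive_zero_left f x a d : is_derive x 1 f d -> a < x ->
  (forall y, a <= y -> y <= x -> f y = 0) -> d = 0.
Proof.
move=> fd ax f0.
have h : is_derive (- x) 1 (fun z => f (- z)) (- d).
  have h1 : is_derive (- x) 1 (fun z : R => - z) (-1) by deriv.
  have := @is_derive1_comp _ f (fun z : R => - z) (- x) _ _; rewrite opprK => /(_ _ _ fd h1).
  by rewrite mulrN1.
apply: oppr_inj; rewrite oppr0; apply: (derive_zero_right h (b := - a)).
  by rewrite ltrN2.
by move=> y y1 y2; apply: f0; [rewrite lerNr|rewrite lerNl].
Qed.

Variables (l c : R) (q dq m dm : R -> R).
Hypotheses (l0 : 0 < l) (c0 : 0 < c) (sol : solution l c q dq m dm).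
Hypothesis (min : minimiser_OR l c q m).

(* Otherwise flipping the sign of [m] between two consecutive zeros gives
   another minimiser; it is C^1, so [m] vanishes to first order at a zero and
   hence identically to its right. *)
Lemma m_ge0_left b : -1 <= b -> b < 1 -> m b = 0 -> forall y, -1 <= y -> y <= b -> 0 <= m y.
Proof.
move=> b1 b2 mb y y1 yb; rewrite leNgt; apply/negP => my.
have [[_ _ [qN1 mN1] [q1 m1]] _] := min.
have yle1 : y <= 1 := le_trans yb (ltW b2).
have [x x1 x2|//||a [a1 ay ma ha]] := @first_hit_left _ m (-1) y y1.
- by have [_ _ ? _] := sol_continuous sol x1 (le_trans x2 yle1).
- by rewrite mN1.
have [x x1 x2|//||b' [yb' b'b mb' hb]] := @first_hit_right _ m y b yb.
- by have [_ _ ? _] := sol_continuous sol (le_trans y1 x1) (le_trans x2 (ltW b2)).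
- by rewrite mb.
have aN1 : -1 < a.
  by rewrite lt_neqAle a1 andbT; apply/eqP => e; move: ma; rewrite -e mN1; lra.
have ab : a < b' by exact: lt_trans ay yb'.
have b'1 : b' < 1 by exact: le_lt_trans b'b b2.
pose N x := if a <= x <= b' then - m x else m x.
pose dN x := if a <= x <= b' then - dm x else dm x.
have [Cq Cm] := solution_C1 sol.
have CmN : C1_on a b' (fun x => - m x) (fun x => - dm x).
  move=> x x1 x2; have [? ?] := Cm x (le_trans a1 x1) (le_trans x2 (ltW b'1)).
  by split; [deriv|cont].
have pN : pc1 N dN (-1) 1.
  apply: (@Pc1_cat _ _ _ _ b'); first apply: (@Pc1_cat _ _ _ _ a).
  - apply: (Pc1_smooth aN1 (C1_on_sub (lexx _) (ltW (lt_trans ab b'1)) Cm)) => x x1 x2; rewrite /N /dN.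
      case: ifP => // /andP[x3 _]; have -> : x = a by apply/eqP; rewrite eq_le x2.
      by rewrite ma oppr0.
    by rewrite leNgt x2.
  - by apply: (Pc1_smooth ab CmN) => x x1 x2; rewrite /N /dN ?x1 ?x2// !ltW.
  - apply: (Pc1_smooth b'1 (C1_on_sub (ltW (lt_trans aN1 ab)) (lexx _) Cm)) => x x1 x2; rewrite /N /dN.
      case: ifP => // /andP[_ x3]; have -> : x = b' by apply/eqP; rewrite eq_le x1 x3.
      by rewrite mb' oppr0.
    by rewrite [x <= b']leNgt x1 andbF.
have n11 := ltrN11 R.
have pq := pc1_C1 n11 Cq; have pm := pc1_C1 n11 Cm.
have aN : admissible_OR q N.
  split; [exact: pc1_W12 pq|exact: pc1_W12 pN| |]; split=> //.
  - by rewrite /N leNgt aN1.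
  - by rewrite /N [1 <= b']leNgt b'1 andbF.
have minN : minimiser_OR l c q N.
  apply: (minimiser_of_eq min aN); rewrite (E_pc1 l c pq pN) (E_pc1 l c pq pm).
  apply: eq_Rint => x _ _; rewrite /Edens /N /dN.
  by case: ifP => _ //; rewrite !sqrrN.
have [q' [dq' [m' [dm' [_ Nm sol']]]]] := minimiser_solution l0 minN.
have bN1 : -1 <= b' := ltW (lt_trans aN1 ab).
have [_ _ dmb _] := sol bN1 (ltW b'1).
have [_ _ dmb' _] := sol' _ bN1 (ltW b'1).
(* The regular version m' of the flipped function equals m to the right of b' and - m to its left,
   so its derivative at b' is both [dm b'] and [- dm b']. *)
have e1 : dm b' - dm' b' = 0.
  have d1 : is_derive b' 1 (fun x => m x - m' x) (dm b' - dm' b') by deriv.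
  apply: (derive_zero_right d1 b'1) => x x1 x2.
  rewrite -Nm//; last exact: le_trans bN1 x1.
  rewrite /N; case: ifP => [/andP[_ x3]|]; last by rewrite subrr.
  have -> : x = b' by apply/eqP; rewrite eq_le x1 x3.
  by rewrite mb' oppr0 subrr.
have e2 : dm b' + dm' b' = 0.
  have d2 : is_derive b' 1 (fun x => m x + m' x) (dm b' + dm' b') by deriv.
  apply: (derive_zero_left d2 ab) => x x1 x2.
  rewrite -Nm; [|exact: le_trans a1 x1|exact: le_trans x2 (ltW b'1)].
  by rewrite /N x1 x2 subrr.
by apply: (m_unique l0 c0 sol qN1 mN1 q1 m1 bN1 b'1 mb'); lra.
Qed.

End Sign.

(** * Instability *)

Section Assembly.
Variable R : realType.
Implicit Types (f g : R -> R) (a b x y d : R).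
Local Notation mu := (@lebesgue_measure R).
Local Notation int a b f := (\int[mu]_(x in `[a, b]) f x).

(* The gain is l times a multiple of 1/eta, the cost of cutting off the
   rotation field over the rest of the channel only l K / 2. *)
Lemma gain_wall (l K eta y x : R) : 0 < l -> 0 < eta -> K * (101 * eta) = 1 -> 3 <= y -> x <= eta ->
  l * K / 2 - l / 1800 * (2 * (3 / eta) * y - (3 / eta) ^+ 2 * x) < 0.
Proof.
move=> l0 e0 eK y3 xe.
pose z := eta^-1; have z0 : 0 < z by rewrite invr_gt0.
have ez : eta * z = 1 by rewrite divff// gt_eqF.
have Kz : K = z / 101.
  have Ke : K * eta = 1 / 101 by lra.
  transitivity (K * eta * z); first by rewrite -mulrA ez mulr1.
  by rewrite Ke mul1r mulrC.
have h1 : z ^+ 2 * x <= z.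
  have := ler_wpM2l (sqr_ge0 z) xe; have -> // : z ^+ 2 * eta = z.
  by rewrite expr2 -mulrA [z * eta]mulrC ez mulr1.
have h2 : z * 3 <= z * y by rewrite ler_pM2l.
have -> : l * K / 2 - l / 1800 * (2 * (3 / eta) * y - (3 / eta) ^+ 2 * x) =
   l / 1800 * (900 / 101 * z - 6 * (z * y) + 9 * (z ^+ 2 * x)).
  by rewrite -/z Kz; field.
rewrite pmulr_rlt0; lra.
Qed.

Lemma gain_low (l K eta y x : R) : 0 < l -> 0 < eta -> K * (101 * eta) = 1 -> 3 / 2 <= y -> x <= 2 * eta ->
  l * K / 2 - 4 / 9 * l * (2 * (1 / eta) * y - (1 / eta) ^+ 2 * x) < 0.
Proof.
move=> l0 e0 eK y3 xe.
pose z := eta^-1; have z0 : 0 < z by rewrite invr_gt0.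
have ez : eta * z = 1 by rewrite divff// gt_eqF.
have Kz : K = z / 101.
  have Ke : K * eta = 1 / 101 by lra.
  transitivity (K * eta * z); first by rewrite -mulrA ez mulr1.
  by rewrite Ke mul1r mulrC.
have h1 : z ^+ 2 * x <= 2 * z.
  have := ler_wpM2l (sqr_ge0 z) xe; have -> // : z ^+ 2 * (2 * eta) = 2 * z.
  by rewrite mulrCA expr2 -mulrA [z * eta]mulrC ez mulr1.
have h2 : z * (3 / 2) <= z * y by rewrite ler_pM2l.
have -> : l * K / 2 - 4 / 9 * l * (2 * (1 / eta) * y - (1 / eta) ^+ 2 * x) =
   l * (z / 202 - 8 / 9 * (z * y) + 4 / 9 * (z ^+ 2 * x)).
  by rewrite -/z Kz; field.
by rewrite pmulr_rlt0//; lra.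
Qed.

Definition rotation_bound (c : R) : R := 4 * (1 + c) ^+ 2 + (1 + 2 * c + 2 * c ^+ 2).

Lemma eta_small (c eta : R) : 0 < c -> 0 < eta -> rotation_bound c * (101 * eta) = 1 ->
  2 * eta <= 1.
Proof.
move=> c0 eta0 etaK.
have h : 4 <= rotation_bound c by rewrite /rotation_bound; have := sqr_ge0 c; nra.
have : 4 * (101 * eta) <= rotation_bound c * (101 * eta) by rewrite ler_wpM2r//; lra.
rewrite etaK; lra.
Qed.

Lemma seg_rotation_minimiser (l c : R) (q dq m dm : R -> R) s : 0 < l -> 0 < c ->
  solution l c q dq m dm -> minimiser_OR l c q m -> 0 <= s -> s <= 1 ->
  seg l c q m (-1) s 0 0 (2 * q s) (m s)
    (flux l dq dm s (2 * q s) (m s) + l * rotation_bound c / 2).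
Proof.
move=> l0 c0 sol [[_ _ [qN1 mN1] [q1 m1]] _] s0 s1.
apply: (seg_rotation l0 sol s0 s1) => y y1 ys; have y2 := le_trans ys s1.
apply: lerD; last exact: (m_bound l0 c0 sol qN1 mN1 q1 m1).
have h1 := q_ge l0 c0 sol qN1 q1 y1 y2; have h2 := q_le l0 c0 sol qN1 mN1 q1 m1 y1 y2.
rewrite ler_pM2l//.
have : 0 <= (1 + c - q y) * (1 + c + q y) by apply: mulr_ge0; [lin h2|lin h1 c0].
by lin.
Qed.

(** At the zero b of m, q is already at most -1/2: an h affine in q and w = m vanish together at b
    and are continued by zero. The drop of q from 1, at least 3/2, pays for the cut-off. *)
Lemma seg_negative_low (l c : R) (q dq m dm : R -> R) (eta b z : R) : 0 < l -> 0 < c ->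
  solution l c q dq m dm -> minimiser_OR l c q m ->
  0 < eta -> rotation_bound c * (101 * eta) = 1 ->
  0 <= z -> 1 - 2 * eta <= z -> z <= b -> b < 1 -> 1 < q z -> m b = 0 -> q b <= - (1 / 2) ->
  exists2 k, k < 0 & seg l c q m (-1) 1 0 0 0 0 k.
Proof.
move=> l0 c0 sol min eta0 etaK z0 ez zb b1 qz mb qb.
have [[_ _ [qN1 mN1] [q1 m1]] _] := min; have b1' := ltW b1.
have [y y1 y2|||a [za ab qa ha]] := @first_hit_left _ (fun y => q y - 1) z b zb.
- have [? _ _ _] : [/\ {for y, continuous q}, {for y, continuous dq},
      {for y, continuous m} & {for y, continuous dm}].
    by apply: (sol_continuous sol); [lin z0 y1|lin y2 b1].
  by cont.
- by lin qb.
- by lin qz.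
have aN1 : -1 <= a by lin z0 za.
have a0 : 0 <= a by lin z0 za.
have a1 : a <= 1 by lin ab b1.
have bN1 : -1 <= b by lin aN1 ab.
have qa1 : q a = 1 by lin qa.
have ha' y : a < y -> y <= b -> q y < 1 by move=> y1 y2; have h := ha y y1 y2; lin h.
have S1 := seg_low l0 c0 sol qN1 q1 (1 / eta) aN1 ab b1' qa1 mb qb ha'.
have S2 := seg_zero sol b1 bN1 (lexx 1).
have SR := seg_rotation_minimiser l0 c0 sol min a0 a1.
have := seg_glue sol (lexx (-1)) (lexx 1) (seg_glue sol (lexx (-1)) b1' SR S1) S2.
set k := (X in seg _ _ _ _ _ _ _ _ _ _ X) => S'; exists k => //.
have y3 : 3 / 2 <= 1 - q b by lin qb.
have ba : b - a <= 2 * eta by lin za ez b1.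
have h := gain_low l0 eta0 etaK y3 ba.
by rewrite /k; lin h.
Qed.

(** The pieces meet at a, where 4 q = 1, at b', where the f2 of the middle range vanishes, and at
    the zero b of m. [m_ge0_left] supplies the sign at a that makes b' exist. *)
Lemma seg_negative_middle (l c : R) (q dq m dm : R -> R) (eta b z : R) : 0 < l -> 0 < c ->
  solution l c q dq m dm -> minimiser_OR l c q m ->
  c + c ^+ 2 <= ham l c q dq m dm (-1) ->
  0 < eta -> rotation_bound c * (101 * eta) = 1 ->
  0 <= z -> 1 - eta <= b -> z <= b -> b < 1 -> 1 < q z -> m b = 0 ->
  - (1 / 2) < q b -> 4 * q b < 1 ->
  (forall y, b < y -> y <= 1 -> m y < 0 /\ 4 * q y + m y <= 1) ->
  exists2 k, k < 0 & seg l c q m (-1) 1 0 0 0 0 k.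
Proof.
move=> l0 c0 sol min hH eta0 etaK z0 eb zb b1 qz mb qb qb4 hwall.
have [[_ _ [qN1 mN1] [q1 m1]] _] := min; have b1' := ltW b1.
have csol y : z <= y -> y <= b -> [/\ {for y, continuous q}, {for y, continuous dq},
    {for y, continuous m} & {for y, continuous dm}].
  by move=> y1 y2; apply: (sol_continuous sol); [lin z0 y1|lin y2 b1].
have [y y1 y2|||a [za ab qa ha]] := @first_hit_left _ (fun y => 4 * q y - 1) z b zb.
- by have [? _ _ _] := csol y y1 y2; cont.
- by lin qb4.
- by lin qz.
have aN1 : -1 <= a by lin z0 za.
have a0 : 0 <= a by lin z0 za.
have a1 : a <= 1 by lin ab b1.
have bN1 : -1 <= b by lin aN1 ab.
have qa4 : 4 * q a = 1 by lin qa.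
have mge := m_ge0_left l0 c0 sol min bN1 b1 mb.
have [Cq _ _ _] := sol_C1 sol aN1 b1'.
have qrange y : a <= y -> y <= b -> - (1 / 2) <= q y /\ q y <= 1 / 4.
  move=> y1 y2; split; last first.
    move: y1; rewrite le_eqVlt => /predU1P[<-|y1]; first by lin qa4.
    by have h := ha y y1 y2; lin h.
  apply: le_trans (ltW qb) _.
  apply: (@nonincreasing_derive _ q dq) => // x x1 x2.
    by case: (Cq x (le_trans y1 x1) x2).
  apply: (dq_le0 l0 c0 sol qN1 q1).
  - exact: le_trans aN1 (le_trans y1 (ltW x1)).
  - exact: le_trans (ltW x2) b1'.
  - by have h := ha x (le_lt_trans y1 x1) (ltW x2); lin h.
have [y y1 y2|||b' [ab' b'b fb' hb']] :=
  @first_hit_left _ (fun y => m y / 2 + - (1 / 6 * (1 + - (4 * q y)))) a b (ltW ab).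
- by have [? _ ? _] := csol y (le_trans za y1) y2; cont.
- by rewrite mb; lin qb4.
- by have h := mge a aN1 (ltW ab); lin h qa4.
have b'N1 : -1 <= b' := le_trans aN1 ab'.
have b'1 : b' <= 1 := le_trans (ltW b'b) b1'.
have hmid y : b' <= y -> y <= b ->
    [/\ 0 <= m y, - (1 / 2) <= q y & m y / 2 <= 1 / 6 * (1 - 4 * q y)].
  move=> y1 y2; split; first exact: mge (le_trans b'N1 y1) y2.
    exact: (qrange y (le_trans ab' y1) y2).1.
  move: y1; rewrite le_eqVlt => /predU1P[<-|y1]; first by lin fb'.
  by have h := hb' y y1 y2; lin h.
have S1 := seg_middle l0 c0 sol hH b'N1 b'b b1' hmid.
have S2 := seg_wall l0 c0 sol qN1 q1 m1 hH (3 / eta) bN1 b1 hwall.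
rewrite /= mb in S1 S2.
have e1 : m b' + (1 / 6 * (1 - 4 * q b') - m b' / 2) = m b' by lin fb'.
rewrite e1 (_ : 0 + (1 / 6 * (1 - 4 * q b) - 0 / 2) = 1 / 6 * (1 - 4 * q b)) in S1;
  last by ring.
rewrite subr0 add0r in S2.
have S3 : seg l c q m (-1) b' 0 0 (2 * (q b' + 1 / 6 * (1 - 4 * q b'))) (m b')
    (flux l dq dm b' (2 * (q b' + 1 / 6 * (1 - 4 * q b'))) (m b') + l * rotation_bound c / 2).
  have ea : 2 * (q a + 1 / 6 * (1 - 4 * q a)) = 2 * q a by rewrite qa4; ring.
  have SR := seg_rotation_minimiser l0 c0 sol min a0 a1.
  move: ab'; rewrite le_eqVlt => /predU1P[<-|ab']; first by rewrite ea.
  have qr y : a <= y -> y <= b' -> - (1 / 2) <= q y /\ q y <= 1 / 4.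
    by move=> y1 y2; exact: qrange y1 (le_trans y2 (ltW b'b)).
  have := seg_upper l0 c0 sol aN1 ab' b'1 qr.
  rewrite /= ea => SU; apply: seg_le (seg_glue sol (lexx _) b'1 SR SU).
  by lin.
have := seg_glue sol (lexx _) (lexx 1) (seg_glue sol (lexx _) b1' S3 S1) S2.
set k := (X in seg _ _ _ _ _ _ _ _ _ _ X) => S'; exists k => //.
have y3 : 3 <= 5 + 4 * q b + 0 by lin qb.
have b1e : 1 - b <= eta by lin eb.
have h := gain_wall l0 eta0 etaK y3 b1e.
by rewrite /k; lin h.
Qed.

(** b is the last point before the wall outside the region m < 0, 4 q + m < 1, and a nearly bulk
    point keeps it within eta of the wall. Either 4 q + m = 1 at b and the wall piece joins the
    rotation field directly, or m = 0 there and the value of q decides the continuation. *)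
Lemma seg_negative (l c : R) (q dq m dm : R -> R) (eta : R) : 0 < l -> 0 < c ->
  solution l c q dq m dm -> minimiser_OR l c q m ->
  c + c ^+ 2 <= ham l c q dq m dm (-1) ->
  0 < eta -> rotation_bound c * (101 * eta) = 1 ->
  (forall a, -1 <= a -> a + eta <= 1 ->
    exists y, [/\ a <= y, y <= a + eta, 1 < q y & 0 <= m y \/ 1 <= 4 * q y + m y]) ->
  exists2 k, k < 0 & seg l c q m (-1) 1 0 0 0 0 k.
Proof.
move=> l0 c0 sol min hH eta0 etaK bulk_points; have esm := eta_small c0 eta0 etaK.
have [[_ _ [qN1 mN1] [q1 m1]] _] := min.
have e1 : -1 <= 1 - eta by lin esm eta0.
have e2 : 1 - eta + eta <= 1 by lin.
have [z [z1 z2 qz hz]] := bulk_points _ e1 e2.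
have {}z2 : z <= 1 by lin z2.
have z0 : 0 <= z by lin z1 esm eta0.
pose f y := Num.max (m y) (4 * q y + m y - 1).
have cf y : z <= y -> y <= 1 -> {for y, continuous f}.
  move=> y1 y2; have yN1 : -1 <= y by lin z0 y1.
  have [? _ ? _] := sol_continuous sol yN1 y2.
  by apply: (@continuous_max _ _ m (fun y => 4 * q y + m y - 1) y) => //; cont.
have [//|||b [zb b1 fb hb]] := @first_hit_left _ f z 1 z2.
- by rewrite /f q1 m1 gt_max; apply/andP; split; lin.
- by rewrite /f le_max; case: hz => hz; apply/orP; [left|right]; [exact: hz|lin hz].
have b0 : 0 <= b by lin z0 zb.
have bN1 : -1 <= b by lin b0.
have b1' := ltW b1.
have eb : 1 - eta <= b by lin z1 zb.
have hwall y : b < y -> y <= 1 -> m y < 0 /\ 4 * q y + m y <= 1.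
  move=> y1 y2; have := hb y y1 y2; rewrite /f gt_max => /andP[? h]; split=> //.
  by lin h.
have [mb qb] : m b <= 0 /\ 4 * q b + m b <= 1.
  have : f b <= 0 by rewrite fb.
  by rewrite /f ge_max => /andP[? h]; split=> //; lin h.
have [eA|nA] := eqVneq (4 * q b + m b) 1.
  have SW := seg_wall l0 c0 sol qN1 q1 m1 hH (3 / eta) bN1 b1 hwall.
  have phi0 : 1 / 6 * (1 - 4 * q b - m b) = 0 by lin eA.
  rewrite phi0 !addr0 in SW.
  have := seg_glue sol (lexx _) (lexx 1) (seg_rotation_minimiser l0 c0 sol min b0 b1') SW.
  set k := (X in seg _ _ _ _ _ _ _ _ _ _ X) => S'; exists k => //.
  have y3 : 3 <= 5 + 4 * q b + m b by lin eA.
  have b1e : 1 - b <= eta by lin eb.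
  have h := gain_wall l0 eta0 etaK y3 b1e.
  by rewrite /k; lin h.
have mb0 : m b = 0.
  have : ~~ (f b < 0) by rewrite fb ltxx.
  rewrite /f gt_max negb_and -!leNgt => /orP[h|h]; first by apply/eqP; rewrite eq_le mb.
  by case/eqP: nA; lin h qb.
have qb4 : 4 * q b < 1 by rewrite lt_neqAle; move: nA qb; rewrite mb0 addr0 => -> ->.
have e3 : -1 <= 1 - 2 * eta by lin esm.
have e4 : 1 - 2 * eta + eta <= 1 by lin eta0.
have [z' [z'1 z'2 qz' _]] := bulk_points _ e3 e4.
have z'b : z' <= b by lin z'2 eb.
have z'0 : 0 <= z' by lin z'1 esm.
have [qlow|qlow] := leP (q b) (- (1 / 2)).
  exact: (seg_negative_low l0 c0 sol min eta0 etaK z'0 z'1 z'b b1 qz').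
exact: (seg_negative_middle l0 c0 sol min hH eta0 etaK z'0 eb z'b b1 qz').
Qed.

End Assembly.

Theorem theorem3p3 (R : realType) (c : R) (hc : 0 < c) :
  exists l0 : R, 0 < l0 /\
    forall l : R, 0 < l -> l < l0 ->
    forall Q11 M1 : R -> R,
      minimiser_OR l c Q11 M1 ->
      unstable_critical_point l c Q11 (fun=> 0) M1 (fun=> 0).
Proof.
(* With tangent constant 3 / eta, a drop of 3 over a width eta gains 9 l / (1800 eta) = l / (200
   eta). The cut-off costs l / (202 eta) for this eta: 101 is the first integer beyond
   break-even. *)
pose eta := (rotation_bound c * 101)^-1.
have K0 : 0 < rotation_bound c.
  rewrite /rotation_bound; have := sqr_ge0 (1 + c); have := sqr_ge0 c; lra.
have eta0 : 0 < eta by rewrite invr_gt0 mulr_gt0// ltr0n.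
have etaK : rotation_bound c * (101 * eta) = 1.
  by rewrite mulrA mulfV// gt_eqF// mulr_gt0// ltr0n.
have eta2 : eta <= 2 by have := eta_small hc eta0 etaK; lra.
have [l0 [l00 hl]] := small_points hc eta0 eta2.
exists l0; split=> // l lp ll Q M min.
have [q [dq [m [dm [Qq Mm sol min']]]]] := classical_minimiser lp min.
have [hH pts] := hl l q dq m dm lp ll sol min'.
split; first exact: minimiser_critical.
have [b b0 [h [dh [w [dw [ph pw [h1 w1] [h2 w2] le]]]]]] :=
  seg_negative lp hc sol min' hH eta0 etaK pts.
have [[wQ wM _ _] _] := min.
apply: (unstable_of_dens wQ wM ph pw) => //.
apply: le_lt_trans b0; apply: le_trans le; rewrite le_eqVlt; apply/orP; left; apply/eqP.
by apply: eq_Rint => y y1 y2; rewrite /sdens Qq// Mm.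
Qed.
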